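(* Let $n\ge 3$ and let $\mathcal{G}$ be an $n$-dimensional real solvable Lie algebra whose derived ideal $\mathcal{G}^1=[\mathcal{G},\mathcal{G}]$ is 2-dimensional. Assume that $\mathcal{G}$ is not 2-step nilpotent. Then one can choose a basis $(X_1,X_2,\ldots,X_n)$ of $\mathcal{G}$ such that $\mathcal{G}^1=\mathrm{Span}\{X_1,X_2\}\cong\mathbb{R}^2$ and the following assertions hold (all operators $a_{X_i}$ and brackets $[X_i,X_j]$, $i,j\ge 3$, not listed are zero). (1) Assume that $\mathcal{G}$ is indecomposable. (1.1) If $n=3$, then the Lie structure of $\mathcal{G}$ is completely determined by the operator $a_{X_3}\in\mathrm{Aut}\,\mathcal{G}^1\equiv \mathrm{GL}_2(\mathbb{R})$, and $\mathcal{G}$ is isomorphic to one and only one of the following Lie algebras: (i) $\mathcal{G}_{3,2.1(\lambda)}$: $a_{X_3}=\begin{bmatrix}1&0\\0&\lambda\end{bmatrix}$ with $\lambda\in\mathbb{R}\setminus\{0\}$; (ii) $\mathcal{G}_{3,2.2}$: $a_{X_3}=\begin{bmatrix}1&1\\0&1\end{bmatrix}$; (iii) $\mathcal{G}_{3,2.3(\varphi)}$: $a_{X_3}=\begin{bmatrix}\cos\varphi&-\sin\varphi\\ \sin\varphi&\cos\varphi\end{bmatrix}$ with $\varphi\in(0,\pi)$. (1.2) If $n=4$, then the Lie structure of $\mathcal{G}$ is defined by $[X_3,X_4]$ and the two operators $a_{X_3},a_{X_4}\in\mathrm{End}\,\mathcal{G}^1\equiv \mathrm{Mat}_2(\mathbb{R})$,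 and $\mathcal{G}$ is isomorphic to one and only one of the following Lie algebras: (i) $\mathcal{G}_{4,2.1}$: $a_{X_3}=\begin{bmatrix}1&0\\0&0\end{bmatrix}$ and $[X_3,X_4]=X_2$; (ii) $\mathcal{G}_{4,2.2}$: $a_{X_3}=\begin{bmatrix}0&1\\0&0\end{bmatrix}$ and $[X_3,X_4]=X_2$; (iii) $\mathcal{G}_{4,2.3(\lambda)}$: $a_{X_3}=\begin{bmatrix}0&1\\0&\lambda\end{bmatrix}$ and $a_{X_4}=\begin{bmatrix}1&0\\0&1\end{bmatrix}$, with $\lambda\in\mathbb{R}$; (iv) $\mathcal{G}_{4,2.4}=\mathrm{aff}(\mathbb{C})$. (1.3) If $n=5+2k$ with $k\ge 0$, then $\mathcal{G}\cong\mathcal{G}_{5+2k,2}$: $a_{X_3}=\begin{bmatrix}0&0\\1&0\end{bmatrix}$, $[X_3,X_4]=X_1$, and $[X_{4+2i},X_{5+2i}]=X_2$ for $i=0,1,\ldots,k$. (1.4) If $n=6+2k$ with $k\ge 0$, then $\mathcal{G}$ is isomorphic to one and only one of the following Lie algebras: (i) $\mathcal{G}_{6+2k,2.1}$: $a_{X_3}=\begin{bmatrix}1&0\\0&0\end{bmatrix}$, $[X_3,X_4]=X_2$, and $[X_{5+2i},X_{6+2i}]=X_2$ for $i=0,1,\ldots,k$; (ii) $\mathcal{G}_{6+2k,2.2}$: $a_{X_3}=\begin{bmatrix}0&0\\1&0\end{bmatrix}$, $[X_3,X_4]=X_1$, and $[X_{5+2i},X_{6+2i}]=X_2$ for $i=0,1,\ldots,k$.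 (2) Assume that $\mathcal{G}$ is decomposable. Then one of the following holds: (2.1) $\mathcal{G}\cong\mathrm{aff}(\mathbb{R})\oplus\mathrm{aff}(\mathbb{R})$ (when $n=4$), or $\mathcal{G}\cong\mathrm{aff}(\mathbb{R})\oplus\mathrm{aff}(\mathbb{R})\oplus\mathbb{R}^{n-4}$ (when $n>4$); (2.2) for some $m\ge 1$, $\mathcal{G}\cong\mathrm{aff}(\mathbb{R})\oplus\mathfrak{h}_{2m+1}$ (when $n=2m+3$), or $\mathcal{G}\cong\mathrm{aff}(\mathbb{R})\oplus\mathfrak{h}_{2m+1}\oplus\mathbb{R}^{n-2m-3}$ (when $n>2m+3$); (2.3) $\mathcal{G}$ is isomorphic to a trivial extension by a commutative Lie algebra of one of the Lie algebras listed in part (1).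
   Context: For a real Lie algebra $\mathcal{G}$ and $X\in\mathcal{G}$, $\mathcal{G}^1:=[\mathcal{G},\mathcal{G}]$ and $a_X:=\mathrm{ad}_X|_{\mathcal{G}^1}$ is the restriction of $\mathrm{ad}_X$ to $\mathcal{G}^1$. When a basis $(X_1,X_2)$ of the 2-dimensional ideal $\mathcal{G}^1$ is fixed, $a_X$ is identified with its matrix in that basis, the $j$-th column being the coordinates of $[X,X_j]$. In each description of a Lie algebra with basis $(X_1,\ldots,X_n)$, $[X_1,X_2]=0$, and all Lie brackets not determined by the listed data are zero. $\mathcal{G}$ is 2-step nilpotent if $[\mathcal{G},\mathcal{G}]\ne 0$ and $[\mathcal{G},[\mathcal{G},\mathcal{G}]]=0$. A Lie algebra is decomposable if it is the (Lie algebra) direct sum of two non-trivial subalgebras, and indecomposable otherwise. $\mathbb{R}^k$ is the $k$-dimensional commutative Lie algebra; a trivial extension of $\mathcal{H}$ by a commutative Lie algebra is a direct sum $\mathcal{H}\oplus\mathbb{R}^k$, $k\ge1$. $\mathrm{aff}(\mathbb{R})$ is the 2-dimensional Lie algebra $\mathrm{Span}\{X,Y\}$ with $[X,Y]=Y$. $\mathrm{aff}(\mathbb{C})$ is the 4-dimensional real Lie algebra $\mathrm{Span}\{X,Y,Z,T\}$ with non-zero brackets $[Z,X]=-Y$, $[Z,Y]=X$, $[T,X]=X$, $[T,Y]=Y$. $\mathfrak{h}_{2m+1}=\mathrm{Span}\{X_i,Y_i,Z : i=1,\ldots,m\}$ ($m\ge1$) is the real Heisenberg Lie algebra with non-zero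 brackets $[X_i,Y_i]=Z$. *)

(* Defs.v *)
From HB Require Import structures.
From mathcomp Require Import all_boot all_order all_algebra.
From mathcomp Require Import reals trigo ring.

Set Implicit Arguments.
Unset Strict Implicit.
Unset Printing Implicit Defensive.

Import Order.TTheory GRing.Theory Num.Theory.
Local Open Scope ring_scope.

HB.mixin Record Vector_isLieAlgebra (K : fieldType) L of Vector K L := {
  lie : L -> L -> L;
  lie_linearl : forall a x y z, lie (a *: x + y) z = a *: lie x z + lie y z;
  lie_linearr : forall a x y z, lie z (a *: x + y) = a *: lie z x + lie z y;
  liexx : forall x, lie x x = 0;
  lie_jacobi : forall x y z,
    lie x (lie y z) + lie y (lie z x) + lie z (lie x y) = 0
}.

#[short(type="lieAlgType")]
HB.structure Definition LieAlgebra (K : fieldType) :=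
  {L of Vector K L & Vector_isLieAlgebra K L}.

Notation "[ 'lie' x , y ]" := (lie x y)
  (at level 0, format "[ 'lie'  x ,  y ]") : ring_scope.

Section LieTheory.
Context {K : fieldType}.

Section Subspaces.
Context {L : lieAlgType K}.
Implicit Types U V W : {vspace L}.

(* The span [U, V] of all brackets, computed on bases of U and V; see
   memv_lie_prod and lie_prod_subP. *)
Definition lie_prod U V : {vspace L} :=
  <<[seq [lie u, v] | u <- vbasis U, v <- vbasis V]>>%VS.

Lemma lie_sum_l I (r : seq I) (F : I -> L) y :
  [lie \sum_(i <- r) F i, y] = \sum_(i <- r) [lie F i, y].
Proof.
have l0 z : lie (0 : L) z = 0.
  by have := lie_linearl (-1) (0 : L) 0 z; rewrite scaler0 addr0 scaleN1r addNr.
elim: r => [|i r IH]; first by rewrite !big_nil.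
by rewrite !big_cons -IH -[F i]scale1r lie_linearl !scale1r.
Qed.

Lemma lie_sum_r I (r : seq I) (F : I -> L) y :
  [lie y, \sum_(i <- r) F i] = \sum_(i <- r) [lie y, F i].
Proof.
have l0 z : lie z (0 : L) = 0.
  by have := lie_linearr (-1) (0 : L) 0 z; rewrite scaler0 addr0 scaleN1r addNr.
elim: r => [|i r IH]; first by rewrite !big_nil.
by rewrite !big_cons -IH -[F i]scale1r lie_linearr !scale1r.
Qed.

Lemma lie_scale_l a (x y : L) : [lie a *: x, y] = a *: [lie x, y].
Proof.
have := lie_linearl a x 0 y; rewrite addr0 => ->.
by have := lie_sum_l [::] id y; rewrite !big_nil => ->; rewrite addr0.
Qed.

Lemma lie_scale_r a (x y : L) : [lie y, a *: x] = a *: [lie y, x].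
Proof.
have := lie_linearr a x 0 y; rewrite addr0 => ->.
by have := lie_sum_r [::] id y; rewrite !big_nil => ->; rewrite addr0.
Qed.

Lemma memv_lie_prod U V u v :
  u \in U -> v \in V -> [lie u, v] \in lie_prod U V.
Proof.
move=> /coord_vbasis-> /coord_vbasis->.
rewrite lie_sum_l memv_suml // => i _; rewrite lie_sum_r memv_suml // => j _.
rewrite lie_scale_l lie_scale_r !memvZ // memv_span //.
by apply: allpairs_f; rewrite memt_nth.
Qed.

Lemma lie_prod_subP U V W :
  reflect (forall u v, u \in U -> v \in V -> [lie u, v] \in W)
          (lie_prod U V <= W)%VS.
Proof.
apply: (iffP idP) => [sW u v uU vV|UVW].
  exact: (subvP sW _ (memv_lie_prod uU vV)).
by apply/span_subvP=> _ /allpairsP[[u v] /= [Uu Vv ->]];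
  apply: UVW; exact: vbasis_mem.
Qed.

End Subspaces.

Definition derived (L : lieAlgType K) : {vspace L} := lie_prod fullv fullv.

Definition derived_series (L : lieAlgType K) (k : nat) : {vspace L} :=
  iter k (fun U => lie_prod U U) fullv.

Definition solvable_lie (L : lieAlgType K) : Prop :=
  exists k, derived_series L k = 0%VS.

Definition nilpotent2 (L : lieAlgType K) : Prop :=
  derived L <> 0%VS /\ lie_prod fullv (derived L) = 0%VS.

Definition decomposable (L : lieAlgType K) : Prop :=
  exists U V : {vspace L},
    [/\ U <> 0%VS /\ V <> 0%VS,
        (lie_prod U U <= U)%VS /\ (lie_prod V V <= V)%VS,
        lie_prod U V = 0%VS,
        (U + V = fullv)%VS & (U :&: V = 0)%VS].

Definition lie_morph (L M : lieAlgType K) (f : L -> M) : Prop :=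
  forall x y, f [lie x, y] = [lie f x, f y].

Definition lie_iso (L M : lieAlgType K) : Prop :=
  exists2 f : {linear L -> M}, bijective f & lie_morph f.

(* The subspace U of L is a subalgebra isomorphic to M. *)
Definition subalg_iso (L : lieAlgType K) (U : {vspace L}) (M : lieAlgType K) :
    Prop :=
  exists f : {linear M -> L},
    [/\ injective f, lie_morph f & forall v, v \in U <-> exists x, f x = v].

(* Bases are 0-indexed sequences; bvec X i is X_i with indices from 1. *)
Definition bvec (L : lieAlgType K) (X : seq L) (i : nat) : L := X`_i.-1.

Definition adapted (L : lieAlgType K) (X : seq L) : Prop :=
  [/\ basis_of fullv X,
      derived L = <<[:: bvec X 1; bvec X 2]>>%VS
    & [lie bvec X 1, bvec X 2] = 0].

(* The coordinates in (X_1, X_2) of an element of <X_1, X_2>. *)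
Definition g1coord (L : lieAlgType K) (X : seq L) (v : L) : 'cV[K]_2 :=
  \col_i coord [tuple bvec X 1; bvec X 2] i v.

(* The matrix in (X_1, X_2) of the restriction a_x of ad_x. *)
Definition a_mx (L : lieAlgType K) (X : seq L) (x : L) : 'M[K]_2 :=
  \matrix_(i, j) g1coord X [lie x, bvec X j.+1] i 0.

Definition basis_iso (L M : lieAlgType K) (X : seq L) (Y : seq M) : Prop :=
  exists f : {linear L -> M}, [/\ bijective f, lie_morph f & map f X = Y].

End LieTheory.

Section DirectSum.
Context (K : fieldType) (L M : lieAlgType K).

Definition prod_lie (x y : L * M) : L * M := ([lie x.1, y.1], [lie x.2, y.2]).

Fact prod_lie_linearl a x y z :
  prod_lie (a *: x + y) z = a *: prod_lie x z + prod_lie y z.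
Proof. by rewrite /prod_lie /= !lie_linearl. Qed.

Fact prod_lie_linearr a x y z :
  prod_lie z (a *: x + y) = a *: prod_lie z x + prod_lie z y.
Proof. by rewrite /prod_lie /= !lie_linearr. Qed.

Fact prod_liexx x : prod_lie x x = 0.
Proof. by rewrite /prod_lie !liexx. Qed.

Fact prod_lie_jacobi x y z :
  prod_lie x (prod_lie y z) + prod_lie y (prod_lie z x)
    + prod_lie z (prod_lie x y) = 0.
Proof. by apply: injective_projections; rewrite /= lie_jacobi. Qed.

HB.instance Definition _ := Vector_isLieAlgebra.Build K (L * M)%type
  prod_lie_linearl prod_lie_linearr prod_liexx prod_lie_jacobi.

End DirectSum.

Definition abel (K : fieldType) (k : nat) : Type := 'rV[K]_k.

Section Abelian.
Context (K : fieldType) (k : nat).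
HB.instance Definition _ := Vector.copy (abel K k) 'rV[K]_k.

Definition abel_lie (x y : abel K k) : abel K k := 0.

Fact abel_lie_linearl a x y z :
  abel_lie (a *: x + y) z = a *: abel_lie x z + abel_lie y z.
Proof. by rewrite scaler0 addr0. Qed.

Fact abel_lie_linearr a x y z :
  abel_lie z (a *: x + y) = a *: abel_lie z x + abel_lie z y.
Proof. by rewrite scaler0 addr0. Qed.

Fact abel_liexx x : abel_lie x x = 0. Proof. by []. Qed.

Fact abel_lie_jacobi x y z :
  abel_lie x (abel_lie y z) + abel_lie y (abel_lie z x)
    + abel_lie z (abel_lie x y) = 0.
Proof. by rewrite !addr0. Qed.

HB.instance Definition _ := Vector_isLieAlgebra.Build K (abel K k)
  abel_lie_linearl abel_lie_linearr abel_liexx abel_lie_jacobi.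
End Abelian.

(* aff(K), with X = (1, 0) and Y = (0, 1) *)
Definition aff (K : fieldType) : Type := (K^o * K^o)%type.

Section Aff.
Context (K : fieldType).
HB.instance Definition _ := Vector.copy (aff K) (K^o * K^o)%type.

Definition aff_lie (x y : aff K) : aff K :=
  (0, (x.1 : K) * (y.2 : K) - (x.2 : K) * (y.1 : K)).

Fact aff_lie_linearl a x y z :
  aff_lie (a *: x + y) z = a *: aff_lie x z + aff_lie y z.
Proof.
apply: injective_projections; first by rewrite /= scaler0 addr0.
case: x y z => [x1 x2] [y1 y2] [z1 z2].
change ((a * x1 + y1) * z2 - (a * x2 + y2) * z1 =
        a * (x1 * z2 - x2 * z1) + (y1 * z2 - y2 * z1) :> K); ring.
Qed.

Fact aff_lie_linearr a x y z :
  aff_lie z (a *: x + y) = a *: aff_lie z x + aff_lie z y.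
Proof.
apply: injective_projections; first by rewrite /= scaler0 addr0.
case: x y z => [x1 x2] [y1 y2] [z1 z2].
change (z1 * (a * x2 + y2) - z2 * (a * x1 + y1) =
        a * (z1 * x2 - z2 * x1) + (z1 * y2 - z2 * y1) :> K); ring.
Qed.

Fact aff_liexx x : aff_lie x x = 0.
Proof.
case: x => [x1 x2]; apply: injective_projections; first by [].
change (x1 * x2 - x2 * x1 = 0 :> K); ring.
Qed.

Fact aff_lie_jacobi x y z :
  aff_lie x (aff_lie y z) + aff_lie y (aff_lie z x)
    + aff_lie z (aff_lie x y) = 0.
Proof.
apply: injective_projections; first by rewrite /= !addr0.
case: x y z => [x1 x2] [y1 y2] [z1 z2].
change (x1 * (y1 * z2 - y2 * z1) - x2 * 0 + (y1 * (z1 * x2 - z2 * x1) - y2 * 0)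
        + (z1 * (x1 * y2 - x2 * y1) - z2 * 0) = 0 :> K); ring.
Qed.

HB.instance Definition _ := Vector_isLieAlgebra.Build K (aff K)
  aff_lie_linearl aff_lie_linearr aff_liexx aff_lie_jacobi.
End Aff.

(* The Heisenberg algebra of dimension 2m+1: ((x, y), z) stands for
   \sum_i x_i X_i + \sum_i y_i Y_i + z Z. *)
Definition heis (K : fieldType) (m : nat) : Type :=
  ('rV[K]_m * 'rV[K]_m * K^o)%type.

Section Heisenberg.
Context (K : fieldType) (m : nat).
HB.instance Definition _ := Vector.copy (heis K m)
  ('rV[K]_m * 'rV[K]_m * K^o)%type.

Definition heis_form (u v : 'rV[K]_m * 'rV[K]_m) : K :=
  \sum_(i < m) (u.1 0 i * v.2 0 i - v.1 0 i * u.2 0 i).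

Definition heis_lie (x y : heis K m) : heis K m := (0, heis_form x.1 y.1).

Fact heis_lie_linearl a x y z :
  heis_lie (a *: x + y) z = a *: heis_lie x z + heis_lie y z.
Proof.
apply: injective_projections; first by rewrite /= scaler0 addr0.
change (heis_form (a *: x.1 + y.1) z.1 =
        a * heis_form x.1 z.1 + heis_form y.1 z.1).
rewrite /heis_form mulr_sumr -big_split /=; apply: eq_bigr => i _.
by rewrite !mxE; ring.
Qed.

Fact heis_lie_linearr a x y z :
  heis_lie z (a *: x + y) = a *: heis_lie z x + heis_lie z y.
Proof.
apply: injective_projections; first by rewrite /= scaler0 addr0.
change (heis_form z.1 (a *: x.1 + y.1) =
        a * heis_form z.1 x.1 + heis_form z.1 y.1).
rewrite /heis_form mulr_sumr -big_split /=; apply: eq_bigr => i _.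
by rewrite !mxE; ring.
Qed.

Fact heis_liexx x : heis_lie x x = 0.
Proof.
apply: injective_projections => //.
by rewrite /= /heis_form big1 // => i _; rewrite subrr.
Qed.

Fact heis_lie_jacobi x y z :
  heis_lie x (heis_lie y z) + heis_lie y (heis_lie z x)
    + heis_lie z (heis_lie x y) = 0.
Proof.
have h u v w : heis_lie u (heis_lie v w) = 0.
  apply: injective_projections => //=.
  by rewrite /heis_form big1 // => i _; rewrite !mxE mulr0 mul0r subr0.
by rewrite !h !addr0.
Qed.

HB.instance Definition _ := Vector_isLieAlgebra.Build K (heis K m)
  heis_lie_linearl heis_lie_linearr heis_liexx heis_lie_jacobi.
End Heisenberg.

(* Indices are those of X_1, ..., X_n: g2op i is the matrix of a_{X_i} in
   (X_1, X_2), and g2br i j the coordinates of [X_i, X_j] in (X_1, X_2). Only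
   the indices 3 <= i, j <= n matter. *)
Record g2data (K : fieldType) : Type := G2Data {
  g2op : nat -> 'M[K]_2;
  g2br : nat -> nat -> 'cV[K]_2;
  g2brxx : forall i, g2br i i = 0;
  g2brC : forall i j, g2br i j = - g2br j i;
  g2opC : forall i j, g2op i *m g2op j = g2op j *m g2op i;
  g2cocycle : forall i j k,
    g2op i *m g2br j k + g2op j *m g2br k i + g2op k *m g2br i j = 0
}.

(* The n-dimensional Lie algebra with data d, for n >= 2: (u, x) stands for
   u_0 X_1 + u_1 X_2 + \sum_i x_i X_(i+3). *)
Definition g2alg (K : fieldType) (n : nat) (d : g2data K) : Type :=
  ('cV[K]_2 * 'cV[K]_(n - 2))%type.

Section G2Algebra.
Context (K : fieldType) (n : nat) (d : g2data K).
HB.instance Definition _ := Vector.copy (g2alg n d)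
  ('cV[K]_2 * 'cV[K]_(n - 2))%type.

Definition g2ad (x : 'cV[K]_(n - 2)) : 'M[K]_2 :=
  \sum_i x i 0 *: g2op d i.+3.

Definition g2form (x y : 'cV[K]_(n - 2)) : 'cV[K]_2 :=
  \sum_i \sum_j (x i 0 * y j 0) *: g2br d i.+3 j.+3.

Definition g2lie (x y : g2alg n d) : g2alg n d :=
  (g2ad x.2 *m y.1 - g2ad y.2 *m x.1 + g2form x.2 y.2, 0).

Fact g2ad_linear a x y : g2ad (a *: x + y) = a *: g2ad x + g2ad y.
Proof.
rewrite /g2ad scaler_sumr -big_split; apply: eq_bigr => i _ /=.
by rewrite !mxE scalerDl scalerA.
Qed.

Fact g2form_linearl a x y z :
  g2form (a *: x + y) z = a *: g2form x z + g2form y z.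
Proof.
rewrite /g2form scaler_sumr -big_split; apply: eq_bigr => i _ /=.
rewrite scaler_sumr -big_split; apply: eq_bigr => j _ /=.
by rewrite !mxE scalerA -scalerDl mulrDl mulrA.
Qed.

Fact g2formC x y : g2form x y = - g2form y x.
Proof.
rewrite /g2form exchange_big /= -sumrN; apply: eq_bigr => i _ /=.
by rewrite -sumrN; apply: eq_bigr => j _; rewrite g2brC scalerN mulrC.
Qed.

Fact g2formxx x : g2form x x = 0.
Proof.
have off (i j : 'I_(n - 2)) :
    (x i 0 * x j 0) *: g2br d i.+3 j.+3 =
    - ((x j 0 * x i 0) *: g2br d j.+3 i.+3).
  by rewrite g2brC scalerN mulrC.
rewrite /g2form.
rewrite (eq_bigr (fun i : 'I_(n - 2) =>
   \sum_(j < n - 2 | (j < i)%N) (x i 0 * x j 0) *: g2br d i.+3 j.+3 +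
   \sum_(j < n - 2 | (i < j)%N) (x i 0 * x j 0) *: g2br d i.+3 j.+3)); last first.
  move=> i _; rewrite (bigID (fun j : 'I_(n - 2) => (j < i)%N)) /=; congr (_ + _).
  rewrite (bigD1 i) ?ltnn //= g2brxx scaler0 add0r; apply: eq_bigl => j.
  by rewrite -leqNgt ltn_neqAle andbC eq_sym.
rewrite big_split /= [X in _ + X](exchange_big_dep predT) //= -big_split /=.
rewrite big1 // => i _; rewrite -big_split big1 // => j _ /=.
by rewrite off addNr.
Qed.

Fact g2lieC x y : g2lie x y = - g2lie y x.
Proof.
apply: injective_projections; rewrite /= ?oppr0 //.
by rewrite g2formC !opprD opprK [- _ + _ in RHS]addrC.
Qed.

Fact g2lie_linearl a x y z :
  g2lie (a *: x + y) z = a *: g2lie x z + g2lie y z.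
Proof.
apply: injective_projections; rewrite /= ?scaler0 ?addr0 //.
rewrite g2ad_linear g2form_linearl mulmxDl mulmxDr -scalemxAl -scalemxAr.
rewrite !scalerDr scalerN opprD [X in X + _ = _]addrACA.
exact: addrACA.
Qed.

Fact g2lie_linearr a x y z :
  g2lie z (a *: x + y) = a *: g2lie z x + g2lie z y.
Proof.
by rewrite g2lieC g2lie_linearl opprD -scalerN -!g2lieC.
Qed.

Fact g2liexx x : g2lie x x = 0.
Proof. by apply: injective_projections; rewrite /= ?subrr ?add0r ?g2formxx. Qed.

Fact g2adC x y : g2ad x *m g2ad y = g2ad y *m g2ad x.
Proof.
rewrite /g2ad !mulmx_suml.
under eq_bigr do rewrite mulmx_sumr.
rewrite exchange_big /=; apply: eq_bigr => j _.
rewrite mulmx_sumr; apply: eq_bigr => i _.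
by rewrite -!scalemxAl -!scalemxAr g2opC !scalerA mulrC.
Qed.

Fact g2ad_form x y z : g2ad x *m g2form y z =
  \sum_i \sum_j \sum_k
    (x i 0 * y j 0 * z k 0) *: (g2op d i.+3 *m g2br d j.+3 k.+3).
Proof.
rewrite /g2ad mulmx_suml; apply: eq_bigr => i _.
rewrite mulmx_sumr; apply: eq_bigr => j _.
rewrite mulmx_sumr; apply: eq_bigr => k _.
by rewrite -scalemxAl -scalemxAr scalerA mulrA.
Qed.

Fact g2form_cocycle x y z :
  g2ad x *m g2form y z + g2ad y *m g2form z x + g2ad z *m g2form x y = 0.
Proof.
rewrite !g2ad_form.
have -> : \sum_i \sum_j \sum_k
    (y i 0 * z j 0 * x k 0) *: (g2op d i.+3 *m g2br d j.+3 k.+3) =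
  \sum_i \sum_j \sum_k
    (x i 0 * y j 0 * z k 0) *: (g2op d j.+3 *m g2br d k.+3 i.+3).
  under eq_bigr do rewrite exchange_big /=.
  rewrite exchange_big /=; apply: eq_bigr => i _; apply: eq_bigr => j _.
  by apply: eq_bigr => k _; rewrite mulrC mulrA.
have -> : \sum_i \sum_j \sum_k
    (z i 0 * x j 0 * y k 0) *: (g2op d i.+3 *m g2br d j.+3 k.+3) =
  \sum_i \sum_j \sum_k
    (x i 0 * y j 0 * z k 0) *: (g2op d k.+3 *m g2br d i.+3 j.+3).
  rewrite exchange_big /=; apply: eq_bigr => i _; rewrite exchange_big /=.
  apply: eq_bigr => j _; apply: eq_bigr => k _.
  by rewrite -mulrA [in LHS]mulrC.
rewrite -!big_split big1 // => i _; rewrite -!big_split big1 // => j _.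
by rewrite -!big_split big1 // => k _; rewrite /= -!scalerDr g2cocycle scaler0.
Qed.

Fact g2lie_jacobi x y z :
  g2lie x (g2lie y z) + g2lie y (g2lie z x) + g2lie z (g2lie x y) = 0.
Proof.
have a0 : g2ad 0 = 0 by rewrite /g2ad big1 // => i _; rewrite mxE scale0r.
have f0 u : g2form u 0 = 0.
  rewrite /g2form big1 // => i _; rewrite big1 // => j _.
  by rewrite mxE mulr0 scale0r.
apply: injective_projections; rewrite /= ?addr0 //.
rewrite a0 !f0 !mul0mx !subr0 !addr0 !mulmxDr !mulmxN !mulmxA.
rewrite (g2adC y.2 x.2) (g2adC z.2 x.2) (g2adC z.2 y.2).
rewrite -[RHS](g2form_cocycle x.2 y.2 z.2).
move: (g2ad x.2 *m g2ad y.2 *m z.1) (g2ad x.2 *m g2ad z.2 *m y.1).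
move: (g2ad y.2 *m g2ad z.2 *m x.1) (g2ad x.2 *m g2form y.2 z.2).
move: (g2ad y.2 *m g2form z.2 x.2) (g2ad z.2 *m g2form x.2 y.2) => P Q A S B C.
by apply/colP => i; rewrite !mxE; ring.
Qed.

HB.instance Definition _ := Vector_isLieAlgebra.Build K (g2alg n d)
  g2lie_linearl g2lie_linearr g2liexx g2lie_jacobi.
End G2Algebra.

(* The basis X of the Lie algebra L has the operators and brackets of d. *)
Definition g2basis (K : fieldType) (L : lieAlgType K) (X : seq L)
    (d : g2data K) : Prop :=
  (forall i, (3 <= i <= size X)%N -> a_mx X (bvec X i) = g2op d i) /\
  (forall i j, (3 <= i <= size X)%N -> (3 <= j <= size X)%N ->
     [lie bvec X i, bvec X j] =
       g2br d i j 0 0 *: bvec X 1 + g2br d i j 1 0 *: bvec X 2).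

Section Builders.
Context (K : fieldType).

Definition mx2 (a b c d : K) : 'M[K]_2 :=
  \matrix_(i, j) nth 0 (nth [::] [:: [:: a; b]; [:: c; d]] i) j.

Definition e1 : 'cV[K]_2 := delta_mx 0 0.
Definition e2 : 'cV[K]_2 := delta_mx 1 0.

Definition ops34 (A3 A4 : 'M[K]_2) (i : nat) : 'M[K]_2 :=
  if i == 3%N then A3 else if i == 4%N then A4 else 0.

(* The listed brackets only: [X_3, X_4], of coordinates v, and [X_i, X_j] = X_2
   for (i, j) in s; bralt is the antisymmetric completion. *)
Definition brlist (v : 'cV[K]_2) (s : seq (nat * nat)) (i j : nat) :
    'cV[K]_2 :=
  if (i, j) == (3, 4)%N then v else if (i, j) \in s then e2 else 0.

Definition bralt (v : 'cV[K]_2) (s : seq (nat * nat)) (i j : nat) :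
    'cV[K]_2 :=
  brlist v s i j - brlist v s j i.

Fact ops34C A3 A4 : A3 *m A4 = A4 *m A3 ->
  forall i j, ops34 A3 A4 i *m ops34 A3 A4 j = ops34 A3 A4 j *m ops34 A3 A4 i.
Proof.
move=> C i j; rewrite /ops34.
by case: (i == 3%N); case: (j == 3%N) => //; case: (i == 4%N); case: (j == 4%N);
  rewrite ?mulmx0 ?mul0mx.
Qed.

Fact br0xx (i : nat) : 0 = 0 :> 'cV[K]_2. Proof. by []. Qed.

Fact br0C (i j : nat) : 0 = - 0 :> 'cV[K]_2. Proof. by rewrite oppr0. Qed.

Fact br0cocycle A3 A4 (i j k : nat) :
  ops34 A3 A4 i *m (0 : 'cV[K]_2) + ops34 A3 A4 j *m (0 : 'cV[K]_2)
    + ops34 A3 A4 k *m (0 : 'cV[K]_2) = 0.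
Proof. by rewrite !mulmx0 !addr0. Qed.

Definition g2ops A3 A4 (C : A3 *m A4 = A4 *m A3) : g2data K :=
  @G2Data K (ops34 A3 A4) (fun _ _ => 0) br0xx br0C (ops34C C)
    (br0cocycle A3 A4).

Fact braltxx v s i : bralt v s i i = 0.
Proof. exact: subrr. Qed.

Fact braltC v s i j : bralt v s i j = - bralt v s j i.
Proof. by rewrite /bralt opprB. Qed.

Fact brcocycle A v s : (s = [::] \/ A *m e2 = 0) -> forall i j k,
  ops34 A 0 i *m bralt v s j k + ops34 A 0 j *m bralt v s k i
    + ops34 A 0 k *m bralt v s i j = 0.
Proof.
move=> hA.
have h j k : (j == 3%N) = false -> (k == 3%N) = false -> A *m bralt v s j k = 0.
  move=> j3 k3; rewrite /bralt /brlist !xpair_eqE j3 k3 /= mulmxBr.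
  by case: hA => [-> | hA]; rewrite ?in_nil ?subrr //;
    case: ifP => _; case: ifP => _; rewrite ?hA ?mulmx0 ?subrr.
have o i : ops34 A 0 i = if i == 3%N then A else 0.
  by rewrite /ops34; case: ifP => //; case: ifP.
move=> i j k; rewrite !o.
case i3: (i == 3%N); case j3: (j == 3%N); case k3: (k == 3%N);
  rewrite ?(eqP i3) ?(eqP j3) ?(eqP k3) ?mul0mx ?add0r ?addr0 ?braltxx
    ?mulmx0 ?add0r ?addr0 //; try exact: h.
- by rewrite -mulmxDr braltC addNr mulmx0.
- by rewrite -mulmxDr braltC addNr mulmx0.
- by rewrite -mulmxDr braltC addNr mulmx0.
Qed.

Definition g2brs A v s (hA : s = [::] \/ A *m e2 = 0) : g2data K :=
  G2Data (braltxx v s) (braltC v s)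
    (ops34C (etrans (mulmx0 _ A) (esym (mul0mx _ A)))) (brcocycle v hA).

Fact mx2_e2 a c : mx2 a 0 c 0 *m e2 = 0.
Proof.
apply/colP => i; rewrite !mxE !big_ord_recl big_ord0 !mxE /=.
by case: i => [[|[|]]] //= _; rewrite !mul0r mulr0 !addr0.
Qed.

Fact mulmx1C (A : 'M[K]_2) : A *m 1%:M = 1%:M *m A.
Proof. by rewrite mulmx1 mul1mx. Qed.

Fact mulmx0C (A : 'M[K]_2) : A *m 0 = 0 *m A.
Proof. by rewrite mulmx0 mul0mx. Qed.

End Builders.

Section ListedAlgebras.
Context {R : realType}.

Definition d321 (l : R) : g2data R := g2ops (mulmx0C (mx2 1 0 0 l)).
Definition d322 : g2data R := g2ops (mulmx0C (mx2 1 1 0 1)).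
Definition d323 (phi : R) : g2data R :=
  g2ops (mulmx0C (mx2 (cos phi) (- sin phi) (sin phi) (cos phi))).

Definition d421 : g2data R :=
  g2brs (A := mx2 1 0 0 0) (e2 _) (s := [::]) (or_introl erefl).
Definition d422 : g2data R :=
  g2brs (A := mx2 0 1 0 0) (e2 _) (s := [::]) (or_introl erefl).
Definition d423 (l : R) : g2data R := g2ops (mulmx1C (mx2 0 1 0 l)).
(* (X_1, X_2, X_3, X_4) = (X, Y, Z, T) *)
Definition daffC : g2data R := g2ops (mulmx1C (mx2 0 1 (-1) 0)).

Definition d52 (k : nat) : g2data R :=
  g2brs (A := mx2 0 0 1 0) (e1 _)
    (s := [seq (4 + 2 * i, 5 + 2 * i)%N | i <- iota 0 k.+1])
    (or_intror (mx2_e2 0 1)).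
Definition d621 (k : nat) : g2data R :=
  g2brs (A := mx2 1 0 0 0) (e2 _)
    (s := [seq (5 + 2 * i, 6 + 2 * i)%N | i <- iota 0 k.+1])
    (or_intror (mx2_e2 1 0)).
Definition d622 (k : nat) : g2data R :=
  g2brs (A := mx2 0 0 1 0) (e1 _)
    (s := [seq (5 + 2 * i, 6 + 2 * i)%N | i <- iota 0 k.+1])
    (or_intror (mx2_e2 0 1)).

Definition G321 (l : R) : lieAlgType R := g2alg 3 (d321 l).
Definition G322 : lieAlgType R := g2alg 3 d322.
Definition G323 (phi : R) : lieAlgType R := g2alg 3 (d323 phi).
Definition G421 : lieAlgType R := g2alg 4 d421.
Definition G422 : lieAlgType R := g2alg 4 d422.
Definition G423 (l : R) : lieAlgType R := g2alg 4 (d423 l).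
Definition affC : lieAlgType R := g2alg 4 daffC.
Definition G52 (k : nat) : lieAlgType R := g2alg (5 + 2 * k) (d52 k).
Definition G621 (k : nat) : lieAlgType R := g2alg (6 + 2 * k) (d621 k).
Definition G622 (k : nat) : lieAlgType R := g2alg (6 + 2 * k) (d622 k).

Inductive listed : lieAlgType R -> Prop :=
| listed_321 l : l != 0 -> listed (G321 l)
| listed_322 : listed G322
| listed_323 phi : 0 < phi < pi -> listed (G323 phi)
| listed_421 : listed G421
| listed_422 : listed G422
| listed_423 l : listed (G423 l)
| listed_affC : listed affC
| listed_52 k : listed (G52 k)
| listed_621 k : listed (G621 k)
| listed_622 k : listed (G622 k).

End ListedAlgebras.

Definition one_and_only_one (Ps : seq Prop) : Prop :=
  exists! i : nat, nth False Ps i.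

(* Main.v *)
(* The derived ideal G^1 is abelian, so ad induces commuting operators on the
   plane G^1. If they are all scalar, some t acts as the identity. Otherwise some
   ad s has a cyclic vector in G^1 and every ad y acts as k + l (ad s). In both
   situations, when some t acts invertibly, G is the sum of G^1 and of the abelian
   centralizer of t, and the normal form is that of a 2x2 real matrix.
   When every operator is a multiple of a single nonzero singular one, induced by
   t, a hyperplane modulo the plane carries an alternating form (its bracket, with
   values in a line of G^1) and a linear form (the bracket with t). The form
   either represents the linear form or has a radical vector on which the linear
   form does not vanish; in each case a symplectic basis gives the normal form,
   its degenerate part being central.
   When the center of G lies in G^1, a decomposition of G splits G^1 into two
   lines stable under ad, which is incompatible with the listed brackets. *)

Require Import Defs.
From HB Require Import structures.
From mathcomp Require Import all_boot all_order all_algebra.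
From mathcomp Require Import reals trigo.
From mathcomp Require Import boolp ring lra zify.

Set Implicit Arguments.
Unset Strict Implicit.
Unset Printing Implicit Defensive.

Import Order.TTheory GRing.Theory Num.Theory.
Local Open Scope ring_scope.

(** * Lie brackets and alternating forms *)

(** For [l != 0] the operator [a_{X_3}] of [G423 l] has two distinct real eigenvalues, and the
    algebra is aff(R) + aff(R), hence decomposable. The normal forms of an indecomposable algebra
    thus produce only [l = 0], and uniqueness of the parameter amounts to keeping a [G423 l] with
    [l != 0] apart from every normal form in dimension 4. Indecomposability forces [Z] to be empty.
    Conversely, every listed form with empty [Z] is proved indecomposable, and this is why a
    decomposable algebra of listed form is a trivial extension by at least one dimension. Distinct
    families of one dimension are separated by elementary properties of the operators [ad x],
    phrased with brackets only and thus invariant under isomorphism. *)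

Lemma coord_inj (K : fieldType) (V : vectType K) (x y : V) :
  (forall i, coord (vbasis {:V}) i x = coord (vbasis {:V}) i y) -> x = y.
Proof.
move=> E; rewrite (coord_vbasis (memvf x)) (coord_vbasis (memvf y)).
by apply: eq_bigr => i _; rewrite E.
Qed.

(** Coordinates turn a vector identity into scalar identities, within reach of [ring] and
    [field]. *)
Ltac vcoord := apply: coord_inj => ?;
  rewrite ?(linearD, linearB, linearN, linearZ, linear0) /=
          ?(linearD, linearB, linearN, linearZ, linear0) /=
          ?(linearD, linearB, linearN, linearZ, linear0) /=.
Ltac vring := vcoord; ring.
Ltac vfield := vcoord; by field.

Section LieBasics.
Context {K : fieldType} {L : lieAlgType K}.
Implicit Types (x y z : L) (a : K) (U V : {vspace L}).

Lemma lie0l y : [lie 0, y] = 0.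
Proof. by have := lie_sum_l (Nil nat) (fun=> 0 : L) y; rewrite !big_nil. Qed.
Lemma lie0r y : [lie y, 0] = 0.
Proof. by have := lie_sum_r (Nil nat) (fun=> 0 : L) y; rewrite !big_nil. Qed.
Lemma lieDl x y z : [lie x + y, z] = [lie x, z] + [lie y, z].
Proof. by rewrite -[x]scale1r lie_linearl !scale1r. Qed.
Lemma lieDr x y z : [lie z, x + y] = [lie z, x] + [lie z, y].
Proof. by rewrite -[x]scale1r lie_linearr !scale1r. Qed.
Lemma lieNl x z : [lie - x, z] = - [lie x, z].
Proof. by rewrite -scaleN1r lie_scale_l scaleN1r. Qed.
Lemma lieNr x z : [lie z, - x] = - [lie z, x].
Proof. by rewrite -scaleN1r lie_scale_r scaleN1r. Qed.
Lemma lieC x y : [lie x, y] = - [lie y, x].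
Proof.
apply/eqP; rewrite -addr_eq0; apply/eqP.
by have := liexx (x + y); rewrite lieDl !lieDr !liexx add0r addr0.
Qed.

Definition lieE := (lieDl, lieDr, lieNl, lieNr, @lie_scale_l, @lie_scale_r,
  lie0l, lie0r, @liexx).

Lemma lie_leibniz x y z :
  [lie x, [lie y, z]] = [lie [lie x, y], z] + [lie y, [lie x, z]].
Proof.
have := lie_jacobi x y z; rewrite (lieC z [lie x, y]) (lieC z x) lieNr.
by move=> H; apply/eqP; rewrite -subr_eq0 -H; apply/eqP; vring.
Qed.

Definition adfun x y := [lie x, y].
HB.instance Definition _ x := GRing.isLinear.Build K L L *:%R (adfun x)
  (fun a y z => lie_linearr a y z x).

Definition ad x : 'End(L) := linfun (adfun x).
Lemma adE x y : ad x y = [lie x, y]. Proof. by rewrite lfunE. Qed.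

Definition central x := forall y, [lie x, y] = 0.

Lemma mem_derived x y : [lie x, y] \in derived L.
Proof. by rewrite memv_lie_prod ?memvf. Qed.

(** If [x] were in the span of [X], then [f] would vanish at [x] too. With [f] a bracket operator,
    this is the main source of freeness below. *)
Lemma free_cons_linear (W : lmodType K) (f : {linear L -> W}) x (X : seq L) :
  f x != 0 -> {in X, forall y, f y = 0} -> free X -> free (x :: X).
Proof.
move=> fx fX frX; rewrite free_cons frX andbT; apply: contra fx.
rewrite -[X]/(tval (in_tuple X)) => /coord_span->; rewrite linear_sum big1 //= => i _.
by rewrite linearZ /= fX ?mem_nth ?scaler0.
Qed.

Lemma free_cons_lie b x (X : seq L) :
  [lie b, x] != 0 -> {in X, forall y, [lie b, y] = 0} -> free X -> free (x :: X).
Proof. exact: (@free_cons_linear _ (adfun b)). Qed.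

Lemma mem_span2P (u v x : L) :
  reflect (exists a b, x = a *: u + b *: v) (x \in <<[:: u; v]>>%VS).
Proof.
rewrite span_cons span_seq1; apply: (iffP memv_addP).
  by move=> [_ /vlineP[a ->] [_ /vlineP[b ->] ->]]; exists a, b.
by move=> [a [b ->]]; exists (a *: u); rewrite ?memvZ ?memv_line //;
   exists (b *: v); rewrite ?memvZ ?memv_line.
Qed.

Lemma free2P (u v : L) :
  reflect (forall a b, a *: u + b *: v = 0 -> a = 0 /\ b = 0) (free [:: u; v]).
Proof.
rewrite free_cons seq1_free span_seq1; apply: (iffP andP) => [[uv v0] a b|F].
  have [->|a0] := eqVneq a 0.
    by rewrite scale0r add0r => /eqP; rewrite scaler_eq0 (negPf v0) orbF => /eqP.
  move=> H; case/negP: uv; apply/vlineP; exists (- a^-1 * b).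
  apply: (scalerI a0); rewrite scalerA mulNr mulrN mulVKf // scaleNr.
  by apply/eqP; rewrite -addr_eq0 H.
split; last first.
  apply/eqP=> v0; have [|_ /eqP] := F 0 1; first by rewrite v0 scaler0 scale0r addr0.
  by rewrite oner_eq0.
apply/vlineP=> -[k E]; have [|/eqP] := F 1 (- k); last by rewrite oner_eq0.
by rewrite E; vring.
Qed.

(* ad x acts on the line [G^1, G^1] by a scalar, hence every bracket acts
   trivially on that line, which is impossible in aff(K). *)
Lemma derived2_abelian : \dim (derived L) = 2%N ->
  forall x y, x \in derived L -> y \in derived L -> [lie x, y] = 0.
Proof.
move=> d2.
have /andP[/eqP sB frB] := vbasisP (derived L).
have szB : size (vbasis (derived L)) = 2%N by rewrite size_tuple.
case E: (tval (vbasis (derived L))) szB sB frB => [|p [|q [|]]] //= _ sB frB.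
have memB x : x \in derived L -> exists a b, x = a *: p + b *: q.
  by rewrite -sB => /mem_span2P.
set r := [lie p, q].
have brr x y : x \in derived L -> y \in derived L -> exists k, [lie x, y] = k *: r.
  move=> /memB[a [b ->]] /memB[c [e ->]]; exists (a * e - b * c).
  by rewrite !lieE (lieC q p) -/r; vring.
have [r0|r0] := eqVneq r 0.
  by move=> x y xD yD; have [k ->] := brr x y xD yD; rewrite r0 scaler0.
have rD : r \in derived L by exact: mem_derived.
have pD : p \in derived L by rewrite -sB memv_span ?inE ?eqxx.
have qD : q \in derived L by rewrite -sB memv_span ?inE ?eqxx ?orbT.
have eig x : exists k, [lie x, r] = k *: r.
  have [k1 E1] := brr _ q (mem_derived x p) qD.
  have [k2 E2] := brr p _ pD (mem_derived x q).
  by exists (k1 + k2); rewrite lie_leibniz -/r E1 E2 scalerDl.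
have brk x y : [lie [lie x, y], r] = 0.
  have [k1 E1] := eig x; have [k2 E2] := eig y.
  have := lie_leibniz x y r; rewrite E2 E1 !lieE E1 E2 !scalerA mulrC.
  by move=> H; apply: (addIr (k1 * k2 *: r)); rewrite add0r.
have kil x : x \in derived L -> [lie x, r] = 0.
  move: x; suff /subvP sD : (derived L <= lker (ad r))%VS.
    by move=> x /sD; rewrite memv_ker adE lieC oppr_eq0 => /eqP.
  by apply/lie_prod_subP => u v _ _; rewrite memv_ker adE lieC brk oppr0.
have [a [b ra]] := memB _ rD.
have b0 : b = 0.
  have /eqP := kil p pD; rewrite {1}ra !lieE -/r scaler0 add0r.
  by rewrite scaler_eq0 (negPf r0) orbF => /eqP.
have a0 : a = 0.
  have /eqP := kil q qD; rewrite {1}ra !lieE (lieC q) -/r scaler0 addr0 scalerN.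
  by rewrite oppr_eq0 scaler_eq0 (negPf r0) orbF => /eqP.
by case/eqP: r0; rewrite ra a0 b0 !scale0r addr0.
Qed.
End LieBasics.

(** * Symplectic bases for brackets with values in a line *)

Section Hyperbolic.
Context {K : fieldType} {L : lieAlgType K}.
Implicit Types (x y z c : L) (S Z : seq L).

(* A symplectic basis a_1, b_1, a_2, b_2, ... for the alternating form given by
   the bracket of L, when that bracket takes its values in the line of c. *)
Fixpoint hyperbolic c S : Prop :=
  match S with
  | [::] => True
  | a :: b :: S' =>
    [/\ [lie a, b] = c, {in S', forall x, [lie a, x] = 0 /\ [lie b, x] = 0}
      & hyperbolic c S']
  | _ => False
  end.

(** [hyperbolic] consumes two vectors at a time, so plain list induction does not fit; odd lengths
    are excluded by the definition. *)
Lemma hyper_ind c (P : seq L -> Prop) :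
  P [::] ->
  (forall a b S, [lie a, b] = c ->
    {in S, forall x, [lie a, x] = 0 /\ [lie b, x] = 0} -> hyperbolic c S ->
    P S -> P [:: a, b & S]) ->
  forall S, hyperbolic c S -> P S.
Proof.
move=> P0 Pc S; have [n] := ubnP (size S); elim: n S => // n IH [|a [|b S]] //=.
by move=> szS [ab abS hS]; apply: Pc => //; apply: IH => //; lia.
Qed.

Lemma span_lie0 x S : {in S, forall y, [lie x, y] = 0} ->
  {in <<S>>%VS, forall y, [lie x, y] = 0}.
Proof.
move=> xS; have /subvP sS : (<<S>> <= lker (ad x))%VS.
  by apply/span_subvP => y /xS E; rewrite memv_ker adE E.
by move=> y /sS; rewrite memv_ker adE => /eqP.
Qed.

Lemma span_cons2P (a b x : L) S :
  reflect (exists k l y, y \in <<S>>%VS /\ x = k *: a + l *: b + y)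
          (x \in <<[:: a, b & S]>>%VS).
Proof.
rewrite !span_cons; apply: (iffP memv_addP).
  move=> [_ /vlineP[k ->] [_ /memv_addP[_ /vlineP[l ->] [y yS ->]] ->]].
  by exists k, l, y; rewrite addrA.
move=> [k [l [y [yS ->]]]]; exists (k *: a); rewrite ?memvZ ?memv_line //.
by exists (l *: b + y); rewrite ?addrA // memv_add ?memvZ ?memv_line.
Qed.

(** Bracketing with [a] reads off the coefficient along [b], and vice versa, so the form has no
    radical on the span of a symplectic basis. *)
Lemma hyperbolic_nondeg c S x : c != 0 -> hyperbolic c S ->
  x \in <<S>>%VS -> {in S, forall y, [lie x, y] = 0} -> x = 0.
Proof.
move=> c0 hS; move: S hS x; apply: hyper_ind => [x|a b S ab abS hS IH x].
  by rewrite span_nil memv0 => /eqP.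
case/span_cons2P=> k [l [y [yS ->]]] xS.
have aS := span_lie0 (fun z zS => (abS z zS).1).
have bS := span_lie0 (fun z zS => (abS z zS).2).
have l0 : l = 0.
  have /eqP := xS a (mem_head _ _); rewrite !lieE (lieC b) ab (lieC y) aS //.
  rewrite oppr0 !addr0 scaler0 add0r scalerN oppr_eq0 scaler_eq0 (negPf c0).
  by rewrite orbF => /eqP.
have k0 : k = 0.
  have /xS : b \in [:: a, b & S] by rewrite !inE eqxx orbT.
  rewrite !lieE ab (lieC y) bS // oppr0 scaler0 !addr0 => /eqP.
  by rewrite scaler_eq0 (negPf c0) orbF => /eqP.
rewrite k0 l0 !scale0r !add0r; apply: IH => // z zS.
have := xS z; rewrite k0 l0 !scale0r !add0r; apply.
by rewrite !inE zS !orbT.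
Qed.

(** The vector [h] is built pair by pair: if [f a = k *: c] and [f b = l *: c], the pair contributes
    [l *: a - k *: b], because [[a, b] = c]. *)
Lemma hyperbolic_solve c S (f : {linear L -> L}) : hyperbolic c S ->
  {in S, forall x, f x \in <[c]>%VS} ->
  exists2 h, h \in <<S>>%VS & {in <<S>>%VS, forall x, [lie h, x] = f x}.
Proof.
move=> hS; move: S hS; apply: hyper_ind => [_|a b S ab abS hS IH fS].
  exists 0; first exact: mem0v.
  by move=> x; rewrite span_nil memv0 => /eqP->; rewrite lieE linear0.
have [|h hhS hE] := IH; first by move=> x xS; apply: fS; rewrite !inE xS !orbT.
have /vlineP[k fa] := fS a (mem_head _ _).
have /vlineP[l fb] : f b \in <[c]>%VS by apply: fS; rewrite !inE eqxx orbT.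
have aS := span_lie0 (fun z zS => (abS z zS).1).
have bS := span_lie0 (fun z zS => (abS z zS).2).
exists (l *: a + (- k) *: b + h); first by apply/span_cons2P; exists l, (- k), h.
move=> _ /span_cons2P[k' [l' [y [yS ->]]]].
rewrite !lieE (lieC b a) ab (lieC h a) (lieC h b) !aS // !bS //.
rewrite hE // !linearD !linearZ /= fa fb; vring.
Qed.

(** A hyperbolic plane splits off: the components of [x] along [a] and [b] are read from [[b, x]]
    and [[a, x]], and subtracting them leaves a vector orthogonal to both. *)
Lemma hyper_step c (U : {vspace L}) a b B : c != 0 ->
  {in U &, forall u v, [lie u, v] \in <[c]>%VS} -> a \in U -> b \in U ->
  [lie a, b] = c -> basis_of (U :&: (lker (ad a) :&: lker (ad b))) B ->
  basis_of U [:: a, b & B] /\ {in B, forall x, [lie a, x] = 0 /\ [lie b, x] = 0}.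
Proof.
set U' := (U :&: _)%VS; move=> c0 UU aU bU ab bB.
have U'P x : reflect [/\ x \in U, [lie a, x] = 0 & [lie b, x] = 0] (x \in U').
  rewrite !memv_cap !memv_ker !adE.
  by apply: (iffP and3P) => -[? /eqP ? /eqP ?].
have BU' x : x \in B -> x \in U' by exact: basis_mem bB.
split; last by move=> x /BU'/U'P[].
have fr : free [:: a, b & B].
  apply: (@free_cons_lie _ _ b).
  - by rewrite lieC ab oppr_eq0.
  - move=> y; rewrite inE => /orP[/eqP->|/BU'/U'P[]//]; exact: liexx.
  - apply: (@free_cons_lie _ _ a); rewrite ?ab //; last exact: basis_free bB.
    by move=> y /BU'/U'P[].
rewrite basisEdim -(eqnP fr) dimvS ?andbT; last first.
  apply/span_subvP => x; rewrite !inE => /or3P[/eqP->|/eqP->|] //.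
  by move/BU'/U'P => [].
apply/subvP => x xU; have /vlineP[l1 E1] := UU a x aU xU.
have /vlineP[l2 E2] := UU b x bU xU.
apply/span_cons2P; exists (- l2), l1, (x - (- l2) *: a - l1 *: b).
split; last by vring.
rewrite (span_basis bB); apply/U'P; split.
- by rewrite !memvB ?memvZ.
- by rewrite !lieE E1 ab; vring.
- by rewrite !lieE E2 (lieC b) ab; vring.
Qed.

(** Induction on the dimension: a pair with nonzero bracket, rescaled to [c], is split off and the
    construction continues on its orthogonal. Once the form vanishes, what is left is the radical
    [Z]. *)
Lemma hyperbolic_split c (U : {vspace L}) : c != 0 ->
  {in U &, forall u v, [lie u, v] \in <[c]>%VS} ->
  exists S Z, [/\ basis_of U (S ++ Z), hyperbolic c S
    & {in Z & U, forall z u, [lie z, u] = 0}].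
Proof.
move=> c0; have [n] := ubnP (\dim U); elim: n U => // n IH U dU UU.
have [ab0|] := pselect ({in U &, forall u v, [lie u, v] = 0}).
  exists [::], (vbasis U); split=> //; first exact: vbasisP.
  by move=> z u zU uU; apply: ab0 => //; exact: vbasis_mem.
move=> /existsNP[u /existsNP[b /not_implyP[uU /not_implyP[bU /eqP ub]]]].
have /vlineP[k uk] := UU u b uU bU.
have k0 : k != 0 by apply: contraNneq ub => k0; rewrite uk k0 scale0r.
have {u uU ub uk} [a aU ab] : exists2 a, a \in U & [lie a, b] = c.
  exists (k^-1 *: u); first by rewrite memvZ.
  by rewrite !lieE uk scalerA mulVf // scale1r.
pose U' := (U :&: (lker (ad a) :&: lker (ad b)))%VS.
have sU' : (U' <= U)%VS by exact: capvSl.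
have dU' : (\dim U' < n)%N.
  apply: (@leq_trans (\dim U)) => //; rewrite ltn_neqAle dimvS // andbT.
  rewrite (dimv_leqif_eq sU'); apply/eqP => E.
  have : a \in U' by rewrite E.
  by rewrite !memv_cap !memv_ker !adE (lieC b) ab oppr_eq0 (negPf c0) !andbF.
have [|S [Z [bSZ hS rZ]]] := IH U' dU'.
  by move=> x y /(subvP sU') xU /(subvP sU') yU; apply: UU.
have [bU' kU'] := hyper_step c0 UU aU bU ab bSZ.
exists [:: a, b & S], Z; split=> //.
  by split=> // x xS; apply: kU'; rewrite mem_cat xS.
move=> z x zZ; have [az bz] : [lie a, z] = 0 /\ [lie b, z] = 0.
  by apply: kU'; rewrite mem_cat zZ orbT.
rewrite -(span_basis bU'); apply: span_lie0 => y.
rewrite !inE => /or3P[/eqP->|/eqP->|ySZ]; first by rewrite lieC az oppr0.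
  by rewrite lieC bz oppr0.
by apply: rZ => //; exact: basis_mem bSZ ySZ.
Qed.

(** On the symplectic part [S] every linear form is represented, so the values on the radical [Z]
    decide. If they vanish, the vector found for [S] represents [f] on all of [U]; otherwise some
    radical vector can be rescaled to have value [c]. *)
Lemma form_dichotomy c (U : {vspace L}) (f : {linear L -> L}) : c != 0 ->
  {in U &, forall u v, [lie u, v] \in <[c]>%VS} ->
  {in U, forall u, f u \in <[c]>%VS} ->
  (exists2 h, h \in U & {in U, forall u, [lie h, u] = f u}) \/
  (exists x, [/\ x \in U, f x = c & {in U, forall u, [lie x, u] = 0}]).
Proof.
move=> c0 UU fU; have [S [Z [bSZ hS rZ]]] := hyperbolic_split c0 UU.
have memU x : x \in S ++ Z -> x \in U by exact: basis_mem bSZ.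
have [Z0|] := pselect ({in Z, forall z, f z = 0}).
  left; have [x xS|h hhS hE] := hyperbolic_solve hS (f := f).
    by apply/fU/memU; rewrite mem_cat xS.
  have hU : h \in U.
    by rewrite -(span_basis bSZ) span_cat (subvP (addvSl _ _)).
  exists h => // u; rewrite -(span_basis bSZ) span_cat => /memv_addP[s sS [z zZ ->]].
  rewrite lieDr hE // linearD (span_lie0 _ zZ) => [|y yZ]; last first.
    by rewrite lieC rZ ?oppr0.
  have /subvP/(_ z zZ) : (<<Z>> <= lker (linfun f))%VS.
    by apply/span_subvP => y yZ; rewrite memv_ker lfunE /= Z0.
  by rewrite memv_ker lfunE => /eqP->.
move=> /existsNP[z /not_implyP[zZ /eqP fz]]; right.
have zU : z \in U by apply: memU; rewrite mem_cat zZ orbT.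
have /vlineP[k E] := fU z zU.
have k0 : k != 0 by apply: contraNneq fz => k0; rewrite E k0 scale0r.
exists (k^-1 *: z); split; first by rewrite memvZ.
  by rewrite linearZ /= E scalerA mulVf // scale1r.
by move=> u uU; rewrite !lieE rZ ?scaler0.
Qed.

Lemma ker_step c (U : {vspace L}) (f : 'End(L)) x B : c != 0 ->
  {in U, forall u, f u \in <[c]>%VS} -> x \in U -> f x = c ->
  basis_of (U :&: lker f) B -> basis_of U (x :: B).
Proof.
move=> c0 fU xU fx bB.
have BP y : y \in B -> y \in U /\ f y = 0.
  by move/(basis_mem bB); rewrite memv_cap memv_ker => /andP[? /eqP].
have fr : free (x :: B).
  apply: (@free_cons_linear _ _ _ f); first by rewrite /= fx.
    by move=> y /BP[].
  exact: basis_free bB.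
rewrite basisEdim -(eqnP fr) dimvS ?andbT; last first.
  by apply/span_subvP => y; rewrite !inE => /predU1P[->//|/BP[]].
apply/subvP => y yU; have /vlineP[k E] := fU y yU.
rewrite -[y](subrKC (k *: x)) span_cons memv_add ?memvZ ?memv_line //.
rewrite (span_basis bB) memv_cap memv_ker memvB ?memvZ //=.
have -> : f (y - k *: x) = f y - k *: f x by rewrite linearB linearZ.
by rewrite E fx subrr.
Qed.

Lemma diff_step (U : {vspace L}) x B : x != 0 -> x \in U ->
  basis_of (U :\: <[x]>) B -> basis_of U (x :: B).
Proof.
move=> x0 xU bB.
have -> : U = (<[x]> + (U :\: <[x]>))%VS.
  by rewrite addvC (addv_diff U); apply/esym/addv_idPl; rewrite -memvE.
rewrite -[x :: B]/([:: x] ++ B); apply: cat_basis => //; last exact: seq1_basis.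
by apply/directv_addP; rewrite capvC capv_diff.
Qed.

(** Used with [W] of codimension two: [ad r] detects the coefficient of [t], and [r] itself lies
    outside [W]. *)
Lemma top_step (W : {vspace L}) t r B : [lie r, t] != 0 ->
  {in W, forall u, [lie r, u] = 0} -> r \notin W ->
  (forall x, exists k a, x - k *: t - a *: r \in W) -> basis_of W B ->
  basis_of fullv [:: t, r & B].
Proof.
move=> rt rW rnW H bB.
have fr : free [:: t, r & B].
  apply: (@free_cons_lie _ _ r) => //.
    move=> y; rewrite inE => /predU1P[->|/(basis_mem bB)/rW//]; exact: liexx.
  by rewrite free_cons (span_basis bB) rnW (basis_free bB).
rewrite basisEdim -(eqnP fr) dimvS ?subvf // andbT; apply/subvP => x _.
have [k [a E]] := H x; apply/span_cons2P; exists k, a, (x - k *: t - a *: r).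
by split; [rewrite (span_basis bB) | vring].
Qed.

Lemma basis_central B z : basis_of fullv B ->
  {in B, forall b, [lie z, b] = 0} -> central z.
Proof.
by move=> bB zB y; apply: (span_lie0 zB); rewrite (span_basis bB) memvf.
Qed.

End Hyperbolic.


(** * Embeddings and isomorphisms *)

Section Embeddings.
Context {K : fieldType}.
Implicit Types L M N : lieAlgType K.

(** Models are always mapped into [L], where a basis is at hand; the isomorphism from [L] is the
    inverse of the embedding. *)
Lemma emb_lie_iso L M (f : {linear M -> L}) : injective f -> lie_morph f ->
  \dim {:M} = \dim {:L} -> lie_iso L M.
Proof.
move=> fI fL dML; pose F : 'Hom(M, L) := linfun f.
have FE x : F x = f x by rewrite lfunE.
have FI : lker F == 0%VS by apply/lker0P => x y; rewrite !FE; exact: fI.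
have FK : cancel F (F^-1)%VF by exact: lker0_lfunK.
have KF : cancel (F^-1)%VF F.
  move=> y; rewrite limg_lfunVK //; have -> : limg F = fullv; last exact: memvf.
  apply/eqP; rewrite eqEdim subvf /= limg_dim_eq ?dML //.
  by rewrite (eqP FI) capv0.
exists (F^-1)%VF; first exact: Bijective KF FK.
by move=> x y; apply: fI; rewrite fL -!FE !KF.
Qed.

Lemma lie_iso_bij L M : lie_iso L M ->
  exists f : {linear M -> L}, [/\ bijective f, lie_morph f & \dim {:M} = \dim {:L}].
Proof.
case=> f fB fL; pose F : 'Hom(L, M) := linfun f.
have FE x : F x = f x by rewrite lfunE.
have FI : lker F == 0%VS by apply/lker0P => x y; rewrite !FE => /(bij_inj fB).
have FK : cancel F (F^-1)%VF by exact: lker0_lfunK.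
have sF : limg F = fullv.
  apply/vspaceP => y; rewrite memvf; case: fB => g _ gK.
  by rewrite -[y]gK -FE memv_img ?memvf.
have KF : cancel (F^-1)%VF F by move=> y; rewrite limg_lfunVK // sF memvf.
exists (F^-1)%VF; split; first exact: Bijective KF FK.
  by move=> x y; apply: (bij_inj fB); rewrite fL -!FE !KF.
by rewrite -sF limg_dim_eq // (eqP FI) capv0.
Qed.

Lemma lie_iso_sym L M : lie_iso L M -> lie_iso M L.
Proof. by move=> /lie_iso_bij[f [fB fL _]]; exists f. Qed.

Lemma lie_iso_trans L M N : lie_iso L M -> lie_iso M N -> lie_iso L N.
Proof.
move=> [f fB fL] [g gB gL]; exists (g \o f : {linear L -> N}).
  exact: bij_comp.
by move=> x y; rewrite /= fL gL.
Qed.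

Lemma dim_lie_prod L M : \dim {: (L * M)%type : lieAlgType K} = (\dim {:L} + \dim
  {:M})%N.
Proof. by rewrite !dimvf. Qed.

Lemma dim_abel k : \dim {: abel K k : lieAlgType K} = k.
Proof. by rewrite dimvf; exact: mul1n. Qed.

Lemma dim_aff : \dim {: aff K : lieAlgType K} = 2%N.
Proof. by rewrite dimvf. Qed.

Lemma dim_heis m : \dim {: heis K m : lieAlgType K} = (2 * m + 1)%N.
Proof. by rewrite dimvf -[LHS]/(1 * m + 1 * m + 1)%N; lia. Qed.

Lemma dim_g2alg n (d : g2data K) : (2 <= n)%N ->
  \dim {: g2alg n d : lieAlgType K} = n.
Proof. by move=> n2; rewrite dimvf -[LHS]/(2 * 1 + (n - 2) * 1)%N !muln1 subnKC. Qed.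

Section Joint.
Context (L M N : lieAlgType K) (f : {linear M -> L}) (g : {linear N -> L}).

Definition joint_fun (p : M * N) : L := f p.1 + g p.2.
Fact joint_linear : linear joint_fun.
Proof. by move=> a x y; rewrite /joint_fun !linearP /=; vring. Qed.
HB.instance Definition _ := GRing.isLinear.Build K (M * N)%type L *:%R joint_fun
  joint_linear.

Lemma joint_emb (U V : {vspace L}) :
  injective f -> lie_morph f -> injective g -> lie_morph g ->
  (forall x y, [lie f x, g y] = 0) ->
  (forall x, f x \in U) -> (forall y, g y \in V) -> (U :&: V = 0)%VS ->
  exists h : {linear (M * N)%type -> L}, [/\ injective h, lie_morph h,
    forall x y, h (x, y) = f x + g y & forall p, h p \in (U + V)%VS].
Proof.
move=> fI fL gI gL fg fU gV UV; exists joint_fun; split=> //.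
- move=> [x y] [x' y'] /eqP; rewrite -subr_eq0 -linearB /= => /eqP E.
  have Ef : f (x - x') = - g (y - y') by apply/eqP; rewrite -addr_eq0; apply/eqP.
  have f0 : f (x - x') = 0.
    by apply/eqP; rewrite -memv0 -UV memv_cap fU Ef memvN gV.
  have g0 : g (y - y') = 0 by move: E; rewrite /joint_fun /= f0 add0r.
  congr pair; apply/eqP; rewrite -subr_eq0; apply/eqP.
    by apply: fI; rewrite f0 linear0.
  by apply: gI; rewrite g0 linear0.
- move=> [x y] [x' y'].
  change (f [lie x, x'] + g [lie y, y'] = [lie f x + g y, f x' + g y']).
  rewrite !lieE fL gL fg (lieC (g y) (f x')) fg.
  by rewrite oppr0 addr0 add0r.
- by move=> p; rewrite memv_add.
Qed.
End Joint.

Lemma lie_iso_decomposable L M N : lie_iso L (M * N)%type ->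
  (0 < \dim {:M})%N -> (0 < \dim {:N})%N -> decomposable L.
Proof.
move=> /lie_iso_bij[h [hB hL _]] M0 N0; have hI := bij_inj hB.
have [h' hK h'K] := hB.
have linl : linear (fun x : M => h (x, 0)).
  move=> a x y; rewrite -linearP; congr (h _).
  by apply: injective_projections; rewrite //= scaler0 addr0.
have linr : linear (fun y : N => h (0, y)).
  move=> a x y; rewrite -linearP; congr (h _).
  by apply: injective_projections; rewrite //= scaler0 addr0.
pose fl : {linear M -> L} := HB.pack (fun x : M => h (x, 0))
  (GRing.isLinear.Build K M L *:%R _ linl).
pose fr : {linear N -> L} := HB.pack (fun x : N => h (0, x))
  (GRing.isLinear.Build K N L *:%R _ linr).
pose U := limg (linfun fl); pose V := limg (linfun fr).
have UP x : x \in U -> exists y, x = h (y, 0).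
  by move=> /memv_imgP[y _ ->]; exists y; rewrite lfunE.
have VP x : x \in V -> exists y, x = h (0, y).
  by move=> /memv_imgP[y _ ->]; exists y; rewrite lfunE.
have hU y : h (y, 0) \in U.
  by have <- : linfun fl y = h (y, 0) by [rewrite lfunE]; rewrite memv_img ?memvf.
have hV y : h (0, y) \in V.
  by have <- : linfun fr y = h (0, y) by [rewrite lfunE]; rewrite memv_img ?memvf.
exists U, V; split.
- split=> E.
    suff E' : {:M}%VS = 0%VS by rewrite E' dimv0 in M0.
    apply/vspaceP => y; rewrite memvf memv0; apply/esym/eqP.
    have /eqP : h (y, 0) == 0 by rewrite -memv0 -E.
    by rewrite -(linear0 h) => /hI[].
  suff E' : {:N}%VS = 0%VS by rewrite E' dimv0 in N0.
  apply/vspaceP => y; rewrite memvf memv0; apply/esym/eqP.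
  have /eqP : h (0, y) == 0 by rewrite -memv0 -E.
  by rewrite -(linear0 h) => /hI[].
- split; apply/lie_prod_subP.
    move=> _ _ /UP[x ->] /UP[y ->]; rewrite -hL.
    have -> : [lie ((x, 0) : M * N), (y, 0)] = ([lie x, y], 0).
      by apply: injective_projections; rewrite //= lie0l.
    exact: hU.
  move=> _ _ /VP[x ->] /VP[y ->]; rewrite -hL.
  have -> : [lie ((0, x) : M * N), (0, y)] = (0, [lie x, y]).
    by apply: injective_projections; rewrite //= lie0l.
  exact: hV.
- apply/eqP; rewrite -subv0; apply/lie_prod_subP => _ _ /UP[x ->] /VP[y ->].
  rewrite -hL memv0; apply/eqP; rewrite -(linear0 h); congr (h _).
  by apply: injective_projections; rewrite /= ?lie0l ?lie0r.
- apply/vspaceP => x; rewrite memvf -[x]h'K; case: (h' x) => [y z].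
  have -> : (y, z) = (y, 0) + (0, z).
    by apply: injective_projections; rewrite /= ?addr0 ?add0r.
  by rewrite linearD memv_add.
- apply/eqP; rewrite -subv0; apply/subvP => x; rewrite memv_cap => /andP[].
  by move=> /UP[y ->] /VP[z] /hI[-> _]; rewrite memv0 -(linear0 h).
Qed.

(** The general isomorphism carries an abelian factor of dimension [size Z]; this removes it when
    [Z] is empty. *)
Lemma lie_iso_abel0 L M : lie_iso L (M * abel K 0)%type -> lie_iso L M.
Proof.
move=> [f fB fL]; have lf : linear (fun x => (f x).1).
  by move=> a x y; rewrite linearP.
pose F : {linear L -> M} := HB.pack (fun x => (f x).1)
  (GRing.isLinear.Build K L M *:%R _ lf).
have [g fK gK] := fB.
exists F; last by move=> x y; rewrite /= fL.
exists (fun x => g (x, 0)) => x /=; last by rewrite gK.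
have -> : ((f x).1, 0) = f x.
  by apply: injective_projections => //=; apply/rowP => -[].
exact: fK.
Qed.

Lemma sum_free0 L k (Y : seq L) (x : 'I_k -> K) : size Y = k -> free Y ->
  \sum_i x i *: Y`_i = 0 -> forall i, x i = 0.
Proof.
move=> sY; case: _ / sY x => x frY.
have /freeP F : free (in_tuple Y) by [].
exact: F.
Qed.

Lemma mem_sum_nth L k (Y : seq L) (x : 'I_k -> K) : size Y = k ->
  \sum_i x i *: Y`_i \in <<Y>>%VS.
Proof. by move=> sY; rewrite memv_suml // => i _;
  rewrite memvZ // memv_span // mem_nth // sY. Qed.

Lemma abel_emb L k (Z : seq L) : size Z = k -> free Z ->
  {in Z &, forall x y, [lie x, y] = 0} ->
  exists f : {linear abel K k -> L},
    [/\ injective f, lie_morph f & forall x, f x \in <<Z>>%VS].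
Proof.
move=> sZ frZ cZ; pose F (x : abel K k) : L := \sum_(i < k) x 0 i *: Z`_i.
have lF : linear F.
  move=> a x y; rewrite /F scaler_sumr -big_split; apply: eq_bigr => i _ /=.
  by rewrite !mxE scalerDl scalerA.
pose f : {linear abel K k -> L} :=
  HB.pack F (GRing.isLinear.Build K (abel K k) L *:%R F lF).
exists f; split=> /=.
- move=> x y /eqP; rewrite -subr_eq0 -sumrB => /eqP.
  under eq_bigr do rewrite -scalerBl.
  move=> E; apply/rowP => i; apply/eqP; rewrite -subr_eq0.
  by rewrite (sum_free0 sZ frZ E).
- move=> x y; rewrite {1}/F big1 => [|i _]; last by rewrite mxE scale0r.
  rewrite lie_sum_l big1 // => i _; rewrite lie_sum_r big1 // => j _.
  by rewrite !lieE cZ ?scaler0 ?mem_nth ?sZ.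
- by move=> x; exact: mem_sum_nth.
Qed.

Lemma aff_emb L (x y : L) : [lie x, y] = y -> y != 0 ->
  exists f : {linear aff K -> L},
    [/\ injective f, lie_morph f & forall p, f p \in <<[:: x; y]>>%VS].
Proof.
move=> xy y0; pose F (p : aff K) : L := (p.1 : K) *: x + (p.2 : K) *: y.
have lF : linear F.
  by move=> a p q; rewrite /F /= !scalerDl !scalerDr !scalerA addrACA.
have frxy a b : a *: x + b *: y = 0 -> a = 0 /\ b = 0.
  move=> E; have : [lie a *: x + b *: y, y] = 0 by rewrite E lie0l.
  rewrite !lieE xy scaler0 addr0 => /eqP;
    rewrite scaler_eq0 (negPf y0) orbF => /eqP a0; split=> //.
  by move/eqP: E; rewrite a0 scale0r add0r scaler_eq0 (negPf y0) orbF => /eqP.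
pose f : {linear aff K -> L} :=
  HB.pack F (GRing.isLinear.Build K (aff K) L *:%R F lF).
exists f; split=> /=.
- move=> [a b] [c e]; rewrite /F /= => E.
  have [] : a - c = 0 /\ b - e = 0.
    apply: frxy; rewrite !scalerBl addrACA -opprD E; exact: subrr.
  by move=> /eqP; rewrite subr_eq0 => /eqP-> /eqP; rewrite subr_eq0 => /eqP->.
- move=> [a b] [c e]; rewrite /F /= !lieE (lieC y) xy.
  by rewrite scale0r add0r; vring.
- by move=> [a b]; rewrite /F; apply/mem_span2P; exists a, b.
Qed.

Fact half_ltn i n : (i < n./2 -> i.*2.+1 < n)%N. Proof. lia. Qed.

Lemma hyperbolic_nth L (c : L) S : hyperbolic c S -> forall i j,
  (i < (size S)./2)%N -> (j < (size S)./2)%N ->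
  [/\ [lie S`_(i.*2), S`_(j.*2)] = 0, [lie S`_(i.*2.+1), S`_(j.*2.+1)] = 0 &
      [lie S`_(i.*2), S`_(j.*2.+1)] = (i == j)%:R *: c].
Proof.
move: S; apply: hyper_ind => // a b S ab abS hS IH.
have S0 i : (i < (size S)./2)%N -> S`_(i.*2) \in S.
  by move=> iS; apply/mem_nth/ltnW/half_ltn.
have S1 i : (i < (size S)./2)%N -> S`_(i.*2.+1) \in S.
  by move=> iS; apply/mem_nth/half_ltn.
case=> [|i] [|j] //= iS jS.
- by rewrite !liexx scale1r.
- have [-> _] := abS _ (S0 _ jS).
  by have [-> ->] := abS _ (S1 _ jS); rewrite scale0r.
- rewrite (lieC _ a) (lieC _ b) (lieC _ b).
  have [-> ->] := abS _ (S0 _ iS); have [_ ->] := abS _ (S1 _ iS).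
  by rewrite oppr0 scale0r.
- by have [-> -> ->] := IH i j iS jS.
Qed.

(** Vectors at even positions of [S] play the [X_i], those at odd positions the [Y_i], and [c] plays
    [Z]. Brackets with [S] recover the first coordinates of an element from its image; the last one
    is then read off because [c] is not zero. This gives injectivity. *)
Lemma heis_emb L m (c : L) S : hyperbolic c S -> size S = (2 * m)%N ->
  c != 0 -> {in S, forall x, [lie c, x] = 0} ->
  exists f : {linear heis K m -> L},
    [/\ injective f, lie_morph f & forall p, f p \in <<c :: S>>%VS].
Proof.
move=> hS sS c0 cS.
have iS (i : 'I_m) : (i < (size S)./2)%N by rewrite sS; have := ltn_ord i; lia.
have S1 (i : 'I_m) : S`_(i.*2) \in S by apply/mem_nth/ltnW/half_ltn.
have S2 (i : 'I_m) : S`_(i.*2.+1) \in S by apply/mem_nth/half_ltn.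
pose A (x : 'rV[K]_m) : L := \sum_i x 0 i *: S`_(i.*2).
pose B (x : 'rV[K]_m) : L := \sum_i x 0 i *: S`_(i.*2.+1).
have lA : linear A.
  move=> a x y; rewrite /A scaler_sumr -big_split; apply: eq_bigr => i _ /=.
  by rewrite !mxE scalerDl scalerA.
have lB : linear B.
  move=> a x y; rewrite /B scaler_sumr -big_split; apply: eq_bigr => i _ /=.
  by rewrite !mxE scalerDl scalerA.
have AA x y : [lie A x, A y] = 0.
  rewrite lie_sum_l big1 // => i _; rewrite lie_sum_r big1 // => j _.
  by rewrite !lieE; have [-> _ _] := hyperbolic_nth hS (iS i) (iS j); rewrite !scaler0.
have BB x y : [lie B x, B y] = 0.
  rewrite lie_sum_l big1 // => i _; rewrite lie_sum_r big1 // => j _.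
  by rewrite !lieE; have [_ -> _] := hyperbolic_nth hS (iS i) (iS j); rewrite !scaler0.
have AB x y : [lie A x, B y] = (\sum_i x 0 i * y 0 i) *: c.
  rewrite lie_sum_l scaler_suml; apply: eq_bigr => i _; rewrite lie_sum_r.
  rewrite (bigD1 i) //= big1 => [|j ji].
    rewrite addr0 !lieE; have [_ _ ->] := hyperbolic_nth hS (iS i) (iS i).
    by rewrite eqxx scale1r scalerA mulrC.
  rewrite !lieE; have [_ _ ->] := hyperbolic_nth hS (iS i) (iS j).
  by rewrite (inj_eq val_inj) eq_sym (negPf ji) scale0r !scaler0.
have cA x : [lie c, A x] = 0.
  by rewrite lie_sum_r big1 // => i _; rewrite !lieE cS ?scaler0.
have cB x : [lie c, B x] = 0.
  by rewrite lie_sum_r big1 // => i _; rewrite !lieE cS ?scaler0.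
pose F (p : heis K m) : L := A p.1.1 + B p.1.2 + (p.2 : K) *: c.
have lF : linear F.
  move=> a p q; rewrite /F.
  have -> : (a *: p + q).2 = a * (p.2 : K) + (q.2 : K) :> K by [].
  by rewrite lA lB; vring.
have brF p q : [lie F p, F q] = heis_form p.1 q.1 *: c.
  rewrite /F !lieE AA BB AB (lieC (B _) (A _)) AB !cA !cB.
  rewrite (lieC (A _) c) cA (lieC (B _) c) cB /heis_form sumrB.
  vring.
pose f : {linear heis K m -> L} :=
  HB.pack F (GRing.isLinear.Build K (heis K m) L *:%R F lF).
have FE (i : 'I_m) p : [lie F p, S`_(i.*2)] = - p.1.2 0 i *: c /\
    [lie F p, S`_(i.*2.+1)] = p.1.1 0 i *: c.
  have -> : S`_(i.*2) = F ((delta_mx 0 i, 0), 0).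
    rewrite /F /A /B /= scale0r addr0 [X in _ + X]big1; last first.
      by move=> j _; rewrite mxE scale0r.
    rewrite addr0 (bigD1 i) //= big1 => [|j ji].
      by rewrite mxE !eqxx scale1r addr0.
    by rewrite mxE (negPf ji) andbF scale0r.
  have -> : S`_(i.*2.+1) = F ((0, delta_mx 0 i), 0).
    rewrite /F /A /B /= scale0r addr0 big1 ?add0r; last first.
      by move=> j _; rewrite mxE scale0r.
    rewrite (bigD1 i) //= big1 => [|j ji].
      by rewrite mxE !eqxx scale1r addr0.
    by rewrite mxE (negPf ji) andbF scale0r.
  rewrite !brF /heis_form /=; split; congr (_ *: _); rewrite (bigD1 i) //= big1.
  - by rewrite !mxE !eqxx /=; ring.
  - by move=> j ji; rewrite !mxE (negPf ji) andbF /=; ring.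
  - by rewrite !mxE !eqxx /=; ring.
  - by move=> j ji; rewrite !mxE (negPf ji) andbF /=; ring.
have F0 p : F p = 0 -> p = 0.
  move=> Fp; have p1 i : p.1.1 0 i = 0.
    have [_ /eqP] := FE i p; rewrite Fp lie0l eq_sym scaler_eq0 (negPf c0) orbF.
    by move/eqP.
  have p2 i : p.1.2 0 i = 0.
    have [/eqP + _] := FE i p; rewrite Fp lie0l eq_sym scaler_eq0 (negPf c0).
    by rewrite orbF oppr_eq0 => /eqP.
  have p3 : p.2 = 0 :> K.
    move/eqP: Fp; rewrite /F /A /B big1 => [|i _]; last by rewrite p1 scale0r.
    rewrite big1 => [|i _]; last by rewrite p2 scale0r.
    by rewrite !add0r scaler_eq0 (negPf c0) orbF => /eqP.
  apply: injective_projections => //; apply: injective_projections; apply/rowP=> i.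
    by rewrite p1 mxE.
  by rewrite p2 mxE.
exists f; split=> /=.
- move=> p q E; apply/eqP; rewrite -subr_eq0; apply/eqP/F0.
  by rewrite -[F _]/(f (p - q)) linearB /= E subrr.
- move=> p q; rewrite brF {1}/F /= /A /B.
  rewrite !big1 ?add0r // => i _; by rewrite mxE scale0r.
- move=> p; rewrite /F span_cons addrC memv_add ?memvZ ?memv_line // memvD //.
    by rewrite memv_suml // => i _; rewrite memvZ ?memv_span.
  by rewrite memv_suml // => i _; rewrite memvZ ?memv_span.
Qed.
End Embeddings.


(** * Bases with prescribed brackets *)

Section Frames.
Context {K : fieldType}.
Implicit Types (L M : lieAlgType K) (d : g2data K).

(** Bundled as a linear map, so that identities in the plane reduce to identities between
    columns. *)
Definition comb L (p q : L) (u : 'cV[K]_2) : L := u 0 0 *: p + u 1 0 *: q.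

Fact comb_linear L (p q : L) : linear (comb p q).
Proof. by move=> a u v; rewrite /comb !mxE; vring. Qed.
HB.instance Definition _ L (p q : L) := GRing.isLinear.Build K 'cV[K]_2 L *:%R
  (comb p q) (comb_linear p q).

Lemma sum_ord2 (V : nmodType) (F : 'I_2 -> V) : \sum_i F i = F 0 + F 1.
Proof. by rewrite !big_ord_recl big_ord0 addr0; congr (F _ + F _); apply: val_inj. Qed.

Lemma cV2P (u v : 'cV[K]_2) : u 0 0 = v 0 0 -> u 1 0 = v 1 0 -> u = v.
Proof.
move=> E0 E1; apply/colP => i; case: i => [[|[|//]]] Hi.
  by have -> : Ordinal Hi = 0 by exact: val_inj.
by have -> : Ordinal Hi = 1 by exact: val_inj.
Qed.

(* As opposed to [g2basis], indices start from 0: X`_i is X_(i+1). *)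
Definition g2frame L (X : seq L) d : Prop :=
  [/\ [lie X`_0, X`_1] = 0,
      forall i, (2 <= i < size X)%N ->
        [lie X`_i, X`_0] = comb X`_0 X`_1 (col 0 (g2op d i.+1)) /\
        [lie X`_i, X`_1] = comb X`_0 X`_1 (col 1 (g2op d i.+1))
    & forall i j, (2 <= i < size X)%N -> (2 <= j < size X)%N ->
        [lie X`_i, X`_j] = comb X`_0 X`_1 (g2br d i.+1 j.+1)].

Lemma coord2E L (p q : L) (u : 'cV[K]_2) i : free [:: p; q] ->
  coord [tuple p; q] i (comb p q u) = u i 0.
Proof.
move=> fr; rewrite /comb !linearD !linearZ /=.
have := @coord_free _ _ _ [tuple p; q] 0 i fr; rewrite /= => ->.
have := @coord_free _ _ _ [tuple p; q] 1 i fr; rewrite /= => ->.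
case: i => [[|[|//]]] Hi; rewrite /= ?mulr1 ?mulr0 ?addr0 ?add0r.
  by congr (u _ _); apply: val_inj.
by congr (u _ _); apply: val_inj.
Qed.

Lemma g2frame_basis L (X : seq L) d : g2frame X d -> free (take 2 X) ->
  (2 <= size X)%N -> g2basis X d.
Proof.
case: X => [|p [|q X]] //= [pq opX brX]; rewrite take0 => fr _; split.
  move=> [|i] //= i3; have [E0 E1] := opX i i3.
  apply/matrixP => k l; rewrite !mxE /bvec /=.
  case: l => [[|[|//]]] Hl /=; rewrite ?E0 ?E1 coord2E // mxE.
    by congr (g2op d _ _ _); apply: val_inj.
  by congr (g2op d _ _ _); apply: val_inj.
move=> [|i] [|j] //= i3 j3; exact: brX.
Qed.

Lemma g2frame_ad L (X : seq L) d n (x : 'cV[K]_(n - 2)) u : g2frame X d ->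
  size X = n ->
  [lie \sum_i x i 0 *: X`_i.+2, comb X`_0 X`_1 u] = comb X`_0 X`_1 (g2ad d x *m u).
Proof.
case=> _ opX _ sX; rewrite lie_sum_l /g2ad mulmx_suml linear_sum.
apply: eq_bigr => i _; rewrite lie_scale_l -scalemxAl linearZ /=; congr (_ *: _).
have iX : (2 <= i.+2 < size X)%N by have := ltn_ord i; lia.
rewrite {1}/comb !lieE; have [-> ->] := opX _ iX.
rewrite -!linearZ -linearD; congr (comb _ _ _).
by apply: cV2P; rewrite !mxE sum_ord2; congr (_ + _); rewrite mulrC.
Qed.

Lemma g2frame_form L (X : seq L) d n (x y : 'cV[K]_(n - 2)) : g2frame X d ->
  size X = n ->
  [lie \sum_i x i 0 *: X`_i.+2, \sum_i y i 0 *: X`_i.+2] =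
  comb X`_0 X`_1 (g2form d x y).
Proof.
case=> _ _ brX sX; rewrite lie_sum_l /g2form linear_sum.
have iX (i : 'I_(n - 2)) : (2 <= i.+2 < size X)%N by have := ltn_ord i; lia.
apply: eq_bigr => i _; rewrite lie_scale_l lie_sum_r scaler_sumr linear_sum.
by apply: eq_bigr => j _; rewrite lie_scale_r scalerA (brX _ _ (iX i) (iX j))
  [RHS]linearZ mulrC.
Qed.

(** Since [X_1] and [X_2] commute, the relations in [g2frame] cover every bracket that enters the
    formula of [g2lie]. *)
Lemma g2alg_emb L (X : seq L) d n : g2frame X d -> free X -> size X = n ->
  (2 <= n)%N ->
  exists f : {linear g2alg n d -> L},
    [/\ injective f, lie_morph f & forall p, f p \in <<X>>%VS].
Proof.
move=> fX frX sX n2; have [pq _ _] := fX.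
pose A (x : 'cV[K]_(n - 2)) : L := \sum_i x i 0 *: X`_i.+2.
have lA : linear A.
  move=> a x y; rewrite /A scaler_sumr -big_split; apply: eq_bigr => i _ /=.
  by rewrite !mxE scalerDl scalerA.
pose F (p : g2alg n d) : L := comb X`_0 X`_1 p.1 + A p.2.
have lF : linear F by move=> a x y; rewrite /F lA linearP /=; vring.
have F0 p : F p = 0 -> p = 0.
  case: p => u x; rewrite /F /A /=.
  have : (2 <= size X)%N by rewrite sX.
  case: X {fX pq A lA F lF} frX sX => [|p [|q Y]] //= frX sX _.
  have sY : size Y = (n - 2)%N by rewrite -sX !subSS subn0.
  move=> E; have uE : comb p q u = - \sum_i x i 0 *: Y`_i.
    by apply/eqP; rewrite -addr_eq0 E.
  move: frX; rewrite (cat_free [:: p; q]) => /and3P[fpq frY /directv_addP dd].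
  have u0 : comb p q u = 0.
    apply/eqP; rewrite -memv0 -dd memv_cap {2}uE memvN mem_sum_nth // andbT.
    by apply/mem_span2P; exists (u 0 0), (u 1 0).
  have [u00 u10] := free2P _ _ fpq _ _ u0.
  move: E; rewrite u0 add0r => /(sum_free0 sY frY) x0.
  by apply: injective_projections; [apply: cV2P;
    rewrite ?u00 ?u10 mxE | apply/colP=> i; rewrite x0 mxE].
pose f : {linear g2alg n d -> L} :=
  HB.pack F (GRing.isLinear.Build K (g2alg n d) L *:%R F lF).
exists f; split=> /=.
- move=> p q E; apply/eqP; rewrite -subr_eq0; apply/eqP/F0.
  by rewrite -[F _]/(f (p - q)) linearB /= E subrr.
- move=> [u x] [v y]; rewrite /F /=.
  have A0 : A 0 = 0 by rewrite /A big1 // => i _; rewrite mxE scale0r.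
  rewrite A0 addr0 !linearD linearN /= -!(g2frame_ad _ _ fX sX).
  rewrite -(g2frame_form _ _ fX sX) -/(A x) -/(A y).
  rewrite lieDl !(lieDr (comb _ _ v) (A y)).
  rewrite (lieC (comb _ _ u) (A y)).
  have -> : [lie comb X`_0 X`_1 u, comb X`_0 X`_1 v] = 0.
    by rewrite /comb !lieE pq (lieC X`_1) pq oppr0 !scaler0 !addr0.
  by rewrite add0r addrCA addrA.
- move=> p; rewrite /F memvD //.
    by rewrite memvD // memvZ // memv_span // mem_nth // sX // ltnW.
  rewrite memv_suml // => i _; rewrite memvZ // memv_span // mem_nth // sX.
  by have := ltn_ord i; lia.
Qed.

(** Structure constants of different algebras can be compared only through a linear map, so the
    hypothesis speaks of any map carrying [X] to [Y]; [linear_of_free] provides one. *)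
Lemma basis_iso_brackets L M (X : seq L) (Y : seq M) :
  basis_of fullv X -> basis_of fullv Y -> size X = size Y ->
  (forall f : {linear L -> M}, map f X = Y ->
     forall i j, (i < size X)%N -> (j < size X)%N ->
       f [lie X`_i, X`_j] = [lie Y`_i, Y`_j]) ->
  basis_iso X Y.
Proof.
move=> bX bY sXY H; have [f fXY] := linear_of_free X Y.
have {}fXY := fXY (basis_free bX) (esym sXY).
have spX x : exists k : 'I_(size X) -> K, x = \sum_i k i *: X`_i.
  have : x \in <<in_tuple X>>%VS by rewrite (span_basis bX) memvf.
  by move=> /coord_span E; exists (fun i => coord (in_tuple X) i x).
have fn i : (i < size X)%N -> f X`_i = Y`_i.
  by move=> iX; rewrite -fXY (nth_map 0).
have f0 x : f x = 0 -> x = 0.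
  have [k ->] := spX x; rewrite linear_sum.
  under eq_bigr => i _ do rewrite linearZ /= fn //.
  by move/(sum_free0 (esym sXY) (basis_free bY)) => k0;
    rewrite big1 // => i _; rewrite k0 scale0r.
have fI : injective f.
  by move=> x y E; apply/eqP; rewrite -subr_eq0; apply/eqP/f0;
    rewrite linearB /= E subrr.
have fL : lie_morph f.
  have fLi (i : 'I_(size X)) y : f [lie X`_i, y] = [lie f X`_i, f y].
    have [l ->] := spX y; rewrite lie_sum_r !linear_sum lie_sum_r.
    by apply: eq_bigr => j _; rewrite lie_scale_r !linearZ /= lie_scale_r H // !fn.
  move=> x y; have [k ->] := spX x; rewrite lie_sum_l !linear_sum lie_sum_l.
  by apply: eq_bigr => i _; rewrite lie_scale_l !linearZ /= lie_scale_l fLi.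
exists f; split=> //.
have sz (N : lieAlgType K) (Z : seq N) : basis_of fullv Z -> \dim {:N} = size Z.
  by move=> bZ; rewrite -(span_basis bZ) (eqnP (basis_free bZ)).
pose F : 'Hom(L, M) := linfun f.
have FE x : F x = f x by rewrite lfunE.
have FI : lker F == 0%VS by apply/lker0P => x y; rewrite !FE; exact: fI.
have FK : cancel F (F^-1)%VF by exact: lker0_lfunK.
have KF : cancel (F^-1)%VF F.
  move=> y; rewrite limg_lfunVK //; have -> : limg F = fullv; last exact: memvf.
  apply/eqP; rewrite eqEdim subvf /= limg_dim_eq ?(sz _ _ bX) ?(sz _ _ bY) ?sXY //.
  by rewrite (eqP FI) capv0.
by exists (F^-1)%VF => x; rewrite -FE ?FK ?KF.
Qed.

End Frames.


(** * The action on the derived ideal *)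

Section Structure.
Context {K : fieldType} {L : lieAlgType K}.
Hypothesis d2 : \dim (derived L) = 2%N.
Implicit Types (x y z p q s t v w : L).

Definition dbasis p q := basis_of (derived L) [:: p; q].

Lemma dbasisP p q : p \in derived L -> q \in derived L -> free [:: p; q] ->
  dbasis p q.
Proof.
move=> pD qD fr; rewrite /dbasis basisEfree fr d2 /= andbT.
by apply/span_subvP => x; rewrite !inE => /orP[] /eqP->.
Qed.

Lemma dbasis_span p q x : dbasis p q -> x \in derived L ->
  exists a b, x = a *: p + b *: q.
Proof. by move=> /span_basis <- /mem_span2P. Qed.

Lemma dbasis_mem p q : dbasis p q -> p \in derived L /\ q \in derived L.
Proof. by move=> b; split; apply: (basis_mem b); rewrite !inE eqxx ?orbT. Qed.

Lemma dbasis_lie0 p q : dbasis p q -> [lie p, q] = 0.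
Proof. by move=> /dbasis_mem[pD qD]; exact: derived2_abelian. Qed.

Lemma dbasis_exists : exists p q, dbasis p q.
Proof.
have bB := vbasisP (derived L).
have szB : size (vbasis (derived L)) = 2%N by rewrite size_tuple.
case E: (tval (vbasis (derived L))) szB bB => [|p [|q [|]]] //= _ bB.
by exists p, q.
Qed.

Lemma derived_lie0 x p q : dbasis p q -> [lie x, p] = 0 -> [lie x, q] = 0 ->
  {in derived L, forall y, [lie x, y] = 0}.
Proof.
move=> pq xp xq y /(dbasis_span pq)[a [b ->]].
by rewrite !lieE xp xq !scaler0 addr0.
Qed.

Lemma not_free2 x y : x != 0 -> ~~ free [:: x; y] -> exists k, y = k *: x.
Proof.
move=> x0; rewrite (@perm_free _ _ _ [:: y; x]); last first.
  by apply/permP => P /=; rewrite !addn0 addnC.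
by rewrite free_cons seq1_free x0 andbT span_seq1 negbK => /vlineP.
Qed.

(** Without a cyclic vector, every nonzero vector of the plane is an eigenvector of every [ad x];
    comparing the eigenvalues at [p], [q] and [p + q] shows that they coincide. *)
Lemma scalar_or_cyclic :
  (forall x, exists k, {in derived L, forall v, [lie x, v] = k *: v}) \/
  (exists s v, v \in derived L /\ free [:: v; [lie s, v]]).
Proof.
have [?|H] := pselect (exists s v, v \in derived L /\ free [:: v; [lie s, v]]).
  by right.
left=> x; have [p [q pq]] := dbasis_exists; have [pD qD] := dbasis_mem pq.
have eig v : v \in derived L -> v != 0 -> exists k, [lie x, v] = k *: v.
  move=> vD v0; apply: not_free2 => //; apply/negP => fr.
  by apply: H; exists x, v.
have frpq := basis_free pq.
have p0 : p != 0 by apply: (free_not0 frpq); rewrite !inE eqxx.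
have q0 : q != 0 by apply: (free_not0 frpq); rewrite !inE eqxx orbT.
have fP := free2P _ _ frpq.
have pq0 : p + q != 0.
  apply/eqP => E; have [|/eqP] := fP 1 1; first by rewrite !scale1r.
  by rewrite oner_eq0.
have [a Ea] := eig p pD p0; have [b Eb] := eig q qD q0.
have [c Ec] := eig _ (memvD pD qD) pq0.
have [ac bc] : a - c = 0 /\ b - c = 0.
  apply: fP; rewrite !scalerBl addrACA -opprD -scalerDr -Ec lieDr Ea Eb.
  exact: subrr.
exists c => v /(dbasis_span pq)[k [l ->]]; rewrite !lieE Ea Eb.
by rewrite (subr0_eq ac) (subr0_eq bc); vring.
Qed.

(** [ad t] maps all of [L] into the derived ideal and is bijective on that ideal, so [[t, x]] is
    already [[t, g]] for some [g] of the ideal. *)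
Lemma centralizer_split t x :
  {in derived L, forall g, [lie t, g] = 0 -> g = 0} ->
  exists2 g, g \in derived L & [lie t, x - g] = 0.
Proof.
move=> tI; have sD : (ad t @: derived L <= derived L)%VS.
  by apply/subvP => _ /memv_imgP[y _ ->]; rewrite adE mem_derived.
have eD : (ad t @: derived L = derived L)%VS.
  apply/eqP; rewrite eqEdim sD limg_dim_eq ?leqnn //=; apply/eqP; rewrite -subv0.
  apply/subvP => y; rewrite memv_cap memv_ker adE memv0 => /andP[yD /eqP ty].
  by rewrite (tI y yD ty).
have : [lie t, x] \in (ad t @: derived L)%VS by rewrite eD mem_derived.
case/memv_imgP => g gD; rewrite adE => E; exists g => //.
by rewrite !lieE E subrr.
Qed.

(** By the Leibniz rule [ad t] kills [[x, y]], which lies in the derived ideal, where [ad t] is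
    injective. *)
Lemma centralizer_abelian t x y :
  {in derived L, forall g, [lie t, g] = 0 -> g = 0} ->
  [lie t, x] = 0 -> [lie t, y] = 0 -> [lie x, y] = 0.
Proof.
move=> tI tx ty; apply: tI; first exact: mem_derived.
by rewrite lie_leibniz tx ty !lieE addr0.
Qed.

(** When [p], [q] is a basis of the derived ideal and [ad t] is injective there, this is the center
    of [L]. *)
Definition joint_centralizer p q t : {vspace L} :=
  (lker (ad t) :&: (lker (ad p) :&: lker (ad q)))%VS.

Lemma joint_centralizerP p q t x :
  reflect [/\ [lie t, x] = 0, [lie x, p] = 0 & [lie x,
    q] = 0] (x \in joint_centralizer p q t).
Proof.
rewrite !memv_cap !memv_ker !adE (lieC p) (lieC q) !oppr_eq0.
by apply: (iffP and3P) => -[/eqP ? /eqP ? /eqP ?]; split=> //; apply/eqP.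
Qed.

Section Invertible.
Context (p q t : L) (pq : dbasis p q).
Hypothesis tI : {in derived L, forall g, [lie t, g] = 0 -> g = 0}.

Lemma joint_centralizer_central x : x \in joint_centralizer p q t -> central x.
Proof.
move=> /joint_centralizerP[tx xp xq] y; have [g gD ty] := centralizer_split y tI.
rewrite -[y](subrK g) lieDr (centralizer_abelian tI tx ty) add0r.
exact: (derived_lie0 pq).
Qed.

Lemma joint_centralizer_free : free ([:: p; q] ++ vbasis (joint_centralizer p q t)).
Proof.
rewrite cat_free (basis_free pq) (basis_free (vbasisP _)) /=.
apply/directv_addP/eqP; rewrite (span_basis pq) (span_basis (vbasisP _)) -subv0.
apply/subvP => x; rewrite memv_cap => /andP[xD /joint_centralizerP[tx _ _]].
by rewrite memv0 (tI xD tx).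
Qed.

(** A vector is corrected by an element of the derived ideal so as to commute with [t], then by a
    multiple of [t] so as to act trivially on the plane; what remains is central. *)
Lemma frame3 : (forall y, exists k, [lie y, p] = k *: [lie t, p] /\
    [lie y, q] = k *: [lie t, q]) ->
  exists Z, basis_of fullv ([:: p; q; t] ++ Z) /\ {in Z, forall z, central z}.
Proof.
move=> H; exists (vbasis (joint_centralizer p q t)); split; last first.
  by move=> z /vbasis_mem; exact: joint_centralizer_central.
have [pD qD] := dbasis_mem pq.
have p0 : p != 0 by apply: (free_not0 (basis_free pq)); rewrite !inE eqxx.
have fr : free (t :: [:: p; q] ++ vbasis (joint_centralizer p q t)).
  apply: (@free_cons_lie _ _ p); last exact: joint_centralizer_free.
    by apply: contraNneq p0 => E; apply/eqP/tI; rewrite // lieC E oppr0.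
  move=> y; rewrite mem_cat !inE -orbA => /or3P[/eqP->|/eqP->|/vbasis_mem].
  - exact: liexx.
  - exact: dbasis_lie0.
  - by move=> /joint_centralizerP[_ E _]; rewrite lieC E oppr0.
have pe : perm_eq ([:: p; q; t] ++ vbasis (joint_centralizer p q t))
    (t :: [:: p; q] ++ vbasis (joint_centralizer p q t)) by apply/permP => P /=; lia.
rewrite (perm_basis _ pe) basisEdim -(eqnP fr) dimvS ?subvf // andbT.
apply/subvP => x _; have [g gD tx] := centralizer_split x tI.
have [k [E1 E2]] := H (x - g).
have -> : x = k *: t + (g + (x - g - k *: t)) by vring.
rewrite span_cons memv_add ?memvZ ?memv_line // span_cat memv_add //.
  by rewrite (span_basis pq).
rewrite (span_basis (vbasisP _)); apply/joint_centralizerP.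
split; rewrite lieE.
- by rewrite tx !lieE scaler0 subr0.
- by rewrite E1 !lieE subrr.
- by rewrite E2 !lieE subrr.
Qed.

End Invertible.

(** Correcting [s] by an element of the derived ideal makes it commute with [t] and keeps its action
    on the abelian plane. Independence of [t] and [s'] comes from the cyclic vector: they send [v]
    to [v] and to [[s, v]]. *)
Lemma frame4 p q t s : dbasis p q -> [lie t, p] = p -> [lie t, q] = q ->
  (exists2 v, v \in derived L & free [:: v; [lie s, v]]) ->
  (forall y, exists k l, [lie y, p] = k *: p + l *: [lie s, p] /\
    [lie y, q] = k *: q + l *: [lie s, q]) ->
  exists s' Z, [/\ basis_of fullv ([:: p; q; s'; t] ++ Z),
    {in Z, forall z, central z}, [lie s', t] = 0,
    [lie s', p] = [lie s, p] & [lie s', q] = [lie s, q]].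
Proof.
move=> pq tp tq [v vD frv] H; have [pD qD] := dbasis_mem pq.
have tE g : g \in derived L -> [lie t, g] = g.
  by move=> /(dbasis_span pq)[a [b ->]]; rewrite !lieE tp tq.
have tI : {in derived L, forall g, [lie t, g] = 0 -> g = 0}.
  by move=> g gD; rewrite tE.
have [g gD ts] := centralizer_split s tI.
set s' := s - g in ts.
have sE x : x \in derived L -> [lie s', x] = [lie s, x].
  by move=> xD; rewrite /s' lieDl lieNl (derived2_abelian d2 gD xD) subr0.
clearbody s'.
exists s', (vbasis (joint_centralizer p q t)).
have s't : [lie s', t] = 0 by rewrite lieC ts oppr0.
have annD x y : x \in joint_centralizer p q t -> y \in derived L -> [lie x, y] = 0.
  by move=> /joint_centralizerP[_ xp xq]; exact: (derived_lie0 pq).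
split=> //; try exact: sE; last by move=> z /vbasis_mem;
  exact: joint_centralizer_central.
have fr : free (s' :: t :: [:: p; q] ++ vbasis (joint_centralizer p q t)).
  have pqZ y : y \in [:: p; q] ++ vbasis (joint_centralizer p q t) -> [lie v, y] = 0.
    rewrite mem_cat !inE -orbA => /or3P[/eqP->|/eqP->|/vbasis_mem yZ].
    - exact: derived2_abelian.
    - exact: derived2_abelian.
    - by rewrite lieC annD ?oppr0.
  have v0 : v != 0 by apply: (free_not0 frv); rewrite !inE eqxx.
  have frt : free (t :: [:: p; q] ++ vbasis (joint_centralizer p q t)).
    apply: (@free_cons_lie _ _ v); [|exact: pqZ|exact: joint_centralizer_free].
    by rewrite lieC tE // oppr_eq0.
  rewrite free_cons frt andbT; apply/negP; rewrite span_cons.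
  case/memv_addP => _ /vlineP[k ->] [y yS E].
  have vy : [lie v, y] = 0 by apply: (@span_lie0 _ _ _ ([:: p;
    q] ++ vbasis (joint_centralizer p q t))).
  have [] := free2P _ _ frv k (-1).
    by rewrite -sE // E !lieE (lieC y) vy tE //; vring.
  by move=> _ /eqP; rewrite oppr_eq0 oner_eq0.
have pe : perm_eq ([:: p; q; s'; t] ++ vbasis (joint_centralizer p q t))
    (s' :: t :: [:: p; q] ++ vbasis (joint_centralizer p q t)) by apply/permP =>
      P /=; lia.
rewrite (perm_basis _ pe) basisEdim -(eqnP fr) dimvS ?subvf // andbT.
apply/subvP => x _; have [h hD tx] := centralizer_split x tI.
have [k [l [E1 E2]]] := H (x - h).
apply/span_cons2P; exists l, k, (h + (x - h - l *: s' - k *: t)); split; last by vring.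
rewrite span_cat memv_add ?(span_basis pq) // (span_basis (vbasisP _)).
apply/joint_centralizerP; split;
  rewrite !(lieDl, lieDr, lieNl, lieNr, lie_scale_l, lie_scale_r).
- by move: tx; rewrite lieDr lieNr ts liexx => ->; rewrite !scaler0 !subr0.
- by move: E1; rewrite lieDl lieNl => ->; rewrite sE // tp; vring.
- by move: E2; rewrite lieDl lieNl => ->; rewrite sE // tq; vring.
Qed.

End Structure.


(** * Singular operators *)

Section Degenerate.
Context {K : fieldType} {L : lieAlgType K}.
Hypothesis d2 : \dim (derived L) = 2%N.
Implicit Types (x y z p q s t v w : L) (S Z B : seq L).

Lemma derived_sub B (W : {vspace L}) : basis_of fullv B ->
  {in B &, forall x y, [lie x, y] \in W} -> (derived L <= W)%VS.
Proof.
move=> bB BW; have bxW x : x \in B -> forall y, [lie x, y] \in W.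
  move=> xB y; have : y \in <<in_tuple B>>%VS by rewrite (span_basis bB) memvf.
  move=> /coord_span->; rewrite lie_sum_r memv_suml // => i _.
  by rewrite lie_scale_r memvZ // BW // mem_nth.
apply/lie_prod_subP => x y _ _.
have : x \in <<in_tuple B>>%VS by rewrite (span_basis bB) memvf.
move=> /coord_span->; rewrite lie_sum_l memv_suml // => i _.
by rewrite lie_scale_l memvZ // bxW // mem_nth.
Qed.

Lemma central_r x y : central y -> [lie x, y] = 0.
Proof. by move=> cy; rewrite lieC cy oppr0. Qed.

Lemma dbasis_neq0 p q : dbasis p q -> p != 0 /\ q != 0.
Proof.
by move=> /basis_free fr; split; apply: (free_not0 fr); rewrite !inE eqxx ?orbT.
Qed.

Lemma dbasis_lines p q k : dbasis p q -> k *: p \in <[q]>%VS -> k = 0.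
Proof.
move=> /basis_free/free2P fr /vlineP[l E]; have [] // := fr k (- l).
by rewrite E scaleNr subrr.
Qed.

Lemma dbasis_sym p q : dbasis p q -> dbasis q p.
Proof.
by rewrite /dbasis (@perm_basis _ _ _ [:: q; p]) //; apply/permP => P /=;
  rewrite addnCA.
Qed.

Lemma basis_rot3 a b c B : basis_of fullv [:: a, b, c & B] ->
  basis_of fullv [:: b, c, a & B].
Proof.
rewrite (@perm_basis _ _ _ [:: b, c, a & B]) //; apply/permP => P /=.
by rewrite (addnCA (P c)) addnCA.
Qed.

(** In both uses this subspace has codimension two, and the Leibniz rule with [t] confines its
    brackets to a line. The nilpotent case takes the first two arguments equal. *)
Definition rel_centralizer p q t : {vspace L} :=
  (lker (ad p) :&: (ad t @^-1: <[q]>))%VS.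

Lemma rel_centralizerP p q t x :
  reflect ([lie x, p] = 0 /\ exists k, [lie t,
    x] = k *: q) (x \in rel_centralizer p q t).
Proof.
rewrite memv_cap memv_ker !adE (lieC p) oppr_eq0 -memv_preim adE.
by apply: (iffP andP) => -[/eqP ? /vlineP ?]; split.
Qed.

Definition hframe p q t Z B := [/\ basis_of fullv ([:: p; q; t] ++ B ++ Z),
  {in Z, forall z, central z} & {in B, forall b, [lie p, b] = 0}].

(** For [u], [v] in [W], [ad t] kills [[u, v]] because [q] is central, so [[u, v]] has no component
    along [p]. On a complement [U] of [q] in [W], the linear form [ad t] is compared with the
    bracket. If [h] represents it, [t - h] commutes with [U] and spans with [p] a copy of aff(R)
    commuting with the rest; otherwise a radical vector [x] satisfies [[t, x] = q]. *)
Lemma diag_case p q t : dbasis p q -> [lie t, p] = p -> central q ->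
  (forall y, exists k, [lie y, p] = k *: p) ->
  (exists t' S Z, [/\ hframe p q t' Z S, [lie t', p] = p, S != [::],
     hyperbolic q S & {in S, forall s, [lie t', s] = 0}]) \/
  (exists t' x S Z, [/\ hframe p q t' Z (x :: S), [lie t', p] = p,
     [lie t', x] = q, hyperbolic q S
     & {in S, forall s, [lie t', s] = 0 /\ [lie x, s] = 0}]).
Proof.
move=> pq tp cq H; have [pD qD] := dbasis_mem pq; have [p0 q0] := dbasis_neq0 pq.
pose W := rel_centralizer p q t; have tq := central_r t cq.
have WW : {in W &, forall u v, [lie u, v] \in <[q]>%VS}.
  move=> u v /rel_centralizerP[up [k tu]] /rel_centralizerP[vp [l tv]].
  have [a [b E]] := dbasis_span pq (mem_derived u v).
  have := lie_leibniz t u v; rewrite tu tv E !lieE tp tq.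
  rewrite cq (central_r u cq) !scaler0 !addr0 => /eqP.
  by rewrite scaler_eq0 (negPf p0) orbF => /eqP ->;
    rewrite scale0r add0r memvZ ?memv_line.
have qW : q \in W.
  by apply/rel_centralizerP; split; [exact: cq | exists 0; rewrite tq scale0r].
pose U := (W :\: <[q]>)%VS.
have UW u : u \in U -> u \in W by apply/subvP/diffvSl.
have UU : {in U &, forall u v, [lie u, v] \in <[q]>%VS}.
  by move=> u v /UW uW /UW vW; apply: WW.
have tU : {in U, forall u, ad t u \in <[q]>%VS}.
  by move=> u /UW/rel_centralizerP[_ [k E]]; rewrite adE E memvZ ?memv_line.
have t'p t' : t' - t \in W -> [lie t', p] = p.
  by move=> /rel_centralizerP[E _]; rewrite -[t'](subrK t) lieDl E tp add0r.
have full t' B : t' - t \in W -> basis_of U B -> basis_of fullv [:: p, q, t' & B].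
  move=> t'W /(diff_step q0 qW) bW; apply/basis_rot3/(top_step _ _ _ _ bW).
  - by rewrite lieC t'p // oppr_eq0.
  - by move=> u /rel_centralizerP[E _]; rewrite lieC E oppr0.
  - apply/negP => /rel_centralizerP[_ [k]]; rewrite tp => E.
    have := @dbasis_lines p q 1 pq;
      rewrite scale1r E memvZ ?memv_line // => /(_ isT)/eqP.
    by rewrite oner_eq0.
  move=> x; have [k E] := H x.
  have [a [b Et]] := dbasis_span pq (mem_derived t (x - k *: t')).
  exists k, a; apply/rel_centralizerP; split.
    by rewrite !lieE E (t'p t') // subrr sub0r scaler0 oppr0.
  by exists b; rewrite lieDr Et !lieE tp; vring.
have BU B b : basis_of U B -> b \in B -> [lie p, b] = 0.
  move=> bU bB; have /UW/rel_centralizerP[E _] := basis_mem bU bB.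
  by rewrite lieC E oppr0.
have [[h hU hE]|[x [xU tx xZ]]] := form_dichotomy q0 UU (f := ad t) tU.
  have [S [Z [bSZ hS rZ]]] := hyperbolic_split q0 UU.
  pose t' := t - h.
  have t'W : t' - t \in W by rewrite /t' addrAC subrr sub0r memvN UW.
  have t'U u : u \in U -> [lie t', u] = 0.
    by move=> uU; rewrite lieDl lieNl hE // [X in _ - X]adE subrr.
  have SU s : s \in S -> s \in U.
    by move=> sS; apply: (basis_mem bSZ); rewrite mem_cat sS.
  have ZU z : z \in Z -> z \in U.
    by move=> zZ; apply: (basis_mem bSZ); rewrite mem_cat zZ orbT.
  have bF := full _ _ t'W bSZ.
  have cZ : {in Z, forall z, central z}.
    move=> z zZ; apply: (basis_central bF) => y.
    rewrite !inE => /or4P[/eqP->|/eqP->|/eqP->|yB].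
    - by have /UW/rel_centralizerP[] := ZU z zZ.
    - exact: central_r.
    - by rewrite lieC t'U ?oppr0 ?ZU.
    - by apply: rZ => //; exact: basis_mem bSZ yB.
  left; exists t', S, Z; split=> //.
  - by split=> // s sS; apply: (BU _ _ bSZ); rewrite mem_cat sS.
  - exact: t'p.
  (* Without a hyperbolic pair no bracket would reach [q], and the derived ideal would be the line
     of [p]. *)
  - apply/negP => /eqP S0; move: bF; rewrite S0 cat0s => bF.
    have /dimvS : (derived L <= <[p]>)%VS.
      apply: (derived_sub bF) => u v.
      rewrite !inE => /or4P[/eqP->|/eqP->|/eqP->|/cZ-> //] ; last by rewrite mem0v.
      + move=> /or4P[/eqP->|/eqP->|/eqP->|/cZ cv]; rewrite ?liexx ?mem0v //.
        * by rewrite central_r ?mem0v.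
        * by rewrite lieC memvN t'p // memv_line.
        * by rewrite central_r ?mem0v.
      + by rewrite cq mem0v.
      + move=> /or4P[/eqP->|/eqP->|/eqP->|/cZ cv]; rewrite ?liexx ?mem0v //.
        * by rewrite t'p // memv_line.
        * by rewrite central_r ?mem0v.
        * by rewrite central_r ?mem0v.
    by rewrite d2 dim_vline; case: (p != 0).
  - by move=> s /SU; exact: t'U.
(* [x] is orthogonal to all of [U]; the symplectic basis is taken in the kernel of [ad t], a
   complement of [x] in [U]. *)
right; pose U3 := (U :&: lker (ad t))%VS.
have U3U u : u \in U3 -> u \in U by apply/subvP/capvSl.
have [S [Z [bSZ hS rZ]]] := hyperbolic_split (U := U3) q0 (sub_in2 U3U UU).
have bxSZ := ker_step q0 tU xU tx bSZ.
have bF := full t _ (etrans (congr1 (fun u => u \in W) (subrr t)) (mem0v W)) bxSZ.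
have tS s : s \in S ++ Z -> [lie t, s] = 0.
  by move/(basis_mem bSZ); rewrite memv_cap memv_ker adE => /andP[_ /eqP].
have xS s : s \in S ++ Z -> [lie x, s] = 0 by move/(basis_mem bSZ)/U3U/xZ.
exists t, x, S, Z; split=> //; last first.
- by move=> s sS; split; [apply: tS | apply: xS]; rewrite mem_cat sS.
- by rewrite -tx; exact/esym/adE.
split=> //; last first.
  move=> s sS; apply: (BU _ _ bxSZ); move: sS; rewrite !inE mem_cat.
  by case/orP => ->; rewrite ?orbT.
move=> z zZ; have zSZ : z \in S ++ Z by rewrite mem_cat zZ orbT.
have zU3 := basis_mem bSZ zSZ.
apply: (basis_central bF) => y; rewrite !inE => /or4P[/eqP->|/eqP->|/eqP->|].
- by have /UW/rel_centralizerP[] := U3U _ zU3.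
- exact: central_r.
- by rewrite lieC tS ?oppr0.
case/predU1P => [->|yB]; first by rewrite lieC xS ?oppr0.
by apply: rZ => //; exact: basis_mem bSZ yB.
Qed.

(* Here the form is alternating with values in <p>, while ad t takes values in
   <q>; the linear form to compare with is therefore (ad t)^2. *)
Lemma nilpotent_case p q t : dbasis p q -> [lie t, q] = p -> central p ->
  (forall y, exists k, [lie y, q] = k *: p) ->
  (exists t' a b S Z, [/\ hframe q p t' Z [:: a, b & S], [lie t', q] = p,
     [lie t', a] = q, hyperbolic p [:: a, b & S]
     & {in b :: S, forall s, [lie t', s] = 0}]) \/
  (exists t' x S Z, [/\ hframe q p t' Z (x :: S), [lie t', q] = p,
     [lie t', x] = q, hyperbolic p S
     & {in S, forall s, [lie t', s] = 0 /\ [lie x, s] = 0}]).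
Proof.
move=> pq tq cp H; have [pD qD] := dbasis_mem pq; have [p0 q0] := dbasis_neq0 pq.
pose W := rel_centralizer q q t; have tp := central_r t cp.
have WW : {in W &, forall u v, [lie u, v] \in <[p]>%VS}.
  move=> u v /rel_centralizerP[uq [k tu]] /rel_centralizerP[vq [l tv]].
  have [a [b E]] := dbasis_span pq (mem_derived u v).
  have := lie_leibniz t u v; rewrite tu tv E !lieE tp tq (lieC q) uq vq.
  rewrite oppr0 !scaler0 !addr0 add0r => /eqP.
  by rewrite scaler_eq0 (negPf p0) orbF => /eqP ->;
    rewrite scale0r addr0 memvZ ?memv_line.
have pW : p \in W.
  by apply/rel_centralizerP; split; [exact: cp | exists 0; rewrite tp scale0r].
pose U := (W :\: <[p]>)%VS.
have UW u : u \in U -> u \in W by apply/subvP/diffvSl.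
have UU : {in U &, forall u v, [lie u, v] \in <[p]>%VS}.
  by move=> u v /UW uW /UW vW; apply: WW.
have ttU : {in U, forall u, (ad t \o ad t)%VF u \in <[p]>%VS}.
  by move=> u /UW/rel_centralizerP[_ [k E]];
    rewrite comp_lfunE !adE E lieE tq memvZ ?memv_line.
have qtt u : u \in U -> exists k, [lie t, u] = k *: q /\ (ad t \o ad t)%VF u = k *: p.
  by move=> /UW/rel_centralizerP[_ [k E]]; exists k; rewrite comp_lfunE !adE E lieE tq.
have full B : basis_of U B -> basis_of fullv [:: q, p, t & B].
  move=> /(diff_step p0 pW) bW; apply/basis_rot3/(top_step _ _ _ _ bW).
  - by rewrite lieC tq // oppr_eq0.
  - by move=> u /rel_centralizerP[E _]; rewrite lieC E oppr0.
  - apply/negP => /rel_centralizerP[_ [k]]; rewrite tq => E.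
    have := @dbasis_lines p q 1 pq;
      rewrite scale1r E memvZ ?memv_line // => /(_ isT)/eqP.
    by rewrite oner_eq0.
  move=> x; have [k E] := H x.
  have [a [b Et]] := dbasis_span pq (mem_derived t (x - k *: t)).
  exists k, a; apply/rel_centralizerP; split.
    by rewrite !lieE E tq // subrr sub0r scaler0 oppr0.
  by exists b; rewrite lieDr Et !lieE tq; vring.
have BU B b : basis_of U B -> b \in B -> [lie q, b] = 0.
  move=> bU bB; have /UW/rel_centralizerP[E _] := basis_mem bU bB.
  by rewrite lieC E oppr0.
have [[h hU hE]|[x [xU tx xZ]]] := form_dichotomy p0 UU (f := (ad t \o ad t)%VF) ttU.
  (* If [ad t] vanished on [U], no bracket would reach [q] and the derived ideal would be the line
     of [p]. *)
  left; have [a aU ta] : exists2 a, a \in U & [lie t, a] = q.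
    have [t0|] := pselect ({in U, forall u, [lie t, u] = 0}).
      have bF := full _ (vbasisP U).
      have sD : (derived L <= <[p]>)%VS.
        apply: (derived_sub bF) => u v.
        rewrite !inE => /or4P[/eqP->|/eqP->|/eqP->|/vbasis_mem uU].
        + move=> /or4P[/eqP->|/eqP->|/eqP->|/vbasis_mem vU]; rewrite ?liexx ?mem0v //.
          * by rewrite central_r ?mem0v.
          * by rewrite lieC memvN tq // memv_line.
          * by have /UW/rel_centralizerP[E _] := vU; rewrite lieC E oppr0 mem0v.
        + by rewrite cp mem0v.
        + move=> /or4P[/eqP->|/eqP->|/eqP->|/vbasis_mem vU]; rewrite ?liexx ?mem0v //.
          * by rewrite tq // memv_line.
          * by rewrite central_r ?mem0v.
          * by rewrite t0 ?mem0v.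
        + move=> /or4P[/eqP->|/eqP->|/eqP->|/vbasis_mem vU]; rewrite ?liexx ?mem0v //.
          * by have /UW/rel_centralizerP[E _] := uU; rewrite E mem0v.
          * by rewrite central_r ?mem0v.
          * by rewrite lieC t0 // oppr0 mem0v.
          * exact: UU.
      by have := dimvS sD; rewrite d2 dim_vline; case: (p != 0).
    move=> /existsNP[u /not_implyP[uU /eqP tu]].
    have [k [E _]] := qtt u uU.
    have k0 : k != 0 by apply: contraNneq tu => k0; rewrite E k0 scale0r.
    exists (k^-1 *: u); first by rewrite memvZ.
    by rewrite !lieE E scalerA mulVf // scale1r.
  have hg u k : u \in U -> [lie t, u] = k *: q -> [lie h, u] = k *: p.
    move=> uU tu; rewrite hE // -[LHS]/((ad t \o ad t)%VF u) comp_lfunE !adE tu.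
    by rewrite lie_scale_r tq.
  (* [h] represents the square of [ad t], so [[h, a] = p]; the sign is chosen for [[a, b] = p].
     Since [[h, h] = 0], that square vanishes at [b], and on [U] this makes [[t, b]] vanish as
     well. *)
  pose b := - h; have bU : b \in U by rewrite memvN.
  have ab : [lie a, b] = p.
    by rewrite /b lieNr lieC opprK (hg a 1) ?scale1r.
  have tb : [lie t, b] = 0.
    have [k [E _]] := qtt b bU; have := hg b k bU E.
    rewrite /b lieNr liexx oppr0 => /esym/eqP; rewrite scaler_eq0 (negPf p0) orbF.
    by move=> /eqP k0; rewrite -/b E k0 scale0r.
  pose U3 := (U :&: (lker (ad a) :&: lker (ad b)))%VS.
  have U3U u : u \in U3 -> u \in U by apply/subvP/capvSl.
  have [S [Z [bSZ hS rZ]]] := hyperbolic_split (U := U3) p0 (sub_in2 U3U UU).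
  have [bF0 kab] := hyper_step p0 UU aU bU ab bSZ.
  have bF := full _ bF0.
  (* Orthogonality to [b] says that the square of [ad t] vanishes, which on [U] forces [ad t] itself
     to vanish. *)
  have tS s : s \in S ++ Z -> [lie t, s] = 0.
    move=> sS; have sU := U3U _ (basis_mem bSZ sS).
    have [k [E _]] := qtt s sU; have := hg s k sU E.
    have := (kab s sS).2; rewrite /b lieNl => /eqP; rewrite oppr_eq0 => /eqP->.
    by move=> /esym/eqP; rewrite scaler_eq0 (negPf p0) orbF E => /eqP->;
      rewrite scale0r.
  exists t, a, b, S, Z; split=> //.
  - split=> //.
      move=> z zZ; have zSZ : z \in S ++ Z by rewrite mem_cat zZ orbT.
      apply: (basis_central bF) => y; rewrite !inE => /or4P[/eqP->|/eqP->|/eqP->|].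
      + by have /U3U/UW/rel_centralizerP[] := basis_mem bSZ zSZ.
      + exact: central_r.
      + by rewrite lieC tS ?oppr0.
      move=> /or3P[/eqP->|/eqP->|yB].
      + by rewrite lieC (kab z zSZ).1 oppr0.
      + by rewrite lieC (kab z zSZ).2 oppr0.
      + by apply: rZ => //; exact: basis_mem bSZ yB.
    move=> s sS; apply: (BU _ _ bF0); move: sS; rewrite !inE mem_cat.
    by case/or3P => ->; rewrite ?orbT.
  - by split=> // s sS; apply: kab; rewrite mem_cat sS.
  - move=> s; rewrite inE => /predU1P[->//|sS]; apply: tS.
    by rewrite mem_cat sS.
right; pose U3 := (U :&: lker (ad t \o ad t)%VF)%VS.
have U3U u : u \in U3 -> u \in U by apply/subvP/capvSl.
have [S [Z [bSZ hS rZ]]] := hyperbolic_split (U := U3) p0 (sub_in2 U3U UU).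
have bxSZ := ker_step p0 ttU xU tx bSZ.
have bF := full _ bxSZ.
have tS s : s \in S ++ Z -> [lie t, s] = 0.
  move=> sS; have := basis_mem bSZ sS; rewrite memv_cap memv_ker => /andP[sU].
  have [k [-> ->]] := qtt s sU; rewrite scaler_eq0 (negPf p0) orbF => /eqP->.
  by rewrite scale0r.
have xS s : s \in S ++ Z -> [lie x, s] = 0 by move/(basis_mem bSZ)/U3U/xZ.
exists t, x, S, Z; split=> //; last first.
- by move=> s sS; split; [apply: tS | apply: xS]; rewrite mem_cat sS.
- have [k [E1 E2]] := qtt x xU; rewrite E1.
  have /eqP : (k - 1) *: p = 0 by rewrite scalerBl scale1r -E2 -[X in _ - X]tx subrr.
  by rewrite scaler_eq0 (negPf p0) orbF subr_eq0 => /eqP->; rewrite scale1r.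
split=> //; last first.
  move=> s sS; apply: (BU _ _ bxSZ); move: sS; rewrite !inE mem_cat.
  by case/orP => ->; rewrite ?orbT.
move=> z zZ; have zSZ : z \in S ++ Z by rewrite mem_cat zZ orbT.
apply: (basis_central bF) => y; rewrite !inE => /or4P[/eqP->|/eqP->|/eqP->|].
- by have /U3U/UW/rel_centralizerP[] := basis_mem bSZ zSZ.
- exact: central_r.
- by rewrite lieC tS ?oppr0.
case/predU1P => [->|yB]; first by rewrite lieC xS ?oppr0.
by apply: rZ => //; exact: basis_mem bSZ yB.
Qed.

End Degenerate.


(** * Indecomposability *)

Section Indecomposable.
Context {K : fieldType} {L : lieAlgType K}.
Hypothesis d2 : \dim (derived L) = 2%N.
Implicit Types (x y z p q s t v w : L) (S Z B : seq L).

Lemma dim1_line (U : {vspace L}) : \dim U = 1%N -> exists2 p, p != 0 & U = <[p]>%VS.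
Proof.
move=> U1; have p0 : vpick U != 0 by rewrite vpick0 -dimv_eq0 U1.
exists (vpick U) => //; apply/esym/eqP; rewrite eqEdim dim_vline p0 U1 andbT.
by rewrite -memvE memv_pick.
Qed.

(** A factor meeting the derived ideal only in zero has only zero brackets, so it is central, hence
    inside the derived ideal, hence zero. Both factors therefore meet the ideal, and by dimension
    each does so in a line. *)
Lemma decomposable_diag : (forall x, central x -> x \in derived L) ->
  decomposable L -> exists p q, dbasis p q /\
    forall x, exists x1 x2, [/\ x = x1 + x2, [lie x1, q] = 0, [lie x2, p] = 0 &
      forall y, [lie x1, y] \in <[p]>%VS /\ [lie x2, y] \in <[q]>%VS].
Proof.
move=> zD [U [V [[U0 V0] [/lie_prod_subP UU /lie_prod_subP VV] UV0 UVf UV]]].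
have UV' u v : u \in U -> v \in V -> [lie u, v] = 0.
  by move=> uU vV; apply/eqP; rewrite -memv0 -UV0 memv_lie_prod.
have VU' u v : u \in U -> v \in V -> [lie v, u] = 0.
  by move=> uU vV; rewrite lieC UV' ?oppr0.
pose A := (derived L :&: U)%VS; pose B := (derived L :&: V)%VS.
have AA u u' : u \in U -> u' \in U -> [lie u, u'] \in A.
  by move=> uU u'U; rewrite memv_cap mem_derived UU.
have BB u u' : u \in V -> u' \in V -> [lie u, u'] \in B.
  by move=> uU u'U; rewrite memv_cap mem_derived VV.
have dec x : exists u v, [/\ x = u + v, u \in U & v \in V].
  have : x \in (U + V)%VS by rewrite UVf memvf.
  by move=> /memv_addP[u uU [v vV ->]]; exists u, v.
have uA u y : u \in U -> [lie u, y] \in A.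
  by move=> uU; have [a [b [-> aU bV]]] := dec y; rewrite lieDr (UV' u b) // addr0 AA.
have vB v y : v \in V -> [lie v, y] \in B.
  by move=> vV; have [a [b [-> aU bV]]] := dec y; rewrite lieDr (VU' a v) // add0r BB.
have AB0 : (A :&: B = 0)%VS.
  apply/eqP; rewrite -subv0 -UV; apply/subvP => x.
  by rewrite !memv_cap => /andP[/andP[_ ->] /andP[_ ->]].
have ABD : (A + B = derived L)%VS.
  apply/eqP; rewrite eqEsubv subv_add !capvSl /=; apply/lie_prod_subP => x y _ _.
  have [u [v [-> uU vV]]] := dec x; rewrite lieDl; apply: memv_add.
    exact: uA.
  exact: vB.
have dAB : (\dim A + \dim B = 2)%N by rewrite -d2 -ABD dimv_disjoint_sum.
have A0 : \dim A != 0%N.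
  rewrite dimv_eq0; apply/eqP => A0; apply: U0; apply/eqP; rewrite -subv0.
  apply/subvP => u uU; rewrite -A0 memv_cap uU andbT; apply: zD => y.
  by apply/eqP; rewrite -memv0 -A0 uA.
have B0 : \dim B != 0%N.
  rewrite dimv_eq0; apply/eqP => B0; apply: V0; apply/eqP; rewrite -subv0.
  apply/subvP => u uV; rewrite -B0 memv_cap uV andbT; apply: zD => y.
  by apply/eqP; rewrite -memv0 -B0 vB.
have [p p0 Ap] := dim1_line (U := A) ltac:(lia).
have [q q0 Bq] := dim1_line (U := B) ltac:(lia).
have /andP[pD pU] : (p \in derived L) && (p \in U)
  by rewrite -memv_cap -/A Ap memv_line.
have /andP[qD qV] : (q \in derived L) && (q \in V)
  by rewrite -memv_cap -/B Bq memv_line.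
exists p, q; split.
  apply: dbasisP => //; rewrite free_cons seq1_free q0 andbT span_seq1 -Bq.
  apply/negP => pB; have : p \in (A :&: B)%VS by rewrite memv_cap pB Ap memv_line.
  by rewrite AB0 memv0 (negPf p0).
move=> x; have [u [v [-> uU vV]]] := dec x; exists u, v; split=> //.
- exact: UV'.
- exact: VU'.
- by move=> y; rewrite -Ap -Bq uA ?vB.
Qed.

Lemma decomposable_eigen : (forall x, central x -> x \in derived L) ->
  decomposable L -> exists p q, dbasis p q /\
    forall x, exists a b, [lie x, p] = a *: p /\ [lie x, q] = b *: q.
Proof.
move=> zD /(decomposable_diag zD)[p [q [pq H]]]; exists p, q; split=> // x.
have [x1 [x2 [-> x1q x2p Hx]]] := H x.
have [/vlineP[a E1] _] := Hx p; have [_ /vlineP[b E2]] := Hx q.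
by exists a, b; rewrite !lieDl x1q x2p E1 E2 addr0 add0r.
Qed.

Lemma span3P (a b c x : L) S : x \in <<[:: a, b, c & S]>>%VS ->
  exists k l m y, y \in <<S>>%VS /\ x = k *: a + l *: b + m *: c + y.
Proof.
move=> /span_cons2P[k [l [y [+ ->]]]]; rewrite span_cons.
move=> /memv_addP[_ /vlineP[m ->] [z zS ->]]; exists k, l, m, z; split=> //.
by rewrite addrA.
Qed.

Lemma scale_inj0 (a : K) x : x != 0 -> a *: x = 0 -> a = 0.
Proof. by move=> x0 /eqP; rewrite scaler_eq0 (negPf x0) orbF => /eqP. Qed.

(** On the plane [ad t] has square zero, so both eigenvalues vanish and [ad t] would kill the plane,
    contrary to [[t, q] = p]. *)
Lemma nilpotent_eigen p q t p' q' a b : dbasis p q -> [lie t, q] = p ->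
  [lie t, p] = 0 -> dbasis p' q' -> [lie t, p'] = a *: p' -> [lie t, q'] = b *: q' ->
  False.
Proof.
move=> pq tq tp pq' Ea Eb.
have [p0 q0] := dbasis_neq0 pq; have [p'0 q'0] := dbasis_neq0 pq'.
have tt g : g \in derived L -> [lie t, [lie t, g]] = 0.
  by move=> /(dbasis_span pq)[c [e ->]]; rewrite !lieE tp tq tp lie0r !scaler0 addr0.
have [p'D q'D] := dbasis_mem pq'; have [pD qD] := dbasis_mem pq.
have a0 : a = 0.
  have := tt _ p'D; rewrite Ea lieE Ea scalerA => /(scale_inj0 p'0)/eqP.
  by rewrite mulf_eq0 orbb => /eqP.
have b0 : b = 0.
  have := tt _ q'D; rewrite Eb lieE Eb scalerA => /(scale_inj0 q'0)/eqP.
  by rewrite mulf_eq0 orbb => /eqP.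
by case/eqP: p0; rewrite -tq (derived_lie0 pq' _ _ qD) // ?Ea ?Eb ?a0 ?b0 scale0r.
Qed.

Lemma nilpotent_indecomposable p q t : (forall x, central x -> x \in derived L) ->
  dbasis p q -> [lie t, q] = p -> [lie t, p] = 0 -> ~ decomposable L.
Proof.
move=> zD pq tq tp /(decomposable_eigen zD)[p' [q' [pq' H]]].
by have [a [b [Ea Eb]]] := H t; exact: (nilpotent_eigen pq tq tp pq' Ea Eb).
Qed.

(** The components [t1] and [t2] of [t] each kill a nonzero vector of the plane, yet both act as
    multiples of the injective [ad t]; so both multiples are zero, and [ad t] with them. *)
Lemma indecomposable3 p q t : dbasis p q -> basis_of fullv [:: p; q; t] ->
  {in derived L, forall g, [lie t, g] = 0 -> g = 0} ->
  (forall y, exists k, {in derived L, forall g, [lie y, g] = k *: [lie t, g]}) ->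
  ~ decomposable L.
Proof.
move=> pq bF tI H; have [p0 q0] := dbasis_neq0 pq; have [pD qD] := dbasis_mem pq.
have tn g : g \in derived L -> g != 0 -> [lie t, g] != 0.
  by move=> gD; apply: contraNneq => /(tI g gD) ->.
have zD x : central x -> x \in derived L.
  move=> cx; have : x \in <<[:: p; q; t]>>%VS by rewrite (span_basis bF) memvf.
  move=> /span3P[k [l [m [y [+ E]]]]]; rewrite span_nil memv0 => /eqP y0.
  have := cx p; rewrite E y0 !lieE (lieC q) (dbasis_lie0 d2 pq) oppr0 !scaler0 addr0
    !add0r.
  move=> /(scale_inj0 (tn p pD p0)) ->.
  by rewrite scale0r !addr0 memvD ?memvZ.
move=> /(decomposable_diag zD)[p' [q' [pq' D]]].
have [p'0 q'0] := dbasis_neq0 pq'; have [p'D q'D] := dbasis_mem pq'.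
have [t1 [t2 [Et t1q t2p _]]] := D t.
have [k1 E1] := H t1; have [k2 E2] := H t2.
have k10 : k1 = 0 by apply: (scale_inj0 (tn q' q'D q'0)); rewrite -E1.
have k20 : k2 = 0 by apply: (scale_inj0 (tn p' p'D p'0)); rewrite -E2.
by case/eqP: (tn p pD p0); rewrite {1}Et lieDl E1 // E2 // k10 k20 !scale0r addr0.
Qed.

(** Bracketing a central vector with [v] gives a relation between [v] and [[s, v]] whose
    coefficients are those along [t] and [s]. *)
Lemma center4 p q s t : dbasis p q -> basis_of fullv [:: p; q; s; t] ->
  {in derived L, forall g, [lie t, g] = g} ->
  (exists2 v, v \in derived L & free [:: v; [lie s, v]]) ->
  forall x, central x -> x \in derived L.
Proof.
move=> pq bF tE [v vD fr] x cx; have [pD qD] := dbasis_mem pq.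
have : x \in <<[:: p; q; s; t]>>%VS by rewrite (span_basis bF) memvf.
move=> /span3P[k [l [m [y [+ E]]]]]; rewrite span_seq1 => /vlineP[n En].
have [n0 m0] : n = 0 /\ m = 0.
  apply: (free2P _ _ fr); have := cx v; rewrite E En !lieE tE //.
  by rewrite (derived2_abelian d2 pD vD) (derived2_abelian d2 qD vD) !scaler0 !add0r
    addrC.
by rewrite E En n0 m0 !scale0r !addr0 memvD ?memvZ.
Qed.

(** [ad t] is diagonal on the plane, so eigenlines alone give no contradiction. The vector [x]
    supplies it: each [y] scales [p] and sends [x] to a multiple of [q] with the same coefficient.
    For the two components of [t], exactly one coefficient is nonzero, otherwise [q] would be zero
    or [ad t] would kill the plane. That component carries all of [[t, x] = q], so [q] is on the
    line of its factor; but [ad t] kills the line of the other factor, which is thus again the line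
    of [q]. *)
Lemma indecomposable621 p q t x S : dbasis p q -> central q ->
  basis_of fullv [:: p, q, t, x & S] -> [lie t, p] = p -> [lie t, x] = q ->
  {in x :: S, forall b, [lie p, b] = 0} ->
  hyperbolic q S -> {in S, forall s, [lie t, s] = 0 /\ [lie x, s] = 0} ->
  ~ decomposable L.
Proof.
move=> pq cq bF tp tx pB hS tS; have tq := central_r t cq.
have [p0 q0] := dbasis_neq0 pq; have [pD qD] := dbasis_mem pq.
have pq0 := dbasis_lie0 d2 pq.
have px : [lie p, x] = 0 by rewrite pB ?inE ?eqxx.
have pS : {in S, forall s, [lie p, s] = 0} by move=> s sS; rewrite pB ?inE ?sS ?orbT.
have sp y : exists k l m n s, s \in <<S>>%VS /\
    y = k *: p + l *: q + m *: t + n *: x + s.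
  have : y \in <<[:: p, q, t, x & S]>>%VS by rewrite (span_basis bF) memvf.
  move=> /span3P[k [l [m [z [+ ->]]]]]; rewrite span_cons.
  move=> /memv_addP[_ /vlineP[n ->] [s sS ->]]; exists k, l, m, n, s.
  by split=> //; rewrite !addrA.
have act y : exists m, [lie y, p] = m *: p /\ [lie y, x] = m *: q.
  have [k [l [m [n [s [sS ->]]]]]] := sp y; exists m.
  rewrite !lieE tp tx px !cq (lieC x p) px (lieC s p) (span_lie0 pS sS).
  have -> : [lie s, x] = 0.
    by rewrite lieC (span_lie0 (fun z zS => (tS z zS).2) sS) oppr0.
  by rewrite oppr0 !scaler0 !addr0 !add0r.
have zD y : central y -> y \in derived L.
  have [k [l [m [n [s [sS ->]]]]]] := sp y => cy.
  have sp0 : [lie s, p] = 0 by rewrite lieC (span_lie0 pS sS) oppr0.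
  have st0 : [lie s, t] = 0.
    by rewrite lieC (span_lie0 (fun z zS => (tS z zS).1) sS) oppr0.
  have m0 : m = 0.
    apply: (scale_inj0 p0); have := cy p.
    by rewrite !lieE tp cq (lieC x p) px sp0 oppr0 !scaler0 !addr0 !add0r.
  have [k0 n0] : k = 0 /\ n = 0.
    apply: (free2P _ _ (basis_free pq)); have := cy t.
    rewrite !lieE cq st0 (lieC p) (lieC x) tp tx => E; apply: oppr_inj.
    by rewrite oppr0 -E; vring.
  have s0 : s = 0.
    apply: (hyperbolic_nondeg q0 hS sS) => z zS; have := cy z.
    by rewrite k0 m0 n0 !scale0r !addr0 add0r lieDl lie_scale_l cq scaler0 add0r.
  by rewrite k0 m0 n0 s0 !scale0r !addr0 add0r memvZ.
move=> /(decomposable_diag zD)[p' [q' [pq' D]]].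
have [p'0 q'0] := dbasis_neq0 pq'; have [p'D q'D] := dbasis_mem pq'.
have [t1 [t2 [Et t1q t2p Ht]]] := D t.
have [l1 [E1 F1]] := act t1; have [l2 [E2 F2]] := act t2.
have ker a y : [lie y, p] = a *: p ->
  {in derived L, forall g, [lie y, g] = a *: [lie t, g]}.
  move=> E g /(dbasis_span pq)[b [c ->]]; rewrite !lieE E tp tq (central_r y cq).
  vring.
have tker g : g \in derived L -> [lie t, g] = 0 -> exists k, g = k *: q.
  move=> /(dbasis_span pq)[a [b ->]]; rewrite !lieE tp tq scaler0 addr0.
  by move=> /(scale_inj0 p0) ->; exists b; rewrite scale0r add0r.
have qE : q = [lie t1, x] + [lie t2, x] by rewrite -lieDl -Et tx.
have line (u w : L) : dbasis u w -> (exists k, u = k *: q) -> q \in <[w]>%VS -> False.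
  move=> uw [k Eu] qw; have := @dbasis_lines _ _ _ _ 1 uw.
  by rewrite scale1r Eu memvZ // => /(_ isT)/eqP; rewrite oner_eq0.
have [l10|l10] := eqVneq l1 0.
  have [l20|l20] := eqVneq l2 0.
    by case/eqP: q0; rewrite qE F1 F2 l10 l20 !scale0r addr0.
  apply: (line _ _ pq').
    apply: tker => //; apply: (scalerI l20); rewrite scaler0 -(ker _ _ E2) //.
  by rewrite qE F1 l10 scale0r add0r; have [] := Ht x.
have tq'0 : [lie t, q'] = 0.
  by apply: (scalerI l10); rewrite scaler0 -(ker _ _ E1).
have l20 : l2 = 0.
  apply/eqP/negPn/negP => l20.
  have tp'0 : [lie t, p'] = 0 by apply: (scalerI l20); rewrite scaler0 -(ker _ _ E2).
  by case/eqP: p0; rewrite -tp (derived_lie0 pq').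
apply: (line _ _ (dbasis_sym pq')); first exact: tker.
by rewrite qE F2 l20 scale0r addr0; have [] := Ht x.
Qed.

(** The coefficients of a central vector disappear in turn: bracketing with [q] removes that of [t],
    bracketing with [t] those of [q] and [x], and nondegeneracy removes the part in the span of
    [S]. *)
Lemma center622 p q t x S : dbasis p q -> central p ->
  basis_of fullv [:: q, p, t, x & S] -> [lie t, q] = p -> [lie t, x] = q ->
  {in x :: S, forall b, [lie q, b] = 0} ->
  hyperbolic p S -> {in S, forall s, [lie t, s] = 0 /\ [lie x, s] = 0} ->
  forall y, central y -> y \in derived L.
Proof.
move=> pq cp bF tq tx qB hS tS y cy; have tp := central_r t cp.
have [p0 q0] := dbasis_neq0 pq; have [pD qD] := dbasis_mem pq.
have qx : [lie q, x] = 0 by rewrite qB ?inE ?eqxx.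
have qS : {in S, forall s, [lie q, s] = 0} by move=> s sS; rewrite qB ?inE ?sS ?orbT.
have : y \in <<[:: q, p, t, x & S]>>%VS by rewrite (span_basis bF) memvf.
move=> /span3P[k [l [m [z [+ Ey]]]]]; rewrite span_cons.
move=> /memv_addP[_ /vlineP[n ->] [s sS Ez]].
rewrite {z}Ez !addrA in Ey; rewrite {y}Ey in cy *.
have sq0 : [lie s, q] = 0 by rewrite lieC (span_lie0 qS sS) oppr0.
have st0 : [lie s, t] = 0.
  by rewrite lieC (span_lie0 (fun z zS => (tS z zS).1) sS) oppr0.
have m0 : m = 0.
  apply: (scale_inj0 p0); have := cy q.
  by rewrite !lieE tq cp (lieC x q) qx sq0 oppr0 !scaler0 !addr0 !add0r.
have [k0 n0] : k = 0 /\ n = 0.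
  apply: (free2P _ _ (basis_free pq)); have := cy t.
  rewrite !lieE cp st0 (lieC q) (lieC x) tq tx => E; apply: oppr_inj.
  by rewrite oppr0 -E; vring.
have s0 : s = 0.
  apply: (hyperbolic_nondeg p0 hS sS) => z zS; have := cy z.
  by rewrite k0 m0 n0 !scale0r !addr0 add0r lieDl lie_scale_l cp scaler0 add0r.
by rewrite k0 m0 n0 s0 !scale0r !addr0 add0r memvZ.
Qed.

Lemma center52 p q t S : dbasis p q -> central p ->
  basis_of fullv [:: q, p, t & S] -> [lie t, q] = p ->
  {in S, forall b, [lie q, b] = 0} -> hyperbolic p S ->
  forall y, central y -> y \in derived L.
Proof.
move=> pq cp bF tq qS hS y cy; have tp := central_r t cp.
have [p0 q0] := dbasis_neq0 pq; have [pD qD] := dbasis_mem pq.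
have : y \in <<[:: q, p, t & S]>>%VS by rewrite (span_basis bF) memvf.
move=> /span3P[k [l [m [s [sS Ey]]]]]; rewrite {y}Ey in cy *.
have sq0 : [lie s, q] = 0 by rewrite lieC (span_lie0 qS sS) oppr0.
have m0 : m = 0.
  apply: (scale_inj0 p0); have := cy q.
  by rewrite !lieE tq cp sq0 !scaler0 !addr0 !add0r.
have s0 : s = 0.
  apply: (hyperbolic_nondeg p0 hS sS) => z zS; have := cy z.
  by rewrite m0 scale0r addr0 !lieDl !lie_scale_l cp qS // !scaler0 !add0r.
by rewrite m0 s0 scale0r !addr0 memvD ?memvZ.
Qed.

End Indecomposable.


(** * Listed bases *)

Section ListedFrames.
Context {K : fieldType} {L : lieAlgType K}.
Implicit Types (x y z p q s t v w : L) (S Z B T : seq L).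

Lemma comb_col0 p q (a b c d : K) :
  comb p q (col 0 (mx2 a b c d)) = a *: p + c *: q.
Proof. by rewrite /comb !mxE. Qed.

Lemma comb_col1 p q (a b c d : K) :
  comb p q (col 1 (mx2 a b c d)) = b *: p + d *: q.
Proof. by rewrite /comb !mxE. Qed.

Lemma comb_e1 p q : comb p q (e1 K) = p.
Proof. by rewrite /comb !mxE /= scale1r scale0r addr0. Qed.

Lemma comb_e2 p q : comb p q (e2 K) = q.
Proof. by rewrite /comb !mxE /= scale1r scale0r add0r. Qed.

Lemma comb_scalar0 p q (a : K) : comb p q (col 0 a%:M) = a *: p.
Proof. by rewrite /comb !mxE /= scale0r addr0. Qed.

Lemma comb_scalar1 p q (a : K) : comb p q (col 1 a%:M) = a *: q.
Proof. by rewrite /comb !mxE /= scale0r add0r. Qed.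

Lemma comb_col_zero p q i : comb p q (col i (0 : 'M[K]_2)) = 0.
Proof. by rewrite /comb !mxE !scale0r addr0. Qed.

Lemma g2frame_ops3 p q t (A : 'M[K]_2) (C : A *m 0 = 0 *m A) :
  [lie p, q] = 0 -> [lie t, p] = comb p q (col 0 A) ->
  [lie t, q] = comb p q (col 1 A) -> g2frame [:: p; q; t] (g2ops C).
Proof.
move=> pq tp tq; split=> //.
  by move=> [|[|[|i]]].
by move=> [|[|[|i]]] // [|[|[|j]]] //= _ _; rewrite liexx linear0.
Qed.

Lemma g2frame_ops4 p q s t (A B : 'M[K]_2) (C : A *m B = B *m A) :
  [lie p, q] = 0 -> [lie s, p] = comb p q (col 0 A) ->
  [lie s, q] = comb p q (col 1 A) -> [lie t, p] = comb p q (col 0 B) ->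
  [lie t, q] = comb p q (col 1 B) -> [lie s, t] = 0 ->
  g2frame [:: p; q; s; t] (g2ops C).
Proof.
move=> pq sp sq tp tq st; split=> //.
  by move=> [|[|[|[|i]]]].
move=> [|[|[|[|i]]]] // [|[|[|[|j]]]] //= _ _; rewrite ?liexx ?linear0 //.
by rewrite lieC st oppr0.
Qed.

(** [T] starts at [X_4], hence the shift by four from positions in [T] to indices. *)
Lemma g2frame_brs p q t T (A : 'M[K]_2) (v : 'cV[K]_2) (s : seq (nat * nat)) (hA : s
  = [::] \/ A *m e2 K = 0) :
  [lie p, q] = 0 -> [lie t, p] = comb p q (col 0 A) ->
  [lie t, q] = comb p q (col 1 A) ->
  {in T, forall b, [lie p, b] = 0 /\ [lie q, b] = 0} ->
  (forall j, (j < size T)%N -> [lie t, T`_j] = comb p q (bralt v s 3 j.+4)) ->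
  (forall i j, (i < size T)%N -> (j < size T)%N ->
     [lie T`_i, T`_j] = comb p q (bralt v s i.+4 j.+4)) ->
  g2frame [:: p, q, t & T] (g2brs v hA).
Proof.
move=> pq tp tq pqT tT TT; split=> //.
  move=> [|[|[|i]]] // iT; have -> : g2op (g2brs v hA) i.+4 = 0.
    by rewrite /= /ops34 /= if_same.
  rewrite !comb_col_zero /= (lieC _ p) (lieC _ q).
  by have [-> ->] := pqT _ (mem_nth 0 (iT : (i < size T)%N)); rewrite oppr0.
move=> [|[|[|i]]] // [|[|[|j]]] //= iT jT.
- by rewrite liexx braltxx linear0.
- exact: tT.
- by rewrite lieC braltC linearN tT.
- exact: TT.
Qed.

(** In a symplectic list the pairs occupy the positions [2 * l] and [2 * l + 1], counted from 0. *)
Definition hpair (i j : nat) : bool := ~~ odd i && (j == i.+1).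

Lemma hyperbolic_bracket c S : hyperbolic c S -> forall i j,
  (i < size S)%N -> (j < size S)%N ->
  [lie S`_i, S`_j] = (hpair i j)%:R *: c - (hpair j i)%:R *: c.
Proof.
move: S; apply: hyper_ind => // a b S ab abS hS IH.
have H i : (i < size S)%N -> [lie a, S`_i] = 0 /\ [lie b, S`_i] = 0.
  by move=> iS; apply: abS; rewrite mem_nth.
case=> [|[|i]] [|[|j]] //= iS jS;
  rewrite /hpair /= ?negbK ?eqSS ?andbF ?scale0r ?scale1r ?subrr ?sub0r ?subr0 //.
- exact: liexx.
- by have [] := H j jS.
- by rewrite lieC ab.
- exact: liexx.
- by have [] := H j jS.
- by rewrite lieC; have [->] := H i iS; rewrite oppr0.
- by rewrite lieC; have [_ ->] := H i iS; rewrite oppr0.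
- by rewrite IH // /hpair !eqSS.
Qed.

(** Convertible to the index list of [d52] for [b = 4], and to that of [d621] and [d622] for
    [b = 5]. *)
Definition pairs (b k : nat) : seq (nat * nat) :=
  [seq (b + 2 * l, b.+1 + 2 * l)%N | l <- iota 0 k.+1].
Arguments pairs : simpl never.

Lemma mem_pairs b k i j : (i < 2 * k.+1)%N ->
  ((b + i, b + j)%N \in pairs b k) =
  hpair i j.
Proof.
move=> ik; apply/mapP/andP => [[l]|[oi /eqP->]].
  by rewrite mem_iota => lk [E1 E2]; split; lia.
exists i./2; first by rewrite mem_iota; lia.
congr pair; lia.
Qed.

Lemma mem_pairs_lt b k i j : (i < b)%N ->
  ((i, j) \in pairs b k) = false.
Proof. by move=> ib; apply/mapP => -[l _ [E _]]; lia. Qed.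

Lemma mem_pairs_ltr b k i j : (j <= b)%N ->
  ((i, j) \in pairs b k) = false.
Proof. by move=> ib; apply/mapP => -[l _ [_ E]]; lia. Qed.

Lemma comb_e2b p q (b : bool) : comb p q (if b then e2 K else 0) = b%:R *: q.
Proof. by case: b; rewrite ?comb_e2 ?linear0 ?scale1r ?scale0r. Qed.

Lemma brlistE (v : 'cV[K]_2) (s : seq (nat * nat)) i j : (i, j) != (3, 4)%N ->
  brlist v s i j = if (i, j) \in s then e2 K else 0.
Proof. by rewrite /brlist => /negPf->. Qed.

Lemma hyperbolic_even c S : hyperbolic c S -> size S = (2 * (size S)./2)%N.
Proof. by move: S; apply: hyper_ind => //= a b S _ _ _; lia. Qed.

Section Families.
Context (p q t : L).
Hypothesis pq : [lie p, q] = 0.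

(** The extra vector [x] is [X_4] and commutes with [S], which starts at [X_5]. *)
Lemma g2frame_hyper_ext x S (A : 'M[K]_2) (v : 'cV[K]_2) k (hA : _ \/ A *m e2 K = 0) :
  [lie t, p] = comb p q (col 0 A) -> [lie t, q] = comb p q (col 1 A) ->
  {in x :: S, forall b, [lie p, b] = 0 /\ [lie q, b] = 0} ->
  [lie t, x] = comb p q v ->
  {in S, forall b, [lie t, b] = 0 /\ [lie x, b] = 0} ->
  hyperbolic q S -> size S = (2 * k.+1)%N ->
  g2frame ([:: p; q; t; x] ++ S)
    (g2brs (s := pairs 5 k) v hA).
Proof.
move=> tp tq pqS tx txS hS sS; apply: (g2frame_brs hA) => //.
  move=> [_|j] /=.
    by rewrite /bralt /brlist /= !mem_pairs_lt // subr0.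
  rewrite ltnS => jS; have [-> _] := txS _ (mem_nth 0 jS).
  rewrite /bralt !brlistE ?xpair_eqE //=.
  by rewrite mem_pairs_lt // mem_pairs_ltr // subr0 linear0.
move=> [|i] [|j]; rewrite [size _]/= ?ltnS => iS jS.
- by rewrite liexx braltxx linear0.
- have [_ ->] := txS _ (mem_nth 0 jS).
  rewrite /bralt !brlistE ?xpair_eqE //=.
  by rewrite mem_pairs_lt // mem_pairs_ltr // subr0 linear0.
- rewrite lieC; have [_ ->] := txS _ (mem_nth 0 iS).
  rewrite /bralt !brlistE ?xpair_eqE //=.
  by rewrite mem_pairs_ltr // mem_pairs_lt // subr0 linear0 ?linear0.
- rewrite [LHS](hyperbolic_bracket hS) // /bralt !brlistE ?xpair_eqE //.
  rewrite linearB /= !comb_e2b.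
  by rewrite -[i.+1.+4]/(5 + i)%N -[j.+1.+4]/(5 + j)%N !mem_pairs // -sS.
Qed.

(** Here [S] starts at [X_4]: its first vector enters both the bracket with [t] and the first
    hyperbolic pair, as in [d52]. *)
Lemma g2frame_hyper S (A : 'M[K]_2) (v : 'cV[K]_2) k (hA : _ \/ A *m e2 K = 0) :
  [lie t, p] = comb p q (col 0 A) -> [lie t, q] = comb p q (col 1 A) ->
  {in S, forall b, [lie p, b] = 0 /\ [lie q, b] = 0} ->
  [lie t, S`_0] = comb p q v ->
  {in behead S, forall b, [lie t, b] = 0} ->
  hyperbolic q S -> size S = (2 * k.+1)%N ->
  g2frame ([:: p; q; t] ++ S)
    (g2brs (s := pairs 4 k) v hA).
Proof.
move=> tp tq pqS tx tS hS sS; apply: (g2frame_brs hA) => //.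
  move=> [_|j].
    by rewrite tx /bralt /brlist /= mem_pairs_ltr // subr0.
  case: S pqS tx tS hS sS => [|x S] // _ _ tS _ _ jS.
  rewrite /= tS; last by rewrite mem_nth.
  rewrite /bralt !brlistE ?xpair_eqE //=.
  by rewrite mem_pairs_lt // mem_pairs_ltr // subr0 linear0.
move=> i j iS jS.
rewrite [LHS](hyperbolic_bracket hS) // /bralt !brlistE ?xpair_eqE //.
rewrite linearB /= !comb_e2b.
by rewrite -[i.+4]/(4 + i)%N -[j.+4]/(4 + j)%N !mem_pairs // -sS.
Qed.

Lemma g2frame_brs4 x (A : 'M[K]_2) (v : 'cV[K]_2) (hA : [::] = [::] \/ A *m e2 K = 0) :
  [lie t, p] = comb p q (col 0 A) -> [lie t, q] = comb p q (col 1 A) ->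
  [lie p, x] = 0 -> [lie q, x] = 0 -> [lie t, x] = comb p q v ->
  g2frame [:: p; q; t; x] (g2brs v hA).
Proof.
move=> tp tq px qx tx; apply: (g2frame_brs hA) => //.
- by move=> b; rewrite inE => /eqP->.
- by move=> [|j] //= _; rewrite tx /bralt /brlist /= subr0.
- by move=> [|i] [|j] //= _ _; rewrite liexx braltxx linear0.
Qed.
End Families.

End ListedFrames.


(** * Classification *)

Section Cyclic.
Context {K : fieldType} {L : lieAlgType K}.
Hypothesis d2 : \dim (derived L) = 2%N.
Implicit Types (x y z p q s t v w : L) (S Z B : seq L).

(** [ad y] and [ad s] commute on the derived ideal, because [[y, s]] lies in that abelian ideal; an
    operator commuting with a cyclic one is a polynomial in it, fixed by its value at [v]. *)
Lemma cyclic_action s v : v \in derived L -> free [:: v; [lie s, v]] ->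
  forall y, exists k l, {in derived L, forall g, [lie y, g] = k *: g + l *: [lie s, g]}.
Proof.
move=> vD fr y; have vw := dbasisP d2 vD (mem_derived s v) fr.
have [k [l E]] := dbasis_span vw (mem_derived y v); exists k, l.
move=> g /(dbasis_span vw)[a [b ->]].
have sy : [lie [lie y, s], v] = 0 by apply: derived2_abelian => //; exact: mem_derived.
have Ew : [lie y, [lie s, v]] = k *: [lie s, v] + l *: [lie s, [lie s, v]].
  by rewrite lie_leibniz sy add0r E !lieE.
rewrite !lieE E Ew; move: [lie s, [lie s, v]] [lie s, v] => w2 w; vring.
Qed.

Lemma basis_sub B B' : basis_of fullv B -> {subset B <= <<B'>>%VS} ->
  (size B' <= size B)%N -> basis_of fullv B'.
Proof.
move=> bB sBB' sz; rewrite basisEdim; apply/andP; split.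
  by rewrite -(span_basis bB); apply/span_subvP.
by rewrite -(span_basis bB) (eqnP (basis_free bB)).
Qed.

Lemma not_nilpotent2 : ~ nilpotent2 L ->
  exists x g, g \in derived L /\ [lie x, g] != 0.
Proof.
move=> nn; have [//|H] := pselect (exists x g, g \in derived L /\ [lie x, g] != 0).
case: nn; split; first by move=> E; move: d2; rewrite E dimv0.
apply/eqP; rewrite -subv0; apply/lie_prod_subP => x g _ gD; rewrite memv0.
by apply/negPn/negP => xg; apply: H; exists x, g.
Qed.

End Cyclic.

(** * Normal forms over the real numbers *)

Section RealForms.
Context {R : realType}.

(** The family [d423] occurs only at 0: two distinct real eigenvalues in the presence of the
    identity lead to [aff_aff_form] instead. *)
Variant frame_data : nat -> g2data R -> Prop :=
| frame_321 l of l != 0 : frame_data 3 (d321 l)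
| frame_322 : frame_data 3 d322
| frame_323 phi of 0 < phi < pi : frame_data 3 (d323 phi)
| frame_421 : frame_data 4 d421
| frame_422 : frame_data 4 d422
| frame_423 : frame_data 4 (d423 0)
| frame_affC : frame_data 4 daffC
| frame_52 k : frame_data (5 + 2 * k) (d52 k)
| frame_621 k : frame_data (6 + 2 * k) (d621 k)
| frame_622 k : frame_data (6 + 2 * k) (d622 k).

(** These are the roots of [X^2 - a X + b], sorted by the sign of the discriminant: distinct real,
    double, or [x + i y] and [x - i y]. *)
Lemma quadratic_cases (a b : R) :
  [\/ exists r1 r2 : R, [/\ r1 != r2, a = r1 + r2 & b = r1 * r2],
      exists r : R, a = r *+ 2 /\ b = r ^+ 2
    | exists x y : R, [/\ 0 < y, a = x *+ 2 & b = x ^+ 2 + y ^+ 2]].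
Proof.
pose D := a ^+ 2 - 4 * b; have [D0|D0|D0] := ltrgtP D 0.
- apply: Or33; exists (a / 2), (Num.sqrt (- D) / 2); split.
  + by rewrite divr_gt0 ?sqrtr_gt0 //; lra.
  + lra.
  + rewrite !exprMn sqr_sqrtr; last by lra.
    by rewrite /D; field.
- apply: Or31; exists ((a + Num.sqrt D) / 2), ((a - Num.sqrt D) / 2).
  have sD : 0 < Num.sqrt D by rewrite sqrtr_gt0.
  have sE : Num.sqrt D ^+ 2 = D by rewrite sqr_sqrtr // ltW.
  split; [apply/eqP; lra|lra|].
  have -> : (a + Num.sqrt D) / 2 * ((a - Num.sqrt D) / 2) = (a ^+ 2 - Num.sqrt D ^+
    2) / 4 by field.
  by rewrite sE /D; field.
- apply: Or32; exists (a / 2); split; first lra.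
  by rewrite /D in D0; rewrite exprMn; lra.
Qed.

Section OneAlgebra.
Context {L : lieAlgType R}.
Implicit Types (x y z p q s t v w : L) (S Z B X : seq L).

(** Indecomposability for empty [Z] is recorded here because a decomposable algebra must be shown to
    have at least one extra central direction. *)
Definition listed_form := exists m d X Z, [/\ frame_data m d, Z = [::] ->
  ~ decomposable L
  & [/\ size X = m, basis_of fullv (X ++ Z), {in Z, forall z, central z},
     dbasis X`_0 X`_1 & g2frame X d]].

Definition aff_aff_form := exists x y x' y' Z,
  [/\ basis_of fullv ([:: x; y] ++ [:: x'; y'] ++ Z), {in Z, forall z, central z},
     [lie x, y] = y, [lie x', y'] = y' &
     [/\ [lie x, x'] = 0, [lie x, y'] = 0, [lie y, x'] = 0 & [lie y, y'] = 0]].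

Definition aff_heis_form := exists t p q S Z,
  [/\ hframe p q t Z S, central q, [lie t, p] = p /\ S != [::], hyperbolic q S
    & {in S, forall s, [lie t, s] = 0}].

Hypothesis d2 : \dim (derived L) = 2%N.

(** In the basis [v], [w = [s, v]] the operator is a companion matrix with characteristic polynomial
    [X^2 - a X - b]. By Cayley-Hamilton, [w - r2 *: v] is an eigenvector for [r1], and
    symmetrically. A double root leaves a Jordan block, since a cyclic operator is not scalar. For
    complex roots, [q] is solved from [[s, p] = x *: p + y *: q] with [p = v]. *)
Lemma real_normal_form s v : v \in derived L -> free [:: v; [lie s, v]] ->
  exists p q, dbasis p q /\
  [\/ exists r1 r2 : R, [/\ r1 != r2, [lie s, p] = r1 *: p & [lie s, q] = r2 *: q],
      exists r : R, [lie s, p] = r *: p /\ [lie s, q] = p + r *: q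
    | exists x y : R, [/\ 0 < y, [lie s, p] = x *: p + y *: q
       & [lie s, q] = - y *: p + x *: q]].
Proof.
move=> vD fr; have wD := mem_derived s v; have vw := dbasisP d2 vD wD fr.
have [b [a E]] := dbasis_span vw (mem_derived s [lie s, v]).
move: E wD fr vw; set w := [lie s, v] => E wD fr vw.
have sv : [lie s, v] = w by [].
clearbody w; have fP := free2P _ _ fr.
have [[r1 [r2 [r12 Ea Eb]]]|[r [Ea Eb]]|[x [y [y0 Ea Eb]]]] := quadratic_cases a (- b).
- exists (w - r2 *: v), (w - r1 *: v); split.
    apply: dbasisP => //; try by rewrite memvB ?memvZ.
    apply/free2P => c d E0; have [E1 E2] : - (c * r2 + d * r1) = 0 /\ c + d = 0.
      by apply: fP; rewrite -E0; vring.
    have : c * (r1 - r2) = 0 by rewrite (_ : d = - c) in E1; lra.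
    move/eqP; rewrite mulf_eq0 subr_eq0 (negPf r12) orbF => /eqP c0.
    by split=> //; lra.
  apply: Or31; exists r1, r2; rewrite !lieE sv E (_ : b = - (r1 * r2)); last by lra.
  by rewrite Ea; split=> //; vring.
- exists (w - r *: v), v; split.
    apply: dbasisP => //; first by rewrite memvB ?memvZ.
    apply/free2P => c d E0; have [E1 E2] : d - c * r = 0 /\ c = 0.
      by apply: fP; rewrite -E0; vring.
    by split=> //; rewrite E2 in E1; lra.
  apply: Or32; exists r; rewrite !lieE sv E (_ : b = - (r ^+ 2)); last by lra.
  by rewrite Ea; split; vring.
- have yn : y != 0 by rewrite gt_eqF.
  exists v, (y^-1 *: (w - x *: v)); split.
    apply: dbasisP => //; first by rewrite memvZ // memvB ?memvZ.
    apply/free2P => c d E0; have [E1 E2] : c - d * y^-1 * x = 0 /\ d * y^-1 = 0.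
      by apply: fP; rewrite -E0; vring.
    move: E2 E1 => /eqP; rewrite mulf_eq0 invr_eq0 (negPf yn) orbF => /eqP ->.
    by rewrite !mul0r subr0.
  apply: Or33; exists x, y; rewrite !lieE sv E (_ : b = - (x ^+ 2 + y ^+ 2));
    last by lra.
  by rewrite Ea; split=> //; vfield.
Qed.

Lemma listed_form3 p q t A (C : A *m 0 = 0 *m A) : dbasis p q ->
  frame_data 3 (g2ops C) ->
  {in derived L, forall g, [lie t, g] = 0 -> g = 0} ->
  [lie t, p] = comb p q (col 0 A) -> [lie t, q] = comb p q (col 1 A) ->
  (forall y, exists k, {in derived L, forall g, [lie y, g] = k *: [lie t, g]}) ->
  listed_form.
Proof.
move=> pq fd tI tp tq H; have [pD qD] := dbasis_mem pq.
have [|Z [bZ cZ]] := frame3 d2 pq tI.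
  by move=> y; have [k E] := H y; exists k; rewrite !E.
exists 3%N, (g2ops C), [:: p; q; t], Z; split=> //.
  by move=> Z0; rewrite Z0 in bZ; exact: (indecomposable3 d2 pq bZ tI H).
by split=> //; apply: g2frame_ops3 => //; exact: dbasis_lie0.
Qed.

(** The last hypothesis says that [ad s] is not diagonalizable over the reals; as the center lies in
    the derived ideal when [Z] is empty, this excludes a decomposition. *)
Lemma listed_form4 p q t s A (C : A *m 1%:M = 1%:M *m A) : dbasis p q ->
  frame_data 4 (g2ops C) ->
  {in derived L, forall g, [lie t, g] = g} ->
  [lie s, p] = comb p q (col 0 A) -> [lie s, q] = comb p q (col 1 A) ->
  (exists2 v, v \in derived L & free [:: v; [lie s, v]]) ->
  (forall y, exists k l, {in derived L, forall g, [lie y,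
    g] = k *: g + l *: [lie s, g]}) ->
  (forall p' q' a b, dbasis p' q' -> [lie s, p'] = a *: p' ->
     [lie s, q'] = b *: q' -> False) ->
  listed_form.
Proof.
move=> pq fd tE sp sq frv H nd; have [pD qD] := dbasis_mem pq.
have [|s' [Z [bZ cZ s't s'p s'q]]] := frame4 d2 pq (tE p pD) (tE q qD) frv.
  by move=> y; have [k [l E]] := H y; exists k, l; rewrite !E.
have s'E g : g \in derived L -> [lie s', g] = [lie s, g].
  by move=> /(dbasis_span pq)[a [b ->]]; rewrite !lieDr !lie_scale_r s'p s'q.
exists 4%N, (g2ops C), [:: p; q; s'; t], Z; split=> //.
  move=> Z0; rewrite Z0 cats0 in bZ => dL.
  have [|p' [q' [pq' H']]] := decomposable_eigen d2 _ dL.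
    apply: (center4 d2 pq bZ tE); have [v vD frv'] := frv.
    by exists v; rewrite // s'E.
  have [a [b [E1 E2]]] := H' s'; have [p'D q'D] := dbasis_mem pq'.
  by apply: (nd p' q' a b pq'); rewrite -s'E.
split=> //; apply: g2frame_ops4;
  rewrite ?comb_scalar0 ?comb_scalar1 ?scale1r ?tE ?s'p ?s'q //.
exact: dbasis_lie0.
Qed.

(** Positivity of [y] makes [|x / rho|] strictly less than 1, so the angle [acos (x / rho)] is
    interior to the half turn and has sine [y / rho]. *)
Lemma polar (x y : R) : 0 < y -> exists rho phi,
  [/\ 0 < rho, 0 < phi < pi, x = rho * cos phi & y = rho * sin phi].
Proof.
move=> y0; pose rho := Num.sqrt (x ^+ 2 + y ^+ 2).
have y2 : 0 < y ^+ 2 by rewrite exprn_gt0.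
have r2 : rho ^+ 2 = x ^+ 2 + y ^+ 2 by rewrite sqr_sqrtr // addr_ge0 ?sqr_ge0.
have r0 : 0 < rho by rewrite sqrtr_gt0 ltr_wpDl ?sqr_ge0.
have rn : rho != 0 by rewrite gt_eqF.
have xr : `|x / rho| < 1.
  rewrite normrM normfV (gtr0_norm r0) ltr_pdivrMr // mul1r.
  by rewrite -(gtr0_norm r0) -sqrtr_sqr -[X in _ < X]sqrtr_sqr ltr_sqrt ?r2 ?ltrDl
    // -r2 exprn_gt0.
have /andP[x1 x2] : -1 < x / rho < 1 by rewrite -ltr_norml.
exists rho, (acos (x / rho)); split=> //.
- by rewrite acos_gt0 ?acos_ltpi ?x1 ?(ltW x1) ?(ltW x2).
- by rewrite acosK ?in_itv /= ?(ltW x1) ?(ltW x2) //; field.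
rewrite sin_acos ?(ltW x1) ?(ltW x2) //.
have -> : 1 - (x / rho) ^+ 2 = (y / rho) ^+ 2.
  by rewrite !exprMn !exprVn r2; field; rewrite -r2 expf_neq0.
by rewrite sqrtr_sqr ger0_norm ?divr_ge0 ?ltW //; field.
Qed.

(** An empty [S] gives [d421], in dimension 4; [k + 1] hyperbolic pairs give [d621 k]. *)
Lemma listed_form_621 p q t x S Z : dbasis p q -> central q ->
  hframe p q t Z (x :: S) -> [lie t, p] = p -> [lie t, x] = q ->
  hyperbolic q S -> {in S, forall s, [lie t, s] = 0 /\ [lie x, s] = 0} ->
  listed_form.
Proof.
move=> pq cq [bF cZ pB] tp tx hS tS.
have qp0 := dbasis_lie0 d2 pq; have tq := central_r t cq.
have ops : [lie t, p] = comb p q (col 0 (mx2 1 0 0 0)) /\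
    [lie t, q] = comb p q (col 1 (mx2 1 0 0 0)).
  by rewrite comb_col0 comb_col1 tp tq; split; vring.
have sS := hyperbolic_even hS.
case Em: (size S)./2 => [|k].
  have S0 : S = [::] by apply/nilP; rewrite /nilp sS Em.
  rewrite S0 in bF pB; exists 4%N, d421, [:: p; q; t; x], Z; split;
    first by constructor.
    by move=> Z0; rewrite Z0 in bF; apply: (indecomposable621 d2 pq cq bF tp tx pB).
  split=> //; apply: g2frame_brs4; rewrite ?comb_e2 //; try by case: ops.
  by rewrite pB ?inE ?eqxx.
exists (6 + 2 * k)%N, (d621 k), ([:: p; q; t; x] ++ S), Z; split; first by constructor.
  move=> Z0; rewrite Z0 cats0 in bF.
  exact: (indecomposable621 d2 pq cq bF tp tx pB hS tS).
have sS' : size S = (2 * k.+1)%N by rewrite sS Em.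
split=> //; first by rewrite size_cat sS' /=; lia.
apply: g2frame_hyper_ext; rewrite ?comb_e2 //; try by case: ops.
by move=> b bB; rewrite pB.
Qed.

(** As for [d621], an empty [S] gives the four-dimensional algebra. The plane is listed as [p, q] in
    [d422] but as [q, p] in [d622], so the former requires a reordering of the basis. *)
Lemma listed_form_622 p q t x S Z : dbasis p q -> central p ->
  hframe q p t Z (x :: S) -> [lie t, q] = p -> [lie t, x] = q ->
  hyperbolic p S -> {in S, forall s, [lie t, s] = 0 /\ [lie x, s] = 0} ->
  listed_form.
Proof.
move=> pq cp [bF cZ pB] tq tx hS tS.
have qp := dbasis_sym pq.
have pq0 := dbasis_lie0 d2 pq; have qp0 := dbasis_lie0 d2 qp; have tp := central_r t cp.
have sS := hyperbolic_even hS.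
case Em: (size S)./2 => [|k].
  have S0 : S = [::] by apply/nilP; rewrite /nilp sS Em.
  rewrite S0 in bF pB; exists 4%N, d422, [:: p; q; t; x], Z; split;
    first by constructor.
    move=> Z0; rewrite Z0 in bF; apply: (nilpotent_indecomposable d2 _ pq tq tp).
    exact: (center622 pq cp bF tq tx pB).
  split=> //.
    apply: (basis_sub bF) => // y yB; apply: memv_span; move: yB; rewrite !inE.
    by case/or4P => [->|->|->|]; rewrite ?orbT // => /orP[->|->]; rewrite ?orbT.
  apply: g2frame_brs4; rewrite ?comb_e2 ?comb_col0 ?comb_col1 ?tp ?tq //; try by vring.
  by rewrite pB ?inE ?eqxx.
exists (6 + 2 * k)%N, (d622 k), ([:: q; p; t; x] ++ S), Z; split; first by constructor.
  move=> Z0; rewrite Z0 cats0 in bF; apply: (nilpotent_indecomposable d2 _ pq tq tp).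
  exact: (center622 pq cp bF tq tx pB hS tS).
have sS' : size S = (2 * k.+1)%N by rewrite sS Em.
split=> //; first by rewrite size_cat sS' /=; lia.
apply: g2frame_hyper_ext; rewrite ?comb_e1 ?comb_col0 ?comb_col1 ?tp ?tq //;
  try by vring.
by move=> b bB; rewrite pB.
Qed.

Lemma listed_form_52 p q t a b S Z : dbasis p q -> central p ->
  hframe q p t Z [:: a, b & S] -> [lie t, q] = p -> [lie t, a] = q ->
  hyperbolic p [:: a, b & S] -> {in b :: S, forall s, [lie t, s] = 0} ->
  listed_form.
Proof.
move=> pq cp [bF cZ pB] tq tx hS tS.
have qp := dbasis_sym pq.
have qp0 := dbasis_lie0 d2 qp; have tp := central_r t cp.
have sS := hyperbolic_even hS.
pose k := (size S)./2.
have sS' : size [:: a, b & S] = (2 * k.+1)%N by rewrite sS /k /=; lia.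
exists (5 + 2 * k)%N, (d52 k), ([:: q; p; t] ++ [:: a, b & S]), Z; split;
  first by constructor.
  move=> Z0; rewrite Z0 cats0 in bF; apply: (nilpotent_indecomposable d2 _ pq tq tp).
  exact: (center52 pq cp bF tq pB hS).
split=> //; first by rewrite size_cat sS' /=; lia.
apply: g2frame_hyper; rewrite ?comb_e1 ?comb_col0 ?comb_col1 ?tp ?tq //; try by vring.
by move=> x xB; rewrite pB.
Qed.

Lemma dbasis_inj p q t : dbasis p q ->
  (forall a b, a *: [lie t, p] + b *: [lie t, q] = 0 -> a = 0 /\ b = 0) ->
  {in derived L, forall g, [lie t, g] = 0 -> g = 0}.
Proof.
move=> pq H g /(dbasis_span pq)[a [b ->]]; rewrite !lieE => /H[-> ->].
by rewrite !scale0r addr0.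
Qed.

Lemma classify_rank1 s v : v \in derived L -> free [:: v; [lie s, v]] ->
  (forall y, exists l, {in derived L, forall g, [lie y, g] = l *: [lie s, g]}) ->
  listed_form \/ aff_heis_form.
Proof.
move=> vD fr H.
have Ht t c : c != 0 -> t = c *: s ->
    forall y, exists k, {in derived L, forall g, [lie y, g] = k *: [lie t, g]}.
  move=> c0 -> y; have [l E] := H y; exists (l / c) => g gD.
  by rewrite E // lieE scalerA mulfVK.
(* The kernel line of a singular diagonalizable operator is central, because all operators are
   multiples of [ad s]; which vector spans it depends on the root that vanishes. *)
have diag p q r : dbasis p q -> r != 0 -> [lie s, p] = r *: p -> [lie s, q] = 0 ->
    listed_form \/ aff_heis_form.
  move=> pq r0 sp sq; have [pD qD] := dbasis_mem pq.
  have tp : [lie r^-1 *: s, p] = p by rewrite lieE sp scalerA mulVf // scale1r.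
  have cq : central q.
    by move=> y; have [l E] := H y; rewrite lieC E // sq scaler0 oppr0.
  have [|[t [S [Z [hF tp' S0 hS tS]]]]|[t [x [S [Z [hF tp' tx hS tS]]]]]] :=
    diag_case d2 pq tp cq.
  - by move=> y; have [l E] := H y; exists (l * r); rewrite E // sp scalerA.
  - by right; exists t, p, q, S, Z.
  - by left; exact: (listed_form_621 pq cq hF).
have [p [q [pq [[r1 [r2 [r12 sp sq]]]|[r [sp sq]]|[x [y [y0 sp sq]]]]]]] :=
  real_normal_form vD fr.
- have [r10|r10] := eqVneq r1 0.
    apply: (diag q p r2 (dbasis_sym pq)) => //; first by rewrite -r10 eq_sym.
    by rewrite sp r10 scale0r.
  have [r20|r20] := eqVneq r2 0.
    by apply: (diag p q r1 pq) => //; rewrite sq r20 scale0r.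
  left; have fP := free2P _ _ (basis_free pq).
  (* Dividing [s] by [r1] makes the first eigenvalue 1 and the second one the parameter. *)
  have l0 : r2 / r1 != 0 by rewrite mulf_neq0 ?invr_eq0.
  apply: (listed_form3 pq (frame_321 l0) (t := r1^-1 *: s)).
  + apply: (dbasis_inj pq) => a b; rewrite !lieE sp sq !scalerA => /fP[].
    rewrite mulfVK // => -> /eqP; rewrite !mulf_eq0 invr_eq0 (negPf r10) (negPf r20).
    by rewrite !orbF => /eqP.
  + by rewrite comb_col0 !lieE sp scalerA mulVf //; vring.
  + by rewrite comb_col1 !lieE sq scalerA; vring.
  + by apply: Ht => //; rewrite invr_eq0.
- have [r0|r0] := eqVneq r 0.
    rewrite r0 scale0r in sp; rewrite r0 scale0r addr0 in sq.
    have [pD qD] := dbasis_mem pq.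
    have cp : central p.
      by move=> y; have [l E] := H y; rewrite lieC E // sp scaler0 oppr0.
    left; have [|[t [a [b [S [Z [hF tq ta hS tS]]]]]]|[t [x [S [Z [hF tq tx hS
      tS]]]]]] :=
      nilpotent_case d2 pq sq cp.
    + by move=> y; have [l E] := H y; exists l; rewrite E // sq.
    + exact: (listed_form_52 pq cp hF).
    + exact: (listed_form_622 pq cp hF).
  left; have fP := free2P _ _ (basis_free pq); have [pD qD] := dbasis_mem pq.
  (* Dividing [s] by [r] puts 1 on the diagonal but [r^-1] above it; scaling [p] restores 1
     there. *)
  have pq' : dbasis (r^-1 *: p) q.
    apply: dbasisP; rewrite ?memvZ //; apply/free2P => a b; rewrite scalerA => /fP[].
    by move/eqP; rewrite mulf_eq0 invr_eq0 (negPf r0) orbF => /eqP.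
  apply: (listed_form3 pq' frame_322 (t := r^-1 *: s)).
  + apply: (dbasis_inj pq) => a b; rewrite !lieE sp sq => E.
    have [] := fP (a + b * r^-1) b; last by move=> + b0; rewrite b0 mul0r addr0.
    by rewrite -E; vfield.
  + by rewrite comb_col0 !lieE sp; vfield.
  + by rewrite comb_col1 !lieE sq; vfield.
  + by apply: Ht => //; rewrite invr_eq0.
- left; have fP := free2P _ _ (basis_free pq).
  have [rho [phi [rho0 phi0 Ex Ey]]] := polar x y0.
  have rn : rho != 0 by rewrite gt_eqF.
  apply: (listed_form3 pq (frame_323 phi0) (t := rho^-1 *: s)).
  + have xy : x ^+ 2 + y ^+ 2 != 0.
      by rewrite gt_eqF // ltr_wpDl ?sqr_ge0 ?exprn_gt0.
    apply: (dbasis_inj pq) => a b; rewrite !lieE sp sq => E.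
    have [E1 E2] : rho^-1 * (a * x - b * y) = 0 /\ rho^-1 * (a * y + b * x) = 0.
      by apply: fP; rewrite -E; vring.
    move/eqP: E1; rewrite mulf_eq0 invr_eq0 (negPf rn) /= => /eqP E1.
    move/eqP: E2; rewrite mulf_eq0 invr_eq0 (negPf rn) /= => /eqP E2.
    (* Cramer's rule for a system of determinant [x ^+ 2 + y ^+ 2]. *)
    have : a * (x ^+ 2 + y ^+ 2) = 0.
      by rewrite (_ : _ * _ = x * (a * x - b * y) + y * (a * y + b * x));
        [rewrite E1 E2; ring|ring].
    have : b * (x ^+ 2 + y ^+ 2) = 0.
      by rewrite (_ : _ * _ = - y * (a * x - b * y) + x * (a * y + b * x));
        [rewrite E1 E2; ring|ring].
    by move=> /eqP + /eqP; rewrite !mulf_eq0 (negPf xy) !orbF => /eqP-> /eqP->.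
  + by rewrite comb_col0 !lieE sp Ex Ey; vfield.
  + by rewrite comb_col1 !lieE sq Ex Ey; vfield.
  + by apply: Ht => //; rewrite invr_eq0.
Qed.

(** Since [t] acts as the identity, [s] may be replaced by any [c *: s + r *: t] with [c] nonzero:
    it keeps a cyclic vector and, with the identity, still generates all operators. This freedom
    normalizes the spectrum of [s]. *)
Lemma classify_rank2 s t v : v \in derived L -> free [:: v; [lie s, v]] ->
  {in derived L, forall g, [lie t, g] = g} ->
  (forall y, exists k l, {in derived L, forall g, [lie y,
    g] = k *: g + l *: [lie s, g]}) ->
  listed_form \/ aff_aff_form.
Proof.
move=> vD fr tE H.
have Ht s' c r : c != 0 -> s' = c *: s + r *: t ->
    forall y, exists k l, {in derived L, forall g, [lie y,
      g] = k *: g + l *: [lie s', g]}.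
  move=> c0 -> y; have [k [l E]] := H y; exists (k - l / c * r), (l / c) => g gD.
  by rewrite E // !lieE tE //; vfield.
have frH s' c r : c != 0 -> s' = c *: s + r *: t ->
    exists2 v, v \in derived L & free [:: v; [lie s', v]].
  move=> c0 ->; exists v => //; apply/free2P => a b; rewrite !lieE tE // => E.
  have [E1 E2] : a + b * r = 0 /\ b * c = 0 by apply: (free2P _ _ fr); rewrite -E;
    vring.
  move: E2 E1 => /eqP; rewrite mulf_eq0 (negPf c0) orbF => /eqP->.
  by rewrite mul0r addr0.
have [p [q [pq [[r1 [r2 [r12 sp sq]]]|[r [sp sq]]|[x [y [y0 sp sq]]]]]]] :=
  real_normal_form vD fr; have [pD qD] := dbasis_mem pq.
- right; pose c := (r1 - r2)^-1.
  have r0 : r1 - r2 != 0 by rewrite subr_eq0.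
  have c0 : c != 0 by rewrite invr_eq0.
  (* [s1] acts as the projection onto [p] along [q], so [t - s'] acts as the complementary one. *)
  pose s1 := c *: s + (- c * r2) *: t.
  have s1p : [lie s1, p] = p by rewrite /s1 !lieE sp tE // /c; vfield.
  have s1q : [lie s1, q] = 0 by rewrite /s1 !lieE sq tE // /c; vring.
  have [|s' [Z [bZ cZ s't s'p s'q]]] :=
    frame4 d2 pq (tE p pD) (tE q qD) (frH s1 c _ c0 erefl).
    by move=> y; have [k [l E]] := Ht s1 c _ c0 erefl y; exists k, l; rewrite !E.
  exists s', p, (t - s'), q, Z; split=> //.
  + apply: (basis_sub bZ) => // y; rewrite /= !inE.
    have m z : z \in [:: s', p, t - s', q & Z] ->
      z \in <<[:: s', p, t - s', q & Z]>>%VS.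
      exact: memv_span.
    case/or4P => [/eqP->|/eqP->|/eqP->|/orP[/eqP->|yZ]].
    * by apply: m; rewrite !inE eqxx ?orbT.
    * by apply: m; rewrite !inE eqxx ?orbT.
    * by apply: m; rewrite !inE eqxx ?orbT.
    * suff : (t - s') + s' \in <<[:: s', p, t - s', q & Z]>>%VS by rewrite subrK.
      by apply: memvD; apply: m; rewrite !inE eqxx ?orbT.
    * by apply: m; rewrite !inE yZ ?orbT.
  + by rewrite s'p s1p.
  + by rewrite !lieE tE // s'q s1q subr0.
  + split.
    * by rewrite !lieE s't subr0.
    * by rewrite s'q.
    * by rewrite !lieE (lieC p t) (lieC p s') tE // s'p s1p; vring.
    * exact: dbasis_lie0.
(* Removing the eigenvalue leaves a nilpotent operator, so the parameter is 0. The factor 1 matches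
   the form that [frH] and [Ht] expect. *)
- left; apply: (listed_form4 pq frame_423 (s := 1 *: s + (- r) *: t) tE).
  + by rewrite comb_col0 !lieE sp tE //; vring.
  + by rewrite comb_col1 !lieE sq tE //; vring.
  + by apply: (frH _ 1 (- r)); rewrite ?oner_eq0.
  + by apply: (Ht _ 1 (- r)); rewrite ?oner_eq0.
  + have s1p : [lie 1 *: s - r *: t, p] = 0 by rewrite !lieE sp tE //; vring.
    have s1q : [lie 1 *: s - r *: t, q] = p by rewrite !lieE sq tE //; vring.
    rewrite scaleNr; move: (1 *: s - r *: t) s1p s1q => s1 s1p s1q p' q' a b.
    exact: (nilpotent_eigen pq s1q s1p).
- left; have yn : y != 0 by rewrite gt_eqF.
  (* [s] minus its real part [x], divided by [- y], acts as a complex structure on the plane and has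
     no real eigenvalue; the sign matches [daffC]. *)
  have c0 : - y^-1 != 0 by rewrite oppr_eq0 invr_eq0.
  apply: (listed_form4 pq frame_affC (s := (- y^-1) *: s + (x / y) *: t) tE).
  + by rewrite comb_col0 !lieE sp tE //; vfield.
  + by rewrite comb_col1 !lieE sq tE //; vfield.
  + exact: (frH _ _ _ c0 erefl).
  + exact: (Ht _ _ _ c0 erefl).
  + set s1 := _ *: s + _ => p' q' a b pq' Ea _.
    have s1p : [lie s1, p] = - q by rewrite /s1 !lieE sp tE //; vfield.
    have s1q : [lie s1, q] = p by rewrite /s1 !lieE sq tE //; vfield.
    clearbody s1; have [p'0 _] := dbasis_neq0 pq'; have [p'D _] := dbasis_mem pq'.
    have ss g : g \in derived L -> [lie s1, [lie s1, g]] = - g.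
      move=> /(dbasis_span pq)[c [d ->]].
      by rewrite !lieDr !lie_scale_r s1p s1q lieNr s1p s1q; vring.
    have : (a ^+ 2 + 1) *: p' = 0.
      have := ss p' p'D; rewrite Ea lie_scale_r Ea scalerA => E.
      by rewrite scalerDl scale1r expr2 E addNr.
    by move=> /(scale_inj0 p'0)/eqP; rewrite gt_eqF // ltr_wpDl ?sqr_ge0.
Qed.

Lemma classification : ~ nilpotent2 L ->
  [\/ listed_form, aff_aff_form | aff_heis_form].
Proof.
move=> nn; have [sc|[s [v [vD fr]]]] := scalar_or_cyclic d2.
  apply: Or31; have [x [g [gD xg]]] := not_nilpotent2 d2 nn.
  have [c E] := sc x; have c0 : c != 0.
    by apply: contraNneq xg => c0; rewrite E // c0 scale0r.
  have tE : {in derived L, forall g, [lie c^-1 *: x, g] = g}.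
    by move=> h hD; rewrite lieE E // scalerA mulVf // scale1r.
  have [p [q pq]] := dbasis_exists d2; have [pD qD] := dbasis_mem pq.
  (* A scalar action in normal form is the family [d321] at 1. *)
  apply: (listed_form3 pq (frame_321 (oner_neq0 _)) (t := c^-1 *: x)).
  - by move=> h hD; rewrite tE.
  - by rewrite tE // comb_col0; vring.
  - by rewrite tE // comb_col1; vring.
  - by move=> y; have [k Ey] := sc y; exists k => h hD; rewrite tE // Ey.
have H := cyclic_action d2 vD fr.
have [H1|] := pselect (forall y, exists l,
    {in derived L, forall g, [lie y, g] = l *: [lie s, g]}).
  by case: (classify_rank1 vD fr H1) => ?; [apply: Or31 | apply: Or33].
move=> /existsNP[t0 Nt0]; have [k [l E]] := H t0.
have k0 : k != 0.
  by apply/eqP => k0; apply: Nt0; exists l => g gD; rewrite E // k0 scale0r add0r.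
(* An operator that is not a multiple of [ad s] has a nonzero scalar part, which isolates the
   identity. *)
have tE : {in derived L, forall g, [lie k^-1 *: (t0 - l *: s), g] = g}.
  by move=> g gD; rewrite !lieE E //; vfield.
by case: (classify_rank2 vD fr tE H) => ?; [apply: Or31 | apply: Or32].
Qed.

End OneAlgebra.
End RealForms.


(** * From bases to isomorphisms *)

Section JoinIso.
Context {K : fieldType}.
Implicit Types L M N : lieAlgType K.

Lemma span_commute L (A B : seq L) a b : {in A & B, forall x y, [lie x, y] = 0} ->
  a \in <<A>>%VS -> b \in <<B>>%VS -> [lie a, b] = 0.
Proof.
move=> AB aA bB; apply: (span_lie0 _ bB) => y yB; rewrite lieC.
by rewrite (span_lie0 _ aA) ?oppr0 // => x xA; rewrite lieC AB ?oppr0.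
Qed.

Lemma join_emb L M N (A B : seq L) (f : {linear M -> L}) (g : {linear N -> L}) :
  free (A ++ B) -> {in A & B, forall x y, [lie x, y] = 0} ->
  [/\ injective f, lie_morph f & forall x, f x \in <<A>>%VS] ->
  [/\ injective g, lie_morph g & forall x, g x \in <<B>>%VS] ->
  exists h : {linear (M * N)%type -> L},
    [/\ injective h, lie_morph h & forall p, h p \in <<A ++ B>>%VS].
Proof.
rewrite cat_free => /and3P[_ _ /directv_addP AB0] cAB [fI fL fA] [gI gL gB].
have [|h [hI hL _ hAB]] := joint_emb fI fL gI gL _ fA gB AB0.
  by move=> x y; exact: span_commute cAB _ _.
by exists h; split=> // p; rewrite span_cat.
Qed.

Lemma dim_basis L (B : seq L) : basis_of fullv B -> \dim {:L} = size B.
Proof. by move=> bB; rewrite -(eqnP (basis_free bB)) (span_basis bB). Qed.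

Lemma lie_iso_abel_ext L M (A Z : seq L) (f : {linear M -> L}) :
  basis_of fullv (A ++ Z) -> {in Z, forall z, central z} ->
  [/\ injective f, lie_morph f & forall x, f x \in <<A>>%VS] ->
  \dim {:M} = size A -> lie_iso L (M * abel K (size Z))%type.
Proof.
move=> bAZ cZ fP dM; have frZ := catr_free (basis_free bAZ).
have [g gP] : exists g : {linear abel K (size Z) -> L},
    [/\ injective g, lie_morph g & forall x, g x \in <<Z>>%VS].
  by apply: abel_emb => // x y xZ _; rewrite cZ.
have [|h [hI hL _]] := join_emb (basis_free bAZ) _ fP gP.
  by move=> x z _ zZ; exact: central_r (cZ z zZ).
apply: emb_lie_iso hI hL _.
by rewrite dim_lie_prod dM dim_abel (dim_basis bAZ) size_cat.
Qed.

Lemma emb_image L M (U : {vspace L}) (f : {linear M -> L}) : injective f ->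
  (forall x, f x \in U) -> \dim {:M} = \dim U ->
  forall v, v \in U <-> exists x, f x = v.
Proof.
move=> fI fU dMU v; split=> [vU|[x <-]] //.
pose F : 'Hom(M, L) := linfun f.
have FE x : F x = f x by rewrite lfunE.
have FI : lker F == 0%VS by apply/lker0P => x y; rewrite !FE; exact: fI.
have : v \in limg F.
  have -> // : limg F = U; apply/eqP; rewrite eqEdim -dMU.
  rewrite (limg_dim_eq (f := F)) ?leqnn ?andbT; last by rewrite (eqP FI) capv0.
  by apply/subvP => _ /memv_imgP[x _ ->]; rewrite FE.
by move=> /memv_imgP[x _ ->]; exists x; rewrite FE.
Qed.

End JoinIso.

Section FormIso.
Context {R : realType} {L : lieAlgType R}.

Lemma frame_data_ge m (d : g2data R) : frame_data m d -> (2 <= m)%N.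
Proof. by case=> *; lia. Qed.

Lemma frame_lie_iso (X Z : seq L) m (d : g2data R) : (2 <= m)%N -> size X = m ->
  basis_of fullv (X ++ Z) -> {in Z, forall z, central z} -> g2frame X d ->
  lie_iso L (g2alg m d * abel R (size Z))%type.
Proof.
move=> m2 sX bXZ cZ fX.
have [f fP] := g2alg_emb fX (catl_free (basis_free bXZ)) sX m2.
by apply: (lie_iso_abel_ext bXZ cZ fP); rewrite dim_g2alg.
Qed.

Lemma aff_aff_lie_iso : aff_aff_form (L := L) -> exists k,
  \dim {:L} = (4 + k)%N /\ lie_iso L (aff R * aff R * abel R k)%type.
Proof.
move=> [x [y [x' [y' [Z [bF cZ xy xy' [xx' xy'0 yx' yy']]]]]]].
exists (size Z); split; first by rewrite (dim_basis bF).
rewrite catA in bF; have frA := catl_free (basis_free bF).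
have y0 : y != 0 by apply: (free_not0 frA); rewrite !inE eqxx ?orbT.
have y'0 : y' != 0 by apply: (free_not0 frA); rewrite !inE eqxx ?orbT.
have [f fP] := aff_emb xy y0; have [g gP] := aff_emb xy' y'0.
have [|h hP] := join_emb frA _ fP gP.
  by move=> a b; rewrite !inE => /orP[] /eqP-> /orP[] /eqP->.
apply: (lie_iso_abel_ext bF cZ hP).
by rewrite dim_lie_prod dim_aff.
Qed.

Lemma aff_heis_lie_iso : aff_heis_form (L := L) -> exists m k,
  [/\ (1 <= m)%N, \dim {:L} = (2 * m + 3 + k)%N &
    lie_iso L (aff R * heis R m * abel R k)%type].
Proof.
move=> [t [p [q [S [Z [[bF cZ pS] cq [tp S0] hS tS]]]]]].
have sS := hyperbolic_even hS.
exists (size S)./2, (size Z); split.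
- by rewrite lt0n; apply: contraNneq S0 => H; rewrite -size_eq0 sS H.
- by rewrite (dim_basis bF) !size_cat /= sS; lia.
(* The basis is regrouped into a copy of aff(R), a Heisenberg algebra with center spanned by [q],
   and the central rest. *)
have {}bF : basis_of fullv (([:: t; p] ++ q :: S) ++ Z).
  rewrite -catA; apply: (basis_sub bF) => // u uB; apply: memv_span.
  by move: uB; rewrite !inE => /or4P[->|->|->|->]; rewrite ?orbT.
have frA := catl_free (basis_free bF).
have p0 : p != 0 by apply: (free_not0 frA); rewrite !inE eqxx ?orbT.
have q0 : q != 0 by apply: (free_not0 frA); rewrite !inE eqxx ?orbT.
have [f fP] := aff_emb tp p0.
have [g gP] := heis_emb hS sS q0 (fun s _ => cq s).
have [|h hP] := join_emb frA _ fP gP.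
  move=> a b; rewrite !inE => /orP[] /eqP-> /predU1P[->|bS];
    [exact: central_r | exact: tS | exact: central_r | exact: pS].
apply: (lie_iso_abel_ext bF cZ hP).
by rewrite dim_lie_prod dim_aff dim_heis size_cat /=; lia.
Qed.

End FormIso.

(** * Adapted bases and the data that determine the structure *)

Section Adapted.
Context {K : fieldType}.
Implicit Types L M : lieAlgType K.

Lemma adaptedP L (X : seq L) : basis_of fullv X -> dbasis X`_0 X`_1 ->
  [lie X`_0, X`_1] = 0 -> adapted X.
Proof. by move=> bX /span_basis D X01; split. Qed.

Lemma g1coordK L (X : seq L) v : adapted X -> v \in derived L ->
  comb X`_0 X`_1 (g1coord X v) = v.
Proof.
move=> [_ D _]; rewrite D => vD; rewrite [RHS](coord_span (X := [tuple _; _]) vD).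
by rewrite sum_ord2 /comb !mxE.
Qed.

Lemma a_mxE L (X : seq L) x : adapted X ->
  [lie x, X`_0] = comb X`_0 X`_1 (col 0 (a_mx X x)) /\
  [lie x, X`_1] = comb X`_0 X`_1 (col 1 (a_mx X x)).
Proof.
move=> aX; rewrite -{1}(g1coordK aX (mem_derived x X`_0)).
rewrite -{1}(g1coordK aX (mem_derived x X`_1)).
by split; congr (comb _ _ _); apply/colP => i; rewrite !mxE.
Qed.

(** This is the precise sense in which the operators and the brackets outside the plane determine
    the Lie structure; antisymmetry supplies the remaining brackets. *)
Lemma adapted_basis_iso L M (X : seq L) (Y : seq M) : adapted X -> adapted Y ->
  size X = size Y -> (2 <= size X)%N ->
  (forall i, (2 <= i < size X)%N -> a_mx Y Y`_i = a_mx X X`_i) ->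
  (forall i j, (2 <= i < size X)%N -> (2 <= j < size X)%N ->
     g1coord Y [lie Y`_i, Y`_j] = g1coord X [lie X`_i, X`_j]) ->
  basis_iso X Y.
Proof.
move=> aX aY sXY s2 Ha Hb; have [bX _ X01] := aX; have [bY _ Y01] := aY.
apply: basis_iso_brackets => // f fXY.
have fn i : (i < size X)%N -> f X`_i = Y`_i.
  by move=> iX; rewrite -fXY (nth_map 0).
have f0 := fn 0%N (ltnW s2); have f1 := fn 1%N s2.
have fc u : f (comb X`_0 X`_1 u) = comb Y`_0 Y`_1 u.
  by rewrite /comb linearD !linearZ /= f0 f1.
have fa i : (2 <= i < size X)%N ->
    f [lie X`_i, X`_0] = [lie Y`_i, Y`_0] /\ f [lie X`_i, X`_1] = [lie Y`_i, Y`_1].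
  move=> iX; have [-> ->] := a_mxE X`_i aX; have [-> ->] := a_mxE Y`_i aY.
  by rewrite !fc Ha.
move: X01 Y01; rewrite /bvec /= => X01 Y01.
have X10 : [lie X`_1, X`_0] = 0 by rewrite lieC X01 oppr0.
have Y10 : [lie Y`_1, Y`_0] = 0 by rewrite lieC Y01 oppr0.
move=> [|[|i]] [|[|j]] iX jX; rewrite ?liexx ?X01 ?Y01 ?X10 ?Y10 ?linear0 //.
- by rewrite lieC linearN (fa j.+2 jX).1 -lieC.
- by rewrite lieC linearN (fa j.+2 jX).2 -lieC.
- by rewrite (fa i.+2 iX).1.
- by rewrite (fa i.+2 iX).2.
rewrite -(g1coordK aX (mem_derived X`_i.+2 _)) fc -Hb //.
by rewrite (g1coordK aY) // mem_derived.
Qed.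

Lemma adapted_exists L : \dim (derived L) = 2%N -> exists X : seq L, adapted X.
Proof.
move=> d2; have [p [q pq]] := dbasis_exists d2.
exists ([:: p; q] ++ vbasis ((derived L)^C)%VS); apply: adaptedP => //.
  rewrite -(addv_complf (derived L)); apply: cat_basis => //; last exact: vbasisP.
  by apply/directv_addP; exact: capv_compl.
exact: dbasis_lie0.
Qed.

Lemma derived_abel L : \dim (derived L) = 2%N ->
  subalg_iso (derived L) (abel K 2 : lieAlgType K).
Proof.
move=> d2; have [p [q pq]] := dbasis_exists d2; have [pD qD] := dbasis_mem pq.
have [|f [fI fL fpq]] := abel_emb (Z := [:: p; q]) erefl (basis_free pq).
  move=> x y; rewrite !inE => /orP[] /eqP-> /orP[] /eqP->; exact: derived2_abelian.
exists f; split=> //; apply: emb_image => //; first by rewrite -(span_basis pq).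
by rewrite d2 dim_abel.
Qed.

End Adapted.


(** * Isomorphism invariants *)

Section Invariants.
Context {K : fieldType}.
Implicit Types (L M : lieAlgType K) (d : g2data K).

(** These five properties separate the listed families: [has_eigen] sets [G321] and [G322] apart
    from [G323], [G421], [G423] and [affC] from [G422], and [G621] from [G622]; [has_jordan] sets
    [G322] apart from [G321]; [has_unit] sets [G423] and [affC] apart from [G421];
    [has_common_eigen] sets [G423] apart from [affC]; [has_split] sets [G423 l] with [l != 0] apart
    from [G423 0]. *)
Definition has_eigen L := exists x v c, [/\ v != 0, c != 0 & [lie x, v] = c *: v :> L].
Definition has_jordan L := exists x v w, [/\ v != 0, [lie x, v] = v & [lie x,
  w] = w + v :> L].
Definition has_unit L := exists x : L, forall y z : L, [lie x, [lie y, z]] = [lie y, z].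
Definition has_common_eigen L := exists y z : L, [lie y, z] != 0 /\
  forall x, exists c, [lie x, [lie y, z]] = c *: [lie y, z].
Definition has_split L := exists x y z w : L,
  [/\ [lie y, z] != 0, [lie x, [lie y, z]] = 0, w != 0 & [lie x, w] = w].

Section Transport.
Context {L M : lieAlgType K}.
Hypothesis LM : lie_iso L M.

Lemma has_eigen_iso : has_eigen L -> has_eigen M.
Proof.
have [f fB fL] := LM; move=> [x [v [c [v0 c0 E]]]]; exists (f x), (f v), c.
by rewrite -fL E linearZ -(linear0 f) (inj_eq (bij_inj fB)).
Qed.

Lemma has_jordan_iso : has_jordan L -> has_jordan M.
Proof.
have [f fB fL] := LM; move=> [x [v [w [v0 E1 E2]]]]; exists (f x), (f v), (f w).
by rewrite -!fL E1 E2 linearD -(linear0 f) (inj_eq (bij_inj fB)).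
Qed.

Lemma has_unit_iso : has_unit L -> has_unit M.
Proof.
have [f [g fK gK] fL] := LM; move=> [x E]; exists (f x) => y z.
by rewrite -(gK y) -(gK z) -!fL E.
Qed.

Lemma has_common_eigen_iso : has_common_eigen L -> has_common_eigen M.
Proof.
have [f fB fL] := LM; have [g fK gK] := fB; move=> [y [z [v0 E]]].
exists (f y), (f z); split; first by rewrite -fL -(linear0 f) (inj_eq (bij_inj fB)).
by move=> x; have [c Ec] := E (g x); exists c; rewrite -(gK x) -!fL Ec linearZ.
Qed.

Lemma has_split_iso : has_split L -> has_split M.
Proof.
have [f fB fL] := LM; have fI := inj_eq (bij_inj fB).
move=> [x [y [z [w [v0 E1 w0 E2]]]]]; exists (f x), (f y), (f z), (f w).
by rewrite -!fL E1 E2 -(linear0 f) !fI.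
Qed.
End Transport.

Section Target.
Context (n : nat) (d : g2data K).
Local Notation T := (g2alg n d).

Definition g2vec (u : 'cV[K]_2) : T := (u, 0).

Lemma g2vec0 u : (g2vec u == 0) = (u == 0).
Proof. by rewrite /g2vec -pair_eqE /= eqxx andbT. Qed.

Lemma g2bracketE (x y : T) : exists u, [lie x, y] = g2vec u.
Proof. by exists [lie x, y].1; apply: injective_projections. Qed.

Lemma g2lie_vec (x : T) u : [lie x, g2vec u] = g2vec (g2ad d x.2 *m u).
Proof.
apply: injective_projections => //=.
have -> : g2ad d (0 : 'cV[K]_(n - 2)) = 0.
  by rewrite /g2ad big1 // => i _; rewrite mxE scale0r.
have -> : g2form d x.2 0 = 0.
  rewrite /g2form big1 // => i _; rewrite big1 // => j _.
  by rewrite mxE mulr0 scale0r.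
by rewrite mul0mx subr0 addr0.
Qed.

(** Every bracket of the model has zero second component. *)
Lemma g2lie_eigen (x v : T) c : c != 0 -> [lie x, v] = c *: v -> exists u, v = g2vec u.
Proof.
move=> c0 E; exists v.1; apply: injective_projections => //=.
have /= := congr1 snd E => /esym/eqP; rewrite scaler_eq0 (negPf c0) /=.
by move/eqP.
Qed.

Definition g2gen (i : 'I_(n - 2)) : T := (0, delta_mx i 0).

Lemma g2ad_gen i : g2ad d (g2gen i).2 = g2op d i.+3.
Proof.
rewrite /g2ad (bigD1 i) //= big1 => [|j ji].
  by rewrite mxE !eqxx scale1r addr0.
by rewrite mxE (negPf ji) scale0r.
Qed.

Lemma g2gen_vec i u : [lie g2gen i, g2vec u] = g2vec (g2op d i.+3 *m u).
Proof. by rewrite g2lie_vec g2ad_gen. Qed.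

Lemma g2gen_gen i j : [lie g2gen i, g2gen j] = g2vec (g2br d i.+3 j.+3).
Proof.
apply: injective_projections => //=; rewrite !mulmx0 subr0 add0r.
rewrite /g2form (bigD1 i) //= [X in _ + X]big1 => [|k ki]; last first.
  by rewrite big1 // => l _; rewrite mxE (negPf ki) mul0r scale0r.
rewrite addr0 (bigD1 j) //= big1 => [|l lj]; last first.
  by rewrite !mxE (negPf lj) mulr0 scale0r.
by rewrite !mxE !eqxx mulr1 scale1r addr0.
Qed.

Lemma g2ad_single x : (forall i, g2op d i.+4 = 0) ->
  exists c, g2ad (n := n) d x = c *: g2op d 3.
Proof.
(* The sum has at most one term: it is the coordinate of index 0 when [n > 2], and 0 otherwise. *)
move=> d0; exists (\sum_(i < n - 2 | i == 0%N :> nat) x i 0).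
rewrite /g2ad scaler_suml [RHS]big_mkcond; apply: eq_bigr => -[[|i] Hi] _ //=.
by rewrite d0 scaler0.
Qed.

Lemma g2ad_two x : (forall i, g2op d i.+4.+1 = 0) ->
  exists c c', g2ad (n := n) d x = c *: g2op d 3 + c' *: g2op d 4.
Proof.
move=> d0; exists (\sum_(i < n - 2 | i == 0%N :> nat) x i 0),
  (\sum_(i < n - 2 | i == 1%N :> nat) x i 0).
rewrite /g2ad !scaler_suml ![X in _ = X + _]big_mkcond [X in _ = _ + X]big_mkcond.
rewrite -big_split; apply: eq_bigr => -[[|[|i]] Hi] _ //=.
- by rewrite addr0.
- by rewrite add0r.
- by rewrite d0 scaler0 addr0.
Qed.

End Target.

Lemma mx2_mul (a b c e : K) (u : 'cV[K]_2) :
  (mx2 a b c e *m u) 0 0 = a * u 0 0 + b * u 1 0 /\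
  (mx2 a b c e *m u) 1 0 = c * u 0 0 + e * u 1 0.
Proof. by rewrite !mxE !sum_ord2 !mxE. Qed.

End Invariants.

(** * The invariants evaluated on the listed algebras *)

Section TargetInvariants.
Context {R : realType}.

Lemma ops34_ge5 (A3 A4 : 'M[R]_2) i : ops34 A3 A4 i.+4.+1 = 0.
Proof. by []. Qed.

Lemma ops34_ge4 (A3 : 'M[R]_2) i : ops34 A3 0 i.+4 = 0.
Proof. by rewrite /ops34 /= if_same. Qed.

Lemma e1_neq0 : e1 R != 0.
Proof. by apply/eqP => /colP/(_ 0) /eqP; rewrite !mxE /= oner_eq0. Qed.

Lemma e2_neq0 : e2 R != 0.
Proof. by apply/eqP => /colP/(_ 1) /eqP; rewrite !mxE /= oner_eq0. Qed.

Lemma has_eigen_e1 n (d : g2data R) (hn : (2 < n)%N) : g2op d 3 *m e1 R = e1 R ->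
  has_eigen (g2alg n d).
Proof.
move=> E; have n0 : (0 < n - 2)%N by rewrite subn_gt0.
exists (g2gen d (Ordinal n0)), (g2vec n d (e1 R)), 1.
by rewrite g2vec0 e1_neq0 oner_neq0 scale1r g2gen_vec /= E.
Qed.

Lemma mx2_e1 (b e : R) : mx2 1 b 0 e *m e1 R = e1 R.
Proof. by have [M0 M1] := mx2_mul 1 b 0 e (e1 R); apply: cV2P;
  rewrite ?M0 ?M1 !mxE /=; ring. Qed.

Lemma eigen_321 l : has_eigen (G321 (R := R) l).
Proof. exact/has_eigen_e1/mx2_e1. Qed.
Lemma eigen_322 : has_eigen (G322 (R := R)).
Proof. exact/has_eigen_e1/mx2_e1. Qed.
Lemma eigen_421 : has_eigen (G421 (R := R)).
Proof. exact/has_eigen_e1/mx2_e1. Qed.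
Lemma eigen_621 k : has_eigen (G621 (R := R) k).
Proof. by apply: has_eigen_e1 => //; exact: mx2_e1. Qed.

Lemma has_unit_id (d : g2data R) : g2op d 4 = 1%:M ->
  has_unit (g2alg 4 d) /\ has_eigen (g2alg 4 d).
Proof.
move=> E; have n1 : (1 < 4 - 2)%N by [].
have H u : [lie g2gen d (Ordinal n1), g2vec 4 d u] = g2vec 4 d u.
  by rewrite g2gen_vec /= E mul1mx.
split; last by exists (g2gen d (Ordinal n1)), (g2vec 4 d (e1 R)), 1;
  rewrite g2vec0 e1_neq0 oner_neq0 scale1r H.
by exists (g2gen d (Ordinal n1)) => y z; have [u ->] := g2bracketE y z.
Qed.

Lemma unit_423 l : has_unit (G423 (R := R) l) /\ has_eigen (G423 (R := R) l).
Proof. exact: has_unit_id. Qed.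
Lemma unit_affC : has_unit (affC (R := R)) /\ has_eigen (affC (R := R)).
Proof. exact: has_unit_id. Qed.

Lemma no_eigen n (d : g2data R) : (forall i, g2op d i.+4 = 0) ->
  (forall (c : R) (u : 'cV[R]_2), c != 0 -> g2op d 3 *m u = c *: u -> u = 0) ->
  ~ has_eigen (g2alg n d).
Proof.
move=> d0 H [x [v [c [v0 c0 E]]]]; have [u Ev] := g2lie_eigen c0 E.
rewrite Ev g2lie_vec in E; have [a Ea] := g2ad_single x.2 d0.
have {}E : a *: (g2op d 3 *m u) = c *: u.
  by have := congr1 fst E; rewrite /= Ea -scalemxAl.
have a0 : a != 0.
  apply: contraNneq v0 => a0; rewrite Ev g2vec0; apply/eqP.
  by apply: (scalerI c0); rewrite -E a0 scale0r scaler0.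
case/negP: v0; rewrite Ev g2vec0; apply/eqP; apply: (H (c / a)).
  by rewrite mulf_neq0 ?invr_eq0.
by apply: (scalerI a0); rewrite E scalerA mulrC divfK.
Qed.

Lemma no_eigen_nilp n (d : g2data R) : (forall i, g2op d i.+4 = 0) ->
  g2op d 3 *m g2op d 3 = 0 -> ~ has_eigen (g2alg n d).
Proof.
move=> d0 dd; apply: no_eigen => // c u c0 E.
have : (g2op d 3 *m g2op d 3) *m u = (c * c) *: u
  by rewrite -mulmxA E -scalemxAr E scalerA.
rewrite dd mul0mx => /esym/eqP; rewrite scaler_eq0 mulf_eq0 (negPf c0) /=.
by move/eqP.
Qed.

Lemma no_eigen_323 phi : 0 < phi < pi -> ~ has_eigen (G323 (R := R) phi).
Proof.
move=> /sin_gt0_pi s0; apply: no_eigen; first exact: ops34_ge4.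
move=> c u c0; rewrite /= /ops34 /= => E;
  have [E0 E1] := mx2_mul (cos phi) (- sin phi) (sin phi) (cos phi) u.
rewrite E mxE in E0; rewrite E mxE in E1.
(* The determinant of [u] and its rotated image is [sin phi] times the squared norm of [u]; it
   vanishes for an eigenvector. *)
have : sin phi * (u 0 0 ^+ 2 + u 1 0 ^+ 2) = 0.
  have -> : sin phi * (u 0 0 ^+ 2 + u 1 0 ^+ 2) =
    u 0 0 * (sin phi * u 0 0 + cos phi * u 1 0) -
    u 1 0 * (cos phi * u 0 0 + - sin phi * u 1 0) by ring.
  by rewrite -E0 -E1; ring.
move=> /eqP; rewrite mulf_eq0 (gt_eqF s0) /= paddr_eq0 ?sqr_ge0 // !sqrf_eq0.
by move=> /andP[/eqP u0 /eqP u1]; apply: cV2P; rewrite mxE.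
Qed.

Lemma no_eigen_422 : ~ has_eigen (G422 (R := R)).
Proof.
apply: no_eigen_nilp; first exact: ops34_ge4.
by rewrite /= /ops34 /=; apply/matrixP => i j; rewrite !mxE sum_ord2 !mxE;
  case: i j => [[|[|i]] Hi] [[|[|j]] Hj] //=; ring.
Qed.

Lemma no_eigen_622 k : ~ has_eigen (G622 (R := R) k).
Proof.
apply: no_eigen_nilp; first exact: ops34_ge4.
by rewrite /= /ops34 /=; apply/matrixP => i j; rewrite !mxE sum_ord2 !mxE;
  case: i j => [[|[|i]] Hi] [[|[|j]] Hj] //=; ring.
Qed.

Lemma jordan_322 : has_jordan (G322 (R := R)).
Proof.
have n0 : (0 < 3 - 2)%N by [].
exists (g2gen d322 (Ordinal n0)), (g2vec 3 d322 (e1 R)), (g2vec 3 d322 (e2 R)).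
rewrite g2vec0 e1_neq0 !g2gen_vec /=; split=> //; first by rewrite /ops34 /= mx2_e1.
apply: injective_projections; rewrite /= ?addr0 // /ops34 /=.
by have [M0 M1] := mx2_mul 1 1 0 1 (e2 R); apply: cV2P; rewrite ?M0 ?M1 !mxE /=; ring.
Qed.

(** In each coordinate the operator is a scalar [e] with [(e - 1) * u = 0] and [(e - 1) * u' = u],
    whence [u ^+ 2 = 0]. *)
Lemma no_jordan_321 l : ~ has_jordan (G321 (R := R) l).
Proof.
move=> [x [v [w [v0 E1 E2]]]].
have [u Ev] : exists u, v = g2vec _ _ u by apply: (@g2lie_eigen _ _ _ x v 1);
  rewrite ?oner_neq0 ?scale1r.
have [u' Ew] : exists u', w = g2vec _ _ u'.
  exists w.1; apply: injective_projections => //=.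
  by have := congr1 snd E2; rewrite /= Ev /= addr0.
rewrite Ev Ew !g2lie_vec in E1 E2.
have [a Ea] := g2ad_single (d := d321 l) x.2 (ops34_ge4 _).
have F1 := congr1 fst E1; have F2 := congr1 fst E2.
rewrite /= Ea -scalemxAl in F1; rewrite /= Ea -scalemxAl in F2.
have [M0 M1] := mx2_mul 1 0 0 l u; have [N0 N1] := mx2_mul 1 0 0 l u'.
have p0 : a * u 0 0 = u 0 0 by have /colP/(_ 0) := F1; rewrite mxE M0 => Eq;
  rewrite -[RHS]Eq; ring.
have p1 : a * (l * u 1 0) = u 1 0 by have /colP/(_ 1) := F1; rewrite mxE M1 => Eq;
  rewrite -[RHS]Eq; ring.
have q0 : a * u' 0 0 = u' 0 0 + u 0 0.
  by have /colP/(_ 0) := F2; rewrite mxE [RHS]mxE N0 => Eq; rewrite -[RHS]Eq; ring.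
have q1 : a * (l * u' 1 0) = u' 1 0 + u 1 0.
  by have /colP/(_ 1) := F2; rewrite mxE [RHS]mxE N1 => Eq; rewrite -[RHS]Eq; ring.
case/negP: v0; rewrite Ev g2vec0; apply/eqP; apply: cV2P; rewrite mxE.
  have : u 0 0 ^+ 2 = 0.
    have -> : u 0 0 ^+ 2 = u 0 0 * (a * u' 0 0 - u' 0 0) by rewrite q0; ring.
    by rewrite mulrBr mulrCA mulrA p0 subrr.
  by move/eqP; rewrite sqrf_eq0 => /eqP.
have : u 1 0 ^+ 2 = 0.
  have -> : u 1 0 ^+ 2 = u 1 0 * (a * (l * u' 1 0) - u' 1 0) by rewrite q1; ring.
  have -> : u 1 0 * (a * (l * u' 1 0) - u' 1 0) = u' 1 0 * (a * (l * u 1 0) - u 1 0)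
    by ring.
  by rewrite p1 subrr mulr0.
by move/eqP; rewrite sqrf_eq0 => /eqP.
Qed.

(** The nonzero bracket [[X_3, X_4] = X_2] is in the kernel of [a_{X_3}], hence is killed by every
    [ad x]. *)
Lemma no_unit_421 : ~ has_unit (G421 (R := R)).
Proof.
move=> [x E]; have n0 : (0 < 4 - 2)%N by []; have n1 : (1 < 4 - 2)%N by [].
have := E (g2gen d421 (Ordinal n0)) (g2gen d421 (Ordinal n1)).
rewrite g2gen_gen g2lie_vec /= /bralt /brlist /= subr0.
have [a ->] := g2ad_single (d := d421) x.2 (ops34_ge4 _).
rewrite -scalemxAl /= /ops34 /= mx2_e2 scaler0 => /eqP.
by rewrite eq_sym g2vec0 (negPf e2_neq0).
Qed.

(** [X_1] is killed by [X_3] and fixed by [X_4]. *)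
Lemma common_423 l : has_common_eigen (G423 (R := R) l).
Proof.
have n1 : (1 < 4 - 2)%N by [].
exists (g2gen (d423 l) (Ordinal n1)), (g2vec 4 (d423 l) (e1 R)).
rewrite g2gen_vec /= /ops34 /= mul1mx g2vec0 e1_neq0; split=> // x.
have [a [b E]] := g2ad_two (d := d423 l) x.2 (ops34_ge5 _ _).
exists b; rewrite g2lie_vec E /= /ops34 /=; apply: injective_projections;
  rewrite /= ?scaler0 //.
rewrite mulmxDl -!scalemxAl mul1mx.
suff -> : mx2 0 1 0 l *m e1 R = 0 by rewrite scaler0 add0r.
by have [M0 M1] := mx2_mul 0 1 0 l (e1 R); apply: cV2P; rewrite ?M0 ?M1 !mxE /=; ring.
Qed.

(** A common eigenvector would be a real eigenvector of the complex structure [a_{X_3}], with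
    [c ^+ 2 + 1 = 0]. *)
Lemma no_common_affC : ~ has_common_eigen (affC (R := R)).
Proof.
move=> [y [z [v0 E]]]; have [u Eu] := g2bracketE y z; rewrite Eu g2vec0 in v0.
have n0 : (0 < 4 - 2)%N by [].
have [c] := E (g2gen daffC (Ordinal n0)); rewrite Eu g2gen_vec => /(congr1 fst) /=.
rewrite /ops34 /= => Ec; have [E0 E1] := mx2_mul 0 1 (-1) 0 u.
rewrite Ec mxE in E0; rewrite Ec mxE in E1.
have : (c ^+ 2 + 1) * u 0 0 = 0.
  have -> : (c ^+ 2 + 1) * u 0 0 = c * (c * u 0 0) + u 0 0 by ring.
  rewrite E0; have -> : c * (0 * u 0 0 + 1 * u 1 0) = c * u 1 0 by ring.
  by rewrite E1; ring.
move/eqP; rewrite mulf_eq0 gt_eqF ?ltr_wpDl ?sqr_ge0 //= => /eqP u0.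
have u1 : u 1 0 = 0 by move: E0; rewrite u0; lra.
by case/eqP: v0; apply: cV2P; rewrite ?u0 ?u1 mxE.
Qed.

Lemma split_423 l : l != 0 -> has_split (G423 (R := R) l).
Proof.
move=> l0; have n0 : (0 < 4 - 2)%N by []; have n1 : (1 < 4 - 2)%N by [].
(* [w] spans the eigenline of [a_{X_3}] for [l], an eigenvalue that division by [l] turns into 1;
   [X_1] spans its kernel and is the bracket of [X_4] and [X_1]. *)
pose d := d423 l; pose w : 'cV[R]_2 := e1 R + l *: e2 R.
exists (l^-1 *: g2gen d (Ordinal n0)), (g2gen d (Ordinal n1)), (g2vec 4 d (e1 R)),
  (g2vec 4 d w).
rewrite !lie_scale_l !g2gen_vec /= /ops34 /= mul1mx !g2vec0 e1_neq0.
split=> //.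
- suff -> : mx2 0 1 0 l *m e1 R = 0 by apply: injective_projections; rewrite /= scaler0.
  by have [M0 M1] := mx2_mul 0 1 0 l (e1 R); apply: cV2P; rewrite ?M0 ?M1 !mxE /=; ring.
- by apply/eqP => /colP/(_ 0)/eqP; rewrite !mxE /= mulr0 addr0 oner_eq0.
- apply: injective_projections; rewrite /= ?scaler0 //.
  by have [M0 M1] := mx2_mul 0 1 0 l w; apply: cV2P; rewrite mxE ?M0 ?M1 !mxE /=; field.
Qed.

(** The operators are [a N + b] with [N] nilpotent: killing a nonzero vector forces [b = 0], and
    then 1 is not an eigenvalue. *)
Lemma no_split_423 : ~ has_split (G423 (R := R) 0).
Proof.
move=> [x [y [z [w [v0 E1 w0 E2]]]]]; have [u Eu] := g2bracketE y z.
rewrite Eu g2vec0 in v0; rewrite Eu in E1.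
have [u' Ew] : exists u, w = g2vec _ _ u by apply: (@g2lie_eigen _ _ _ x w 1);
  rewrite ?oner_neq0 ?scale1r.
rewrite Ew g2vec0 in w0; rewrite Ew in E2; rewrite !g2lie_vec in E1 E2.
have [a [b E]] := g2ad_two (d := d423 0) x.2 (ops34_ge5 _ _).
have F1 := congr1 fst E1; have F2 := congr1 fst E2.
rewrite /= E /= /ops34 /= mulmxDl -!scalemxAl mul1mx in F1.
rewrite /= E /= /ops34 /= mulmxDl -!scalemxAl mul1mx in F2.
have [M0 M1] := mx2_mul (0 : R) 1 0 0 u; have [N0 N1] := mx2_mul (0 : R) 1 0 0 u'.
have p0 : a * u 1 0 + b * u 0 0 = 0.
  by have /colP/(_ 0) := F1; rewrite [LHS]mxE [X in X + _]mxE [X in _ + X]mxE M0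
    ?[RHS]mxE => Eq; rewrite -[RHS]Eq; ring.
have p1 : b * u 1 0 = 0.
  by have /colP/(_ 1) := F1; rewrite [LHS]mxE [X in X + _]mxE [X in _ + X]mxE M1
    ?[RHS]mxE => Eq; rewrite -[RHS]Eq; ring.
have q0 : a * u' 1 0 + b * u' 0 0 = u' 0 0.
  by have /colP/(_ 0) := F2; rewrite [LHS]mxE [X in X + _]mxE [X in _ + X]mxE N0
    ?[RHS]mxE => Eq; rewrite -[RHS]Eq; ring.
have q1 : b * u' 1 0 = u' 1 0.
  by have /colP/(_ 1) := F2; rewrite [LHS]mxE [X in X + _]mxE [X in _ + X]mxE N1
    ?[RHS]mxE => Eq; rewrite -[RHS]Eq; ring.
have b0 : b = 0.
  apply/eqP/negPn/negP => b0; case/eqP: v0; apply: cV2P; rewrite mxE.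
    apply: (mulfI b0); rewrite mulr0.
    move/eqP: p1; rewrite mulf_eq0 (negPf b0) /= => /eqP u1.
    by move: p0; rewrite u1 mulr0 add0r.
  by move/eqP: p1; rewrite mulf_eq0 (negPf b0) /= => /eqP.
case/eqP: w0; rewrite b0 mul0r in q1; rewrite -q1 b0 in q0.
by apply: cV2P; rewrite mxE // -q0; ring.
Qed.

End TargetInvariants.


(** * The theorem *)

Lemma one_and_only_oneP (Ps : seq Prop) : (exists i, nth False Ps i) ->
  (forall i j, (i < j)%N -> nth False Ps i -> nth False Ps j -> False) ->
  one_and_only_one Ps.
Proof.
move=> [i Pi] H; exists i; split=> // j Pj.
by have [ij|ji|//] := ltngtP i j; [case: (H i j) | case: (H j i)].
Qed.

Lemma mx2_unit (K : fieldType) (a b c e : K) : a * e - b * c != 0 ->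
  mx2 a b c e \in unitmx.
Proof.
set D := a * e - b * c => D0.
have /mulmx1_unit[] // : mx2 a b c e *m (D^-1 *: mx2 e (- b) (- c) a) = 1%:M.
have dD : D^-1 * D = 1 by rewrite mulVf.
apply/matrixP => i j; rewrite !mxE sum_ord2 !mxE.
by case: i j => [[|[|i]] Hi] [[|[|j]] Hj] //=; rewrite -?dD /D /=; ring.
Qed.

(** * Pairwise exclusion and the indecomposable case *)

Section Exclusion.
Context {R : realType} {G : lieAlgType R}.

Lemma lie_iso_transport (P : lieAlgType R -> Prop) (A B : lieAlgType R) :
  (forall L M : lieAlgType R, lie_iso L M -> P L -> P M) ->
  lie_iso G A -> lie_iso G B -> P A -> P B.
Proof. by move=> HP GA GB; apply: HP; exact: lie_iso_trans (lie_iso_sym GA) GB. Qed.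

Lemma disjoint_dim3 i j : (i < j)%N ->
  nth False [:: exists2 l : R, l != 0 & lie_iso G (G321 l); lie_iso G G322;
    exists2 phi : R, 0 < phi < pi & lie_iso G (G323 phi)] i ->
  nth False [:: exists2 l : R, l != 0 & lie_iso G (G321 l); lie_iso G G322;
    exists2 phi : R, 0 < phi < pi & lie_iso G (G323 phi)] j -> False.
Proof.
case: i j => [|[|[|i]]] [|[|[|j]]] //= _; rewrite ?nth_nil //.
- move=> [l _ G1] G2; apply: (@no_jordan_321 R l).
  exact: lie_iso_transport (@has_jordan_iso _) G2 G1 jordan_322.
- move=> [l _ G1] [phi hphi G2]; apply: (no_eigen_323 hphi).
  exact: lie_iso_transport (@has_eigen_iso _) G1 G2 (eigen_321 l).
- move=> G1 [phi hphi G2]; apply: (no_eigen_323 hphi).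
  exact: lie_iso_transport (@has_eigen_iso _) G1 G2 eigen_322.
Qed.

Lemma disjoint_dim4 i j : (i < j)%N ->
  nth False [:: lie_iso G G421; lie_iso G G422;
    exists l : R, lie_iso G (G423 l); lie_iso G affC] i ->
  nth False [:: lie_iso G G421; lie_iso G G422;
    exists l : R, lie_iso G (G423 l); lie_iso G affC] j -> False.
Proof.
case: i j => [|[|[|[|i]]]] [|[|[|[|j]]]] //= _; rewrite ?nth_nil //.
- move=> G1 G2; apply: (@no_eigen_422 R).
  exact: lie_iso_transport (@has_eigen_iso _) G1 G2 eigen_421.
- move=> G1 [l G2]; apply: (@no_unit_421 R).
  exact: lie_iso_transport (@has_unit_iso _) G2 G1 (unit_423 l).1.
- move=> G1 G2; apply: (@no_unit_421 R).
  exact: lie_iso_transport (@has_unit_iso _) G2 G1 unit_affC.1.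
- move=> G1 [l G2]; apply: (@no_eigen_422 R).
  exact: lie_iso_transport (@has_eigen_iso _) G2 G1 (unit_423 l).2.
- move=> G1 G2; apply: (@no_eigen_422 R).
  exact: lie_iso_transport (@has_eigen_iso _) G2 G1 unit_affC.2.
- move=> [l G1] G2; apply: (@no_common_affC R).
  exact: lie_iso_transport (@has_common_eigen_iso _) G1 G2 (common_423 l).
Qed.

Lemma disjoint_dim6 k i j : (i < j)%N ->
  nth False [:: lie_iso G (G621 k); lie_iso G (G622 k)] i ->
  nth False [:: lie_iso G (G621 k); lie_iso G (G622 k)] j -> False.
Proof.
case: i j => [|[|i]] [|[|j]] //= _; rewrite ?nth_nil // => G1 G2.
apply: (@no_eigen_622 R k).
exact: lie_iso_transport (@has_eigen_iso _) G1 G2 (eigen_621 k).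
Qed.

Lemma listed_frame m (d : g2data R) : frame_data m d -> listed (g2alg m d).
Proof.
case=> [l l0||phi hphi|||||k|k|k].
- exact: listed_321.
- exact: listed_322.
- exact: listed_323.
- exact: listed_421.
- exact: listed_422.
- exact: listed_423.
- exact: listed_affC.
- exact: listed_52.
- exact: listed_621.
- exact: listed_622.
Qed.

(** A nonempty [Z], and likewise each of the two other forms, would exhibit [G] as a direct sum of
    nonzero algebras. *)
Lemma indecomposable_frame : \dim (derived G) = 2%N -> ~ nilpotent2 G ->
  ~ decomposable G -> exists m d (X : seq G), [/\ frame_data m d, size X = m,
    adapted X, g2frame X d & lie_iso G (g2alg m d)].
Proof.
move=> d2 nn nd; have dab k : \dim {: abel R k : lieAlgType R} = k := dim_abel k.
have [[m [d [X [Z [fd _ [sX bXZ cZ X01 fX]]]]]]|/aff_aff_lie_iso[k [_ I]]|] :=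
  classification d2 nn.
- have m2 := frame_data_ge fd; have I := frame_lie_iso m2 sX bXZ cZ fX.
  have Z0 : Z = [::].
    apply/nilP; rewrite /nilp eqn0Ngt; apply/negP => Z0; apply: nd.
    by apply: (lie_iso_decomposable I); rewrite ?dim_g2alg ?dab // ltnW.
  rewrite Z0 cats0 in bXZ; rewrite Z0 in I.
  exists m, d, X; split=> //; last exact: lie_iso_abel0.
  by apply: adaptedP => //; case: fX.
- case: nd; case: k I => [/lie_iso_abel0|k] I.
    by apply: (lie_iso_decomposable I); rewrite dim_aff.
  by apply: (lie_iso_decomposable I); rewrite ?dim_lie_prod ?dim_aff ?dab.
- move=> /aff_heis_lie_iso[m [k [m1 _ I]]].
  case: nd; case: k I => [/lie_iso_abel0|k] I.
    by apply: (lie_iso_decomposable I); rewrite ?dim_aff ?dim_heis ?addn1.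
  by apply: (lie_iso_decomposable I); rewrite ?dim_lie_prod ?dim_aff ?dab.
Qed.

End Exclusion.

Theorem theorem3p4 (R : realType) (n : nat) (G : lieAlgType R)
  (hn : (3 <= n)%N)
  (hdim : \dim {:G} = n)
  (hsolv : solvable_lie G)
  (hder : \dim (derived G) = 2%N)
  (hnil : ~ nilpotent2 G) :
  exists X : seq G,
    adapted X /\ subalg_iso (derived G) (abel R 2 : lieAlgType R) /\
    (* (1) *)
    (~ decomposable G ->
      (* (1.1) *)
      (n = 3%N ->
        a_mx X (bvec X 3) \in unitmx /\
        (forall (H : lieAlgType R) (Y : seq H), adapted Y -> size Y = n ->
           a_mx Y (bvec Y 3) = a_mx X (bvec X 3) -> basis_iso X Y) /\
        [\/ exists2 l : R, l != 0 & g2basis X (d321 l),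
            g2basis X d322
          | exists2 phi : R, 0 < phi < pi & g2basis X (d323 phi)] /\
        one_and_only_one
          [:: exists2 l : R, l != 0 & lie_iso G (G321 l);
              lie_iso G G322;
              exists2 phi : R, 0 < phi < pi & lie_iso G (G323 phi)]) /\
      (* (1.2) *)
      (n = 4%N ->
        (forall (H : lieAlgType R) (Y : seq H), adapted Y -> size Y = n ->
           a_mx Y (bvec Y 3) = a_mx X (bvec X 3) ->
           a_mx Y (bvec Y 4) = a_mx X (bvec X 4) ->
           g1coord Y [lie bvec Y 3, bvec Y 4] =
             g1coord X [lie bvec X 3, bvec X 4] ->
           basis_iso X Y) /\
        [\/ g2basis X d421,
            g2basis X d422,
            exists l : R, g2basis X (d423 l)
          | g2basis X daffC] /\
        one_and_only_one
          [:: lie_iso G G421;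
              lie_iso G G422;
              exists l : R, lie_iso G (G423 l);
              lie_iso G affC] /\
        (forall l l' : R,
           lie_iso G (G423 l) -> lie_iso G (G423 l') -> l = l')) /\
      (* (1.3) *)
      (forall k : nat, n = (5 + 2 * k)%N ->
        g2basis X (d52 k) /\ lie_iso G (G52 k)) /\
      (* (1.4) *)
      (forall k : nat, n = (6 + 2 * k)%N ->
        (g2basis X (d621 k) \/ g2basis X (d622 k)) /\
        one_and_only_one [:: lie_iso G (G621 k); lie_iso G (G622 k)])) /\
    (* (2) *)
    (decomposable G ->
      [\/ (* (2.1) *)
          (n = 4%N /\ lie_iso G (aff R * aff R)%type) \/
          ((4 < n)%N /\ lie_iso G (aff R * aff R * abel R (n - 4))%type),
          (* (2.2) *)
          (exists2 m : nat, (1 <= m)%N &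
             (n = (2 * m + 3)%N /\ lie_iso G (aff R * heis R m)%type) \/
             ((2 * m + 3 < n)%N /\
                lie_iso G (aff R * heis R m * abel R (n - 2 * m - 3))%type))
        | (* (2.3) *)
          exists (L : lieAlgType R) (k : nat),
            [/\ listed L, (1 <= k)%N & lie_iso G (L * abel R k)%type]]).
Proof.
have [dG|ndG] := pselect (decomposable G).
  (* In the decomposable case nothing beyond adaptedness is asked of the basis. *)
  have [X aX] := adapted_exists hder; exists X; split=> //.
  split; first exact: derived_abel.
  split=> // _.
  have [[m [d [Y [Z [fd ndZ [sY bYZ cZ _ fY]]]]]]|/aff_aff_lie_iso[k [nk I]]|] :=
    classification hder hnil.
  - apply: Or33; exists (g2alg m d : lieAlgType R), (size Z).
    split; first exact: listed_frame.
      (* An empty [Z] would make [G] indecomposable, so the abelian factor is nontrivial. *)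
      by rewrite lt0n; apply/negP => /eqP/size0nil/ndZ.
    exact: frame_lie_iso (frame_data_ge fd) sY bYZ cZ fY.
  - apply: Or31; rewrite hdim in nk; case: k nk I => [|k] nk I.
      by left; split; [rewrite nk | exact: lie_iso_abel0].
    right; split; first by rewrite nk; lia.
    by have -> : (n - 4 = k.+1)%N by lia.
  - move=> /aff_heis_lie_iso[m [k [m1 nk I]]]; apply: Or32; exists m => //.
    rewrite hdim in nk; case: k nk I => [|k] nk I.
      by left; split; [rewrite nk addn0 | exact: lie_iso_abel0].
    right; split; first by rewrite nk; lia.
    by have -> : (n - 2 * m - 3 = k.+1)%N by lia.
have [m [d [X [fd sX aX fX I]]]] := indecomposable_frame hder hnil ndG.
have [bX _ _] := aX.
have sXn : size X = n by rewrite -hdim (dim_basis bX).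
have nm : n = m by rewrite -sXn.
have gb : g2basis X d.
  apply: g2frame_basis => //; last by rewrite sXn ltnW.
  by rewrite -[X](cat_take_drop 2) in bX; exact: catl_free (basis_free bX).
have am3 : a_mx X (bvec X 3) = g2op d 3 by case: gb => ->; rewrite // sXn.
exists X; split=> //; split; first exact: derived_abel.
split=> // _; split; last split; last split.
- move=> n3; split; last split; last split.
  + rewrite am3; rewrite {1}nm in n3.
    case: fd n3 => [l l0||phi hphi|||||k|k|k] // _.
    * by apply: mx2_unit; rewrite mul1r mul0r subr0.
    * by apply: mx2_unit; rewrite mul1r mulr0 subr0 oner_neq0.
    * apply: mx2_unit; rewrite mulNr opprK -!expr2 cos2Dsin2; exact: oner_neq0.
  + move=> H Y aY sY E; apply: adapted_basis_iso; rewrite ?sXn ?sY ?n3 //.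
      by move=> [|[|[|i]]] // _; exact: E.
    by move=> [|[|[|i]]] // [|[|[|j]]] // _ _; rewrite !liexx; apply/colP => i;
       rewrite !mxE !linear0.
  + rewrite {1}nm in n3.
    case: fd n3 gb => [l l0||phi hphi|||||k|k|k] // _ gb.
    * by apply: Or31; exists l.
    * exact: Or32.
    * by apply: Or33; exists phi.
  + apply: one_and_only_oneP; last exact: disjoint_dim3.
    rewrite {1}nm in n3.
    case: fd n3 I => [l l0||phi hphi|||||k|k|k] // _ I.
    * by exists 0%N; exists l.
    * by exists 1%N.
    * by exists 2%N; exists phi.
- move=> n4; split; last split; last split.
  + move=> H Y aY sY E3 E4 E34; apply: adapted_basis_iso; rewrite ?sXn ?sY ?n4 //.
      by move=> [|[|[|[|i]]]].
    have g0 (L : lieAlgType R) (W : seq L) : g1coord W 0 = 0.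
      by apply/colP => i; rewrite !mxE linear0.
    have gN (L : lieAlgType R) (W : seq L) v : g1coord W (- v) = - g1coord W v.
      by apply/colP => i; rewrite !mxE linearN.
    move=> [|[|[|[|i]]]] // [|[|[|[|j]]]] // _ _; rewrite ?liexx ?g0 //.
    by rewrite lieC gN (lieC X`_3) gN; congr (- _).
  + rewrite {1}nm in n4.
    case: fd n4 gb => [l l0||phi hphi|||||k|k|k] // _ gb.
    * exact: Or41.
    * exact: Or42.
    * by apply: Or43; exists 0.
    * exact: Or44.
  + apply: one_and_only_oneP; last exact: disjoint_dim4.
    rewrite {1}nm in n4.
    case: fd n4 I => [l l0||phi hphi|||||k|k|k] // _ I.
    * by exists 0%N.
    * by exists 1%N.
    * by exists 2%N; exists 0.
    * by exists 3%N.
  (* Every parameter is 0: a [G423 l] with [l != 0] is kept apart from [G421], [G422] and [affC] by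
     the exclusions between families, and from [G423 0] by [has_split]. *)
  + suff l0 l : lie_iso G (G423 l) -> l = 0 by move=> l l' /l0-> /l0->.
    move=> Gl; apply/eqP/negPn/negP => ln.
    rewrite {1}nm in n4.
    have Gl' : exists l, lie_iso G (G423 l) by exists l.
    case: fd n4 I => [l' l0||phi hphi|||||k|k|k] // _ I.
    * exact: (@disjoint_dim4 R G 0 2 isT I Gl').
    * exact: (@disjoint_dim4 R G 1 2 isT I Gl').
    * apply: (@no_split_423 R).
      exact: lie_iso_transport (@has_split_iso _) Gl I (split_423 ln).
    * exact: (@disjoint_dim4 R G 2 3 isT Gl' I).
- move=> k nk; rewrite {1}nm in nk.
  (* Size and parity of [n] leave only [d52], with the same [k]. *)
  case: fd nk gb I => [l l0||phi hphi|||||k'|k'|k'] nk gb I; try by exfalso; lia.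
  by have <- : k' = k by lia.
- move=> k nk; rewrite {1}nm in nk.
  case: fd nk gb I => [l l0||phi hphi|||||k'|k'|k'] nk gb I; try by exfalso; lia.
  + have kk : k' = k by lia.
    rewrite kk in gb I; split; first by left.
    by apply: one_and_only_oneP; [exists 0%N | exact: disjoint_dim6].
  + have kk : k' = k by lia.
    rewrite kk in gb I; split; first by right.
    by apply: one_and_only_oneP; [exists 1%N | exact: disjoint_dim6].
Qed.
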